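(* The following hold in $\mathbf{ZF}$. (i) The following statements are all equivalent: (1) every cuf union of cuf sets is a cuf set; (2) every countable union of cuf sets is a cuf set; (3) every countable product of quasi-metrizable cofinite spaces is quasi-metrizable; (4) every cuf product of cofinite cuf spaces is quasi-metrizable; (5) every cuf product of cofinite cuf spaces is first-countable; (6) every cuf product of cofinite cuf spaces is of countable pseudocharacter; (7) every cuf product of cofinite cuf spaces is of cuf pseudocharacter; (8) every cuf product of one-point Hausdorff compactifications of infinite discrete cuf spaces is metrizable. (ii) The following statements are all equivalent: (1) every countable union of countable sets is a cuf set; (2) every countable product of quasi-metrizable countable cofinite spaces is quasi-metrizable; (3) every cuf product of countable cofinite spaces is quasi-metrizable; (4) every cuf product of countable cofinite spaces is first-countable; (5) every cuf product of countable cofinite spaces is of countable pseudocharacter; (6) every cuf product of countable cofinite spaces is of cuf pseudocharacter; (7) every cuf product of one-point Hausdorff compactifications of denumerable discrete spaces is metrizable. (iii) In (i) and (ii), cuf products can be replaced with countable products, i.e. the equivalences remain true when in the listed statements ''cuf product'' is replaced by ''countable product''.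
   Context: The theory is $\mathbf{ZF}$ (no choice). A set is countable if it is equipotent with a subset of $\omega$, denumerable if it is infinite and countable. A cuf set is a set which is a countable union of finite sets. A cuf union is a union of a family of sets indexed by a cuf set. A cuf space is a topological space whose underlying set is a cuf set. A cofinite space is a set $X$ with the cofinite topology $\{\emptyset\}\cup\{U\subseteq X: X\setminus U\text{ is finite}\}$; a cofinite cuf space is a cuf set with its cofinite topology. Products carry the Tychonoff topology; a cuf product (countable product) is a product $\prod_{j\in J}\mathbf{X}_j$ with $J$ a non-empty cuf (countable) set. A quasi-metric on $X$ is $d:X\times X\to[0,+\infty)$ with $d(x,x)=0$, $d(x,y)\le d(x,z)+d(z,y)$, and $d(x,y)=0\Rightarrow x=y$; its topology $\tau(d)$ consists of all $V\subseteq X$ such that for every $x\in V$ there is $n\in\omega$ with $\{y: d(x,y)<2^{-n}\}\subseteq V$. A space $\langle X,\tau\rangle$ is quasi-metrizable if $\tau=\tau(d)$ for some quasi-metric $d$ on $X$. A pseudobase at a point $x$ is a family $\mathcal{U}$ of open sets with $\bigcap\mathcal{U}=\{x\}$. A space is of countable pseudocharacter if every singleton is a $G_\delta$ set, and of cuf pseudocharacter if every point has a pseudobase which is a cuf set. The one-point Hausdorff compactification of an infinite discrete space $X$ is $X\cup\{\infty\}$ ($\infty\notin X$), where all subsets of $X$ are open and a set containing $\infty$ is open iff its complement is finite. *)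

(* Defs.v *)
From mathcomp Require Import ssreflect ssrbool seq.

(* "Holds in ZF" is read as "holds in every model of ZF".  A model is a
   first-order structure in which equality is Rocq's equality.  The schemas of
   separation and replacement range over first-order formulas only (not over
   all Rocq predicates), so a choice principle of the metatheory yields no
   choice in the model. *)

Record structure := Structure {
  domain :> Type;
  elem : domain -> domain -> Prop
}.
Arguments elem {s} x y.

Notation "x ∈ y" := (elem x y) (at level 70, no associativity).

(* De Bruijn indices: under a quantifier, index 0 is the bound variable. *)
Inductive formula : Type :=
| fElem (i j : nat)
| fEq (i j : nat)
| fFalse
| fImp (p q : formula)
| fAnd (p q : formula)
| fOr (p q : formula)
| fAll (p : formula)
| fEx (p : formula).

Definition extend {M : structure} (x : M) (env : nat -> M) : nat -> M :=
  fun n => match n with O => x | S k => env k end.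

Fixpoint sat {M : structure} (env : nat -> M) (p : formula) : Prop :=
  match p with
  | fElem i j => env i ∈ env j
  | fEq i j => env i = env j
  | fFalse => False
  | fImp p q => sat env p -> sat env q
  | fAnd p q => sat env p /\ sat env q
  | fOr p q => sat env p \/ sat env q
  | fAll p => forall x : M, sat (extend x env) p
  | fEx p => exists x : M, sat (extend x env) p
  end.

(* Everything in this section quantifies over elements of M only, so that,
   once the predicate arguments are instantiated, each definition is the
   interpretation in M of a first-order formula of set theory.  Set-theoretic
   operations are rendered by their graphs: [is_op x a b] means [x = op a b],
   whereas maps, dist, iterate and the nat_ operations take the result last. *)
Section SetTheory.
Context {M : structure}.
Implicit Types (x y z a b c f p q r s t w A B C D F J K P R S T U V X : M).

Definition subset A B := forall x, x ∈ A -> x ∈ B.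

Definition is_empty A := forall x, ~ x ∈ A.

Definition nonempty A := exists x, x ∈ A.

Definition is_upair p x y := forall z, z ∈ p <-> z = x \/ z = y.

Definition is_succ y x := forall z, z ∈ y <-> z ∈ x \/ z = x.

Definition inductive_set w :=
  (exists z, is_empty z /\ z ∈ w) /\
  (forall x, x ∈ w -> exists y, is_succ y x /\ y ∈ w).

Definition extensionality :=
  forall A B, (forall x, x ∈ A <-> x ∈ B) -> A = B.

Definition foundation :=
  forall A, nonempty A -> exists x, x ∈ A /\ forall y, ~ (y ∈ x /\ y ∈ A).

Definition pairing := forall x y, exists p, is_upair p x y.

Definition union_axiom :=
  forall C, exists U, forall x, x ∈ U <-> exists A, A ∈ C /\ x ∈ A.

Definition power_set := forall A, exists P, forall B, B ∈ P <-> subset B A.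

Definition infinity := exists w, inductive_set w.

Definition separation :=
  forall (phi : formula) (env : nat -> M) A, exists B,
    forall x, x ∈ B <-> x ∈ A /\ sat (extend x env) phi.

Definition replacement :=
  forall (phi : formula) (env : nat -> M) A,
    (forall x, x ∈ A -> exists! y, sat (extend x (extend y env)) phi) ->
    exists B, forall y,
      y ∈ B <-> exists x, x ∈ A /\ sat (extend x (extend y env)) phi.

Definition models_ZF :=
  [/\ extensionality, foundation, pairing & union_axiom] /\
  [/\ power_set, infinity, separation & replacement].

(* Kuratowski pairs. *)
Definition is_opair p x y :=
  exists a b, is_upair a x x /\ is_upair b x y /\ is_upair p a b.

Definition maps f x y := exists p, is_opair p x y /\ p ∈ f.

(* F is a function with domain J, i.e. a family of sets indexed by J. *)
Definition is_family F J :=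
  (forall p, p ∈ F -> exists x y, x ∈ J /\ is_opair p x y) /\
  (forall x, x ∈ J -> exists! y, maps F x y).

Definition is_function f A B :=
  is_family f A /\ (forall x y, maps f x y -> y ∈ B).

Definition is_cartesian P A B :=
  forall p, p ∈ P <-> exists x y, x ∈ A /\ y ∈ B /\ is_opair p x y.

Definition is_family_union U F :=
  forall x, x ∈ U <-> exists j A, maps F j A /\ x ∈ A.

Definition is_omega w :=
  inductive_set w /\ forall w', inductive_set w' -> subset w w'.

Definition is_nat x := exists w, is_omega w /\ x ∈ w.

Definition equipotent A B :=
  exists f, is_function f A B /\
    forall y, y ∈ B -> exists! x, maps f x y.

Definition finite A := exists n, is_nat n /\ equipotent A n.

Definition infinite A := ~ finite A.

Definition countable A :=
  exists w s, is_omega w /\ subset s w /\ equipotent A s.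

Definition denumerable A := infinite A /\ countable A.

Definition cuf A :=
  exists J F, countable J /\ is_family F J /\
    (forall j B, maps F j B -> finite B) /\ is_family_union A F.

(* c is the b-th term of the sequence u in omega with u_0 = a and
   [step u_i u_(i+1)]. *)
Definition iterate (step : M -> M -> Prop) a b c :=
  exists w u, is_omega w /\ is_function u w w /\
    (forall z, is_empty z -> maps u z a) /\
    (forall i i' x y, is_succ i' i -> maps u i x -> maps u i' y -> step x y) /\
    maps u b c.

Definition nat_add a b c := iterate (fun x y => is_succ y x) a b c.

Definition nat_mul a b c :=
  exists z, is_empty z /\ iterate (fun x y => nat_add x a y) z b c.

Definition nat_pow2 n c :=
  exists z e, is_empty z /\ is_succ e z /\
    iterate (fun x y => nat_add x x y) e n c.

(* The (unreduced) fraction p / q is the ordered pair of the natural numbers p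
   and q, where q is nonzero. *)
Definition is_fraction x p q :=
  is_nat p /\ is_nat q /\ ~ is_empty q /\ is_opair x p q.

Definition frac_lt x y :=
  exists p q p' q' a b, is_fraction x p q /\ is_fraction y p' q' /\
    nat_mul p q' a /\ nat_mul p' q b /\ a ∈ b.

Definition frac_le x y :=
  exists p q p' q' a b, is_fraction x p q /\ is_fraction y p' q' /\
    nat_mul p q' a /\ nat_mul p' q b /\ (a ∈ b \/ a = b).

Definition is_frac_add z x y :=
  exists p q p' q' a b c d, is_fraction x p q /\ is_fraction y p' q' /\
    nat_mul p q' a /\ nat_mul p' q b /\ nat_add a b c /\ nat_mul q q' d /\
    is_opair z c d.

(* A real number r in [0, +oo) is the Dedekind cut of all fractions p / q >= 0
   with p / q < r.  Thus 0 is the empty set, and <= is inclusion. *)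
Definition is_nnreal r :=
  (forall x, x ∈ r -> exists p q, is_fraction x p q) /\
  (forall x y, x ∈ r -> frac_le y x -> y ∈ r) /\
  (forall x, x ∈ r -> exists y, y ∈ r /\ frac_lt x y) /\
  (exists x p q, is_fraction x p q /\ ~ x ∈ r).

Definition is_nnreals R := forall r, r ∈ R <-> is_nnreal r.

Definition real_le r s := subset r s.

Definition real_lt r s := subset r s /\ r <> s.

(* The elements of r and s are added separately because either cut may be
   empty; frac_le makes the sum closed under equality of fractions. *)
Definition is_real_add t r s :=
  forall z, z ∈ t <-> z ∈ r \/ z ∈ s \/
    exists x y u, x ∈ r /\ y ∈ s /\ is_frac_add u x y /\ frac_le z u.

(* r is the cut of 1 / 2 ^ n. *)
Definition is_half_pow r n :=
  exists m, nat_pow2 n m /\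
    forall z, z ∈ r <->
      exists p q a, is_fraction z p q /\ nat_mul p m a /\ a ∈ q.

Definition dist d x y r := exists p, is_opair p x y /\ maps d p r.

Definition is_quasi_metric d X :=
  (exists XX R, is_cartesian XX X X /\ is_nnreals R /\ is_function d XX R) /\
  (forall x r, dist d x x r -> is_empty r) /\
  (forall x y z r s t u, dist d x y r -> dist d x z s -> dist d z y t ->
     is_real_add u s t -> real_le r u) /\
  (forall x y r, dist d x y r -> is_empty r -> x = y).

Definition is_metric d X :=
  is_quasi_metric d X /\ (forall x y r, dist d x y r -> dist d y x r).

(* T is the topology tau(d) on X. *)
Definition is_induced_topology T d X :=
  forall V, V ∈ T <-> subset V X /\
    forall x, x ∈ V -> exists n e, is_half_pow e n /\
      forall y r, dist d x y r -> real_lt r e -> y ∈ V.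

Definition quasi_metrizable X T :=
  exists d, is_quasi_metric d X /\ is_induced_topology T d X.

Definition metrizable X T :=
  exists d, is_metric d X /\ is_induced_topology T d X.

Definition first_countable X T :=
  forall x, x ∈ X -> exists B, countable B /\
    (forall U, U ∈ B -> U ∈ T /\ x ∈ U) /\
    (forall V, V ∈ T -> x ∈ V -> exists U, U ∈ B /\ subset U V).

(* B is a family of open sets whose intersection (taken within X, which matters
   only if B is empty) is {x}. *)
Definition is_pseudobase B x X T :=
  subset B T /\
  forall y, (y ∈ X /\ forall U, U ∈ B -> y ∈ U) <-> y = x.

Definition is_Gdelta A X T :=
  exists B, countable B /\ subset B T /\
    forall y, y ∈ A <-> y ∈ X /\ forall U, U ∈ B -> y ∈ U.

Definition countable_pseudocharacter X T :=
  forall x A, x ∈ X -> is_upair A x x -> is_Gdelta A X T.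

Definition cuf_pseudocharacter X T :=
  forall x, x ∈ X -> exists B, cuf B /\ is_pseudobase B x X T.

Definition is_difference D A B := forall x, x ∈ D <-> x ∈ A /\ ~ x ∈ B.

Definition cofinite_space X T :=
  forall U, U ∈ T <-> subset U X /\
    (is_empty U \/ exists D, is_difference D X U /\ finite D).

(* X, with topology T, is the one-point compactification D + {oo} of an
   infinite discrete space D whose underlying set satisfies Q. *)
Definition compactified_discrete (Q : M -> Prop) X T :=
  exists D oo, infinite D /\ Q D /\ ~ oo ∈ D /\
    (forall x, x ∈ X <-> x ∈ D \/ x = oo) /\
    (forall U, U ∈ T <-> subset U X /\
       (oo ∈ U -> exists C, is_difference C X U /\ finite C)).

(* In the family S of spaces, the space of index j is the pair (X, T). *)
Definition space_at S j X T := exists s, maps S j s /\ is_opair s X T.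

Definition is_space_family S J (Q : M -> M -> Prop) :=
  is_family S J /\
  forall j, j ∈ J -> exists X T, space_at S j X T /\ Q X T.

Definition is_product_set P S J :=
  forall f, f ∈ P <-> is_family f J /\
    forall j X T y, space_at S j X T -> maps f j y -> y ∈ X.

(* B is a product of open sets U_j with U_j = X_j for j outside a finite K. *)
Definition is_basic_box B P S J :=
  exists U K, is_family U J /\ finite K /\
    (forall j X T A, space_at S j X T -> maps U j A ->
       A ∈ T /\ (j ∈ K \/ A = X)) /\
    (forall f, f ∈ B <-> f ∈ P /\
       forall j y A, maps f j y -> maps U j A -> y ∈ A).

Definition is_product_space P W S J :=
  is_product_set P S J /\
  forall V, V ∈ W <-> subset V P /\
    forall f, f ∈ V -> exists B, is_basic_box B P S J /\ f ∈ B /\ subset B V.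

(* Every union of sets satisfying Q, indexed by a set satisfying I, satisfies
   Q'. *)
Definition every_union (I Q Q' : M -> Prop) :=
  forall J F U, I J -> is_family F J -> (forall j A, maps F j A -> Q A) ->
    is_family_union U F -> Q' U.

(* Every product of spaces satisfying Q, indexed by a nonempty set satisfying
   I, satisfies Q'. *)
Definition every_product (I : M -> Prop) (Q Q' : M -> M -> Prop) :=
  forall J S P W, I J -> nonempty J -> is_space_family S J Q ->
    is_product_space P W S J -> Q' P W.

Definition qm_cofinite X T := cofinite_space X T /\ quasi_metrizable X T.

Definition cuf_cofinite X T := cofinite_space X T /\ cuf X.

Definition countable_cofinite X T := cofinite_space X T /\ countable X.

Definition qm_countable_cofinite X T :=
  cofinite_space X T /\ countable X /\ quasi_metrizable X T.

End SetTheory.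

Arguments models_ZF M : clear implicits.

(* Main.v *)
Require Import Defs.
From mathcomp Require Import ssreflect ssrbool seq.
From mathcomp Require Import ssrfun.
From Stdlib Require Import Classical ClassicalEpsilon FunctionalExtensionality ProofIrrelevance.
From Stdlib Require Import Arith Ring.

(* The key objects are the exhaustions of a set A, i.e. the increasing
   sequences of finite sets A_0, A_1, ... with union A: they exist exactly when
   A is a cuf set.

   If unions of cuf sets are cuf, a family of spaces X_j of the kind in
   question has an exhaustion A_n of the disjoint sum of the X_j (for one-point
   compactifications, of the X_j without their points at infinity), which
   supplies exhaustions of all X_j at once, without any choice.  For each n,
   let C_n x y hold in X_j if x = y or y is not in A_n (for compactifications:
   or neither x nor y is in A_n).  These are transitive relations inducing the
   topology of X_j, nontrivial for finitely many j only, so that their products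
   over j induce the product topology; and a decreasing sequence of transitive
   relations comes from a non-archimedean quasi-metric, which is a metric if
   the relations are symmetric.

   Conversely, given sets A_j, let D_j be the union of A_j and omega, and adjoin
   one new point oo to all D_j.  In the product of the resulting spaces consider the constant
   point oo, together with the points agreeing with it except that their j-th
   coordinate is some y in D_j.  If a family B of neighbourhoods of oo misses
   each of these other points at least once, then the sets of all y in D_j
   whose point is missed by a given U in B are finite and cover the union of
   the D_j; so this union is cuf if B and the index set are.

   Since separation and replacement are available for first-order formulas
   only, every class and every induction hypothesis has to be definable. *)

(** * Definability *)

(** Passing to cuf index sets costs nothing: the stages of an exhaustion of the index set group the
    family into countably many finite unions, and finite unions preserve both sizes in question. So
    every statement can be compared with the one about countable unions, which also gives (iii).
    Requiring the factors of a countable product to be quasi-metrizable is no extra restriction: a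
    cuf cofinite space is always quasi-metrizable, and a quasi-metrizable cofinite space is a cuf
    set, because neighbourhoods of one fixed point have finite complements. The set omega is
    adjoined to A_j because a compactification needs an infinite D_j; it affects neither
    countability nor being cuf. A single oo for all j makes the constant point available without
    choice. In the forward direction nothing may be chosen for the factors either: even the discrete
    part of a compactification has to be read off its topology, as the set of isolated points. The
    metalevel epsilon operator serves only to name sets that the axioms determine uniquely. *)

Definition lift (f : nat -> nat) (n : nat) : nat :=
  match n with O => O | S k => S (f k) end.

Fixpoint rename (f : nat -> nat) (p : formula) : formula :=
  match p with
  | fElem i j => fElem (f i) (f j)
  | fEq i j => fEq (f i) (f j)
  | fFalse => fFalse
  | fImp p q => fImp (rename f p) (rename f q)
  | fAnd p q => fAnd (rename f p) (rename f q)
  | fOr p q => fOr (rename f p) (rename f q)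
  | fAll p => fAll (rename (lift f) p)
  | fEx p => fEx (rename (lift f) p)
  end.

(* Definitions wrapped in [sealed] do not unfold during conversion. *)
Lemma seal {A : Type} (x : A) : {y : A | y = x}.
Proof. by exists x. Qed.

Definition sealed {A : Type} (x : A) : A := proj1_sig (seal x).

Lemma sealedE {A : Type} (x : A) : sealed x = x.
Proof. exact: (proj2_sig (seal x)). Qed.

Section Definability.
Context {M : structure}.
Implicit Types (e : nat -> M) (t : (nat -> M) -> M).

Lemma extend_lift f (x : M) e :
  (fun n => extend x e (lift f n)) = extend x (fun n => e (f n)).
Proof. by apply: functional_extensionality; case. Qed.

Lemma sat_rename p f e : sat e (rename f p) <-> sat (fun n => e (f n)) p.
Proof.
elim: p f e => [i j|i j||p IHp q IHq|p IHp q IHq|p IHp q IHq|p IHp|p IHp] f e //=.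
- by rewrite IHp IHq.
- by rewrite IHp IHq.
- by rewrite IHp IHq.
- by split=> H x; move: (H x); rewrite IHp extend_lift.
- by split=> -[x H]; exists x; move: H; rewrite IHp extend_lift.
Qed.

(** A free index is sent either to an index of the outer environment or to a fixed element of M;
    this is how formulas acquire parameters. *)
Definition lookup (r : nat -> nat + M) e (i : nat) : M :=
  match r i with inl n => e n | inr m => m end.

(* P is the interpretation of a first-order formula with parameters in M.
   Under a binder the environment e becomes (fun n => e (S n)). *)
Definition Def (P : (nat -> M) -> Prop) : Prop :=
  exists p r, forall e, P e <-> sat (lookup r e) p.

(** The language has no function symbols, so a term counts as definable when its graph is; index 0
    carries the value. *)
Definition Tm t : Prop := Def (fun e => e 0 = t (fun n => e (S n))).

Lemma Def_ext {P} Q : (forall e, P e <-> Q e) -> Def Q -> Def P.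
Proof. by move=> H [p [r Hp]]; exists p, r => e; rewrite H. Qed.

Lemma Def_subst_env {P} (f : nat -> nat + M) : Def P -> Def (fun e => P (lookup f e)).
Proof.
move=> [p [r Hp]].
exists p, (fun i => match r i with inl n => f n | inr m => inr m end) => e.
rewrite Hp.
suff -> : lookup r (lookup f e) =
   lookup (fun i => match r i with inl n => f n | inr m => inr m end) e by [].
by apply: functional_extensionality => i; rewrite /lookup; case: (r i).
Qed.

Lemma Def_shift {P} (f : nat -> nat) : Def P -> Def (fun e => P (fun n => e (f n))).
Proof. exact: (Def_subst_env (fun n => inl (f n))). Qed.

(** Even indices follow [r1] and odd ones [r2], so that one assignment serves both sides of a binary
    connective. *)
Definition merge (r1 r2 : nat -> nat + M) (i : nat) :=
  if Nat.even i then r1 (Nat.div2 i) else r2 (Nat.div2 i).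

Lemma merge1 r1 r2 e :
  (fun n => lookup (merge r1 r2) e (2 * n)) = lookup r1 e.
Proof.
apply: functional_extensionality => n.
by rewrite /lookup /merge Nat.even_even Nat.div2_double.
Qed.

Lemma merge2 r1 r2 e :
  (fun n => lookup (merge r1 r2) e (S (2 * n))) = lookup r2 e.
Proof.
apply: functional_extensionality => n.
by rewrite /lookup /merge -Nat.add_1_r Nat.even_odd Nat.add_1_r Nat.div2_succ_double.
Qed.

Lemma Def_binop (op : formula -> formula -> formula) (Op : Prop -> Prop -> Prop) :
  (forall p q e, sat e (op p q) = Op (sat e p) (sat e q)) ->
  (forall A A' B B', (A <-> A') -> (B <-> B') -> (Op A B <-> Op A' B')) ->
  forall P Q, Def P -> Def Q -> Def (fun e => Op (P e) (Q e)).
Proof.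
move=> Hop HOp P Q [p [r Hp]] [q [s Hq]].
exists (op (rename (fun n => 2 * n) p) (rename (fun n => S (2 * n)) q)), (merge r s) => e.
by rewrite Hop; apply: HOp; rewrite sat_rename (merge1, merge2).
Qed.

Lemma Def_and P Q : Def P -> Def Q -> Def (fun e => P e /\ Q e).
Proof. by apply: (Def_binop fAnd and) => //; tauto. Qed.

Lemma Def_or P Q : Def P -> Def Q -> Def (fun e => P e \/ Q e).
Proof. by apply: (Def_binop fOr or) => //; tauto. Qed.

Lemma Def_imp P Q : Def P -> Def Q -> Def (fun e => P e -> Q e).
Proof. by apply: (Def_binop fImp (fun A B : Prop => A -> B)) => //; tauto. Qed.

Lemma Def_iff P Q : Def P -> Def Q -> Def (fun e => P e <-> Q e).
Proof. by move=> HP HQ; apply: Def_and; apply: Def_imp. Qed.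

Lemma Def_False : Def (fun e => False).
Proof. by exists fFalse, (fun n => inl n). Qed.

Lemma Def_not P : Def P -> Def (fun e => ~ P e).
Proof. by move=> H; apply: Def_imp => //; apply: Def_False. Qed.

(** Several indices may be sent to the variable being bound; all of them collapse to 0 and the
    others move up by one. The value of [unbind] at [inl O] is a default that is never looked up. *)
Definition bind_index (r : nat -> nat + M) (i : nat) : nat :=
  match r i with inl O => O | _ => S i end.

Definition unbind (r : nat -> nat + M) (i : nat) : nat + M :=
  match r i with inl (S n) => inl n | inl O => inl O | inr m => inr m end.

Lemma extend_unbind r (x : M) e :
  (fun n => extend x (lookup (unbind r) e) (bind_index r n)) = lookup r (extend x e).
Proof.
apply: functional_extensionality => i; rewrite /bind_index /lookup /=.
by case E: (r i) => [[|n]|m] //=; rewrite /unbind E.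
Qed.

Lemma Def_all (P : M -> (nat -> M) -> Prop) :
  Def (fun e => P (e 0) (fun n => e (S n))) -> Def (fun e => forall x, P x e).
Proof.
move=> [p [r Hp]]; exists (fAll (rename (bind_index r) p)), (unbind r) => e /=.
by split=> H x; move: (H x); rewrite sat_rename extend_unbind -Hp.
Qed.

Lemma Def_ex (P : M -> (nat -> M) -> Prop) :
  Def (fun e => P (e 0) (fun n => e (S n))) -> Def (fun e => exists x, P x e).
Proof.
move=> [p [r Hp]]; exists (fEx (rename (bind_index r) p)), (unbind r) => e /=.
by split=> -[x H]; exists x; move: H; rewrite sat_rename extend_unbind -Hp.
Qed.

(** Freezes the environment into parameters: under a binder, separation and replacement are applied
    for each fixed environment. *)
Lemma definable_inst (P : M -> (nat -> M) -> Prop) e :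
  Def (fun e => P (e 0) (fun n => e (S n))) -> Def (fun e' => P (e' 0) e).
Proof.
exact: (Def_subst_env (fun n => match n with O => inl O | S k => inr (e k) end)).
Qed.

Lemma Tm_var i : Tm (fun e => e i).
Proof.
exists (fEq 0 1), (fun n => match n with O => inl O | _ => inl (S i) end) => e.
by [].
Qed.

Lemma Tm_const (a : M) : Tm (fun _ => a).
Proof.
exists (fEq 0 1), (fun n => match n with O => inl O | _ => inr a end) => e.
by [].
Qed.

(** Substitution is replaced by a quantifier over the value of the term, so no substitution into
    formulas has to be defined. *)
Lemma Def_subst P t : Def (fun e => P (e 0) (fun n => e (S n))) -> Tm t ->
  Def (fun e => P (t e) e).
Proof.
move=> HP Ht.
apply: (Def_ext (fun e => exists x, x = t e /\ P x e)); last exact: Def_ex (Def_and _ _ Ht HP).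
by move=> e; split=> [H|[x [-> //]]]; exists (t e).
Qed.

Lemma Tm_shift t (f : nat -> nat) : Tm t -> Tm (fun e => t (fun n => e (f n))).
Proof. exact: (Def_shift (lift f)). Qed.

Lemma Def_pred1 (R : M -> Prop) : Def (fun e => R (e 0)) ->
  forall a, Tm a -> Def (fun e => R (a e)).
Proof. by move=> HR a Ha; apply: (Def_subst (fun x e => R x)). Qed.

Lemma Def_pred2 (R : M -> M -> Prop) : Def (fun e => R (e 0) (e 1)) ->
  forall a b, Tm a -> Tm b -> Def (fun e => R (a e) (b e)).
Proof.
move=> HR a b Ha Hb; apply: (Def_subst (fun x e => R x (b e))) => //.
apply: (Def_subst (fun y e => R (e 0) y)); last exact: Tm_shift.
exact: (Def_shift (fun n => match n with 0 => 1 | _ => 0 end)) HR.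
Qed.

Lemma Def_pred3 (R : M -> M -> M -> Prop) : Def (fun e => R (e 0) (e 1) (e 2)) ->
  forall a b c, Tm a -> Tm b -> Tm c -> Def (fun e => R (a e) (b e) (c e)).
Proof.
move=> HR a b c Ha Hb Hc; apply: (Def_subst (fun x e => R x (b e) (c e))) => //.
apply: (Def_subst (fun y e => R (e 0) y (c (fun n => e (S n))))); last exact: Tm_shift.
apply: (Def_subst (fun z e => R (e 1) (e 0) z)); last by do 2 apply: Tm_shift.
exact: (Def_shift (fun n => match n with 0 => 2 | 1 => 1 | _ => 0 end)) HR.
Qed.

Lemma Def_pred4 (R : M -> M -> M -> M -> Prop) :
  Def (fun e => R (e 0) (e 1) (e 2) (e 3)) ->
  forall a b c d, Tm a -> Tm b -> Tm c -> Tm d -> Def (fun e => R (a e) (b e) (c e) (d e)).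
Proof.
move=> HR a b c d Ha Hb Hc Hd; apply: (Def_subst (fun x e => R x (b e) (c e) (d e))) => //.
set s := fun t e => t (fun n => e (S n)).
apply: (Def_subst (fun y e => R (e 0) y (s c e) (s d e))); last exact: Tm_shift.
apply: (Def_subst (fun z e => R (e 1) (e 0) z (s (s d) e))); last by do 2 apply: Tm_shift.
apply: (Def_subst (fun z e => R (e 2) (e 1) (e 0) z)); last by do 3 apply: Tm_shift.
exact: (Def_shift (fun n => match n with 0 => 3 | 1 => 2 | 2 => 1 | _ => 0 end)) HR.
Qed.

Lemma Def_elem a b : Tm a -> Tm b -> Def (fun e => a e ∈ b e).
Proof. by apply: Def_pred2; exists (fElem 0 1), (fun n => inl n). Qed.

Lemma Def_eq a b : Tm a -> Tm b -> Def (fun e => a e = b e).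
Proof. by apply: Def_pred2; exists (fEq 0 1), (fun n => inl n). Qed.

Lemma Tm_fun1 (f : M -> M) : Tm (fun e => f (e 0)) ->
  forall a, Tm a -> Tm (fun e => f (a e)).
Proof.
move=> Hf a Ha; apply: (Def_pred2 (fun x y => x = f y)) => //.
  exact: Tm_var.
exact: Tm_shift.
Qed.

Lemma Tm_fun2 (f : M -> M -> M) : Tm (fun e => f (e 0) (e 1)) ->
  forall a b, Tm a -> Tm b -> Tm (fun e => f (a e) (b e)).
Proof.
move=> Hf a b Ha Hb; apply: (Def_pred3 (fun x y z => x = f y z)) => //.
- exact: Tm_var.
- exact: Tm_shift.
exact: Tm_shift.
Qed.

Lemma Def_exu (P : M -> (nat -> M) -> Prop) :
  Def (fun e => P (e 0) (fun n => e (S n))) -> Def (fun e => exists! x, P x e).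
Proof.
move=> HP; apply: Def_ex; apply: Def_and => //; apply: Def_all; apply: Def_imp.
  exact: (Def_shift (fun n => match n with O => O | S k => S (S k) end)) HP.
by apply: Def_eq; apply: Tm_var.
Qed.

End Definability.

(* Opacity keeps the search from unfolding: a closure rule fires only on the symbol it is stated
   for. *)
Create HintDb def discriminated.
#[global] Hint Constants Opaque : def.
#[global] Hint Resolve Def_and Def_or Def_imp Def_iff Def_False Def_not Def_all Def_ex Def_exu
  Tm_var Tm_const Def_elem Def_eq : def.

(* Turns hypotheses [definable P] and [definable_map t] into closure rules. *)
Ltac def_hyps := repeat match goal with
  | H : Def (fun e => ?P (e 0)) |- _ => generalize (Def_pred1 P H); clear H; intro
  | H : Def (fun e => ?P (e 0) (e 1)) |- _ => generalize (Def_pred2 P H); clear H; intro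
  | H : Def (fun e => ?P (e 0) (e 1) (e 2)) |- _ => generalize (Def_pred3 P H); clear H; intro
  | H : Def (fun e => ?P (e 0) (e 1) (e 2) (e 3)) |- _ => generalize (Def_pred4 P H); clear H; intro
  | H : Tm (fun e => ?t (e 0)) |- _ => generalize (Tm_fun1 t H); clear H; intro
  end.
Ltac def := cbv beta; def_hyps; solve [auto 100 with def nocore].
(* With these hints [//] and [by] discharge definability side conditions. *)
#[global] Hint Extern 0 (Def _) => def : core.
#[global] Hint Extern 0 (Tm _) => def : core.

Notation definable P := (Def (fun e => P (e 0))).
Notation definable2 P := (Def (fun e => P (e 0) (e 1))).
Notation definable3 P := (Def (fun e => P (e 0) (e 1) (e 2))).
Notation definable4 P := (Def (fun e => P (e 0) (e 1) (e 2) (e 3))).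
Notation definable_map t := (Tm (fun e => t (e 0))).

(** * Basic set theory *)

Section DefHints.
Context {M : structure}.
Implicit Types a b c : (nat -> M) -> M.

Lemma Def_subset a b : Tm a -> Tm b -> Def (fun e => subset (a e) (b e)).
Proof. by apply: Def_pred2; rewrite /subset; def. Qed.

Lemma Def_is_upair a b c :
  Tm a -> Tm b -> Tm c -> Def (fun e => is_upair (a e) (b e) (c e)).
Proof. by apply: Def_pred3; rewrite /is_upair; def. Qed.

Lemma Def_is_succ a b : Tm a -> Tm b -> Def (fun e => is_succ (a e) (b e)).
Proof. by apply: Def_pred2; rewrite /is_succ; def. Qed.

Lemma Def_is_empty a : Tm a -> Def (fun e => is_empty (a e)).
Proof. by apply: Def_pred1; rewrite /is_empty; def. Qed.
#[local] Hint Resolve Def_is_upair : def.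

Lemma Def_is_opair a b c : Tm a -> Tm b -> Tm c -> Def (fun e => is_opair (a e) (b e) (c e)).
Proof. by apply: Def_pred3; rewrite /is_opair; def. Qed.
#[local] Hint Resolve Def_is_opair : def.

Lemma Def_maps a b c : Tm a -> Tm b -> Tm c -> Def (fun e => maps (a e) (b e) (c e)).
Proof. by apply: Def_pred3; rewrite /maps; def. Qed.

End DefHints.
#[global] Hint Resolve Def_subset Def_is_upair Def_is_succ Def_is_empty Def_is_opair Def_maps : def.

Existing Class models_ZF.

Section Sets.
Context {M : structure} {HM : models_ZF M}.
Implicit Types (x y z A B C F J : M) (a b c : (nat -> M) -> M).

Lemma ext A B : (forall x, x ∈ A <-> x ∈ B) -> A = B.
Proof. by case: HM => -[E _ _ _] _; apply: E. Qed.

Lemma inhab : inhabited M.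
Proof. by case: HM => _ [_ [w _] _ _]. Qed.

(** The properties it is used with have at most one witness, by extensionality, so no choice
    principle is imported into M. *)
Definition the (P : M -> Prop) : M := epsilon inhab P.

Lemma theP (P : M -> Prop) : (exists x, P x) -> P (the P).
Proof. exact: epsilon_spec. Qed.

Definition upair x y := the (fun p => is_upair p x y).
Definition union C := the (fun U => forall x, x ∈ U <-> exists A, A ∈ C /\ x ∈ A).
Definition power A := the (fun P => forall B, B ∈ P <-> subset B A).
Definition sep A (P : M -> Prop) := the (fun B => forall x, x ∈ B <-> x ∈ A /\ P x).
Definition image A (t : M -> M) :=
  the (fun B => forall y, y ∈ B <-> exists x, x ∈ A /\ y = t x).

Lemma upairE x y z : z ∈ upair x y <-> z = x \/ z = y.
Proof. by move: z; apply: (theP (fun p => is_upair p x y)); case: HM => -[_ _ E _] _; apply: E. Qed.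

Lemma unionE C x : x ∈ union C <-> exists A, A ∈ C /\ x ∈ A.
Proof.
move: x; apply: (theP (fun U => forall x, x ∈ U <-> exists A, A ∈ C /\ x ∈ A)).
by case: HM => -[_ _ _ E] _; apply: E.
Qed.

Lemma powerE A B : B ∈ power A <-> subset B A.
Proof. by move: B; apply: (theP (fun P => forall B, B ∈ P <-> subset B A)); case: HM => _ [E _ _ _]; apply: E. Qed.

Lemma sepE A (P : M -> Prop) x : definable P -> x ∈ sep A P <-> x ∈ A /\ P x.
Proof.
move=> [p [r Hp]]; move: x; apply: (theP (fun B => forall x, x ∈ B <-> x ∈ A /\ P x)); case: HM => _ [_ _ E _].
(* The truth of P depends on index 0 only; the constant environment A is an arbitrary filler for the
   other indices. *)
have [B HB] := E (rename (bind_index r) p) (lookup (unbind r) (fun _ => A)) A.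
by exists B => x; rewrite HB sat_rename extend_unbind -Hp.
Qed.

Lemma imageE A (t : M -> M) y : definable_map t ->
  y ∈ image A t <-> exists x, x ∈ A /\ y = t x.
Proof.
move=> Ht; move: y; apply: (theP (fun B => forall y, y ∈ B <-> exists x, x ∈ A /\ y = t x)); case: HM => _ [_ _ _ E].
have [p [r Hp]] : Def (fun e => e 1 = t (e 0)).
  exact: (Def_shift (fun n => match n with 0 => 1 | _ => 0 end)) Ht.
(* Both x and y get bound, hence [bind_index] and [unbind] are used twice. *)
set L := lookup (unbind (unbind r)) (fun _ => A).
set f := rename (fun n => lift (bind_index (unbind r)) (bind_index r n)) p.
have Hf x y : sat (extend x (extend y L)) f <-> y = t x.
  rewrite sat_rename (Hp (extend x (extend y (fun _ => A)))) -extend_unbind.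
  by rewrite -extend_unbind -extend_lift.
have [|B HB] := E f L A.
  by move=> x _; exists (t x); split=> [|y]; rewrite Hf.
by exists B => y; rewrite HB; split=> -[x [xA Hx]]; exists x; move: Hx; rewrite Hf.
Qed.

(** By extensionality the graph of a set-valued term is expressed by its membership condition. This
    is what makes the sets named by epsilon definable. *)
Lemma Tm_ext (t : (nat -> M) -> M) (P : M -> (nat -> M) -> Prop) :
  (forall e x, x ∈ t e <-> P x e) -> Def (fun e => P (e 0) (fun n => e (S n))) ->
  Tm t.
Proof.
move=> Ht HP.
apply: (Def_ext (fun e => forall x, x ∈ e 0 <-> P x (fun n => e (S n)))).
  by move=> e; split=> [-> //|H]; apply: ext => x; rewrite H Ht.
apply: Def_all; apply: Def_iff; first by def.
exact: (Def_shift (lift S)) HP.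
Qed.

Lemma Tm_upair a b : Tm a -> Tm b -> Tm (fun e => upair (a e) (b e)).
Proof. by apply: Tm_fun2; apply: (Tm_ext _ (fun x e => x = e 0 \/ x = e 1)) => [e x|]; [apply: upairE|def]. Qed.

Lemma Tm_union a : Tm a -> Tm (fun e => union (a e)).
Proof. by apply: Tm_fun1; apply: (Tm_ext _ (fun x e => exists A, A ∈ e 0 /\ x ∈ A)) => [e x|]; [apply: unionE|def]. Qed.

Lemma Tm_power a : Tm a -> Tm (fun e => power (a e)).
Proof. by apply: Tm_fun1; apply: (Tm_ext _ (fun x e => subset x (e 0))) => [e x|]; [apply: powerE|def]. Qed.

Lemma Tm_sep a (P : M -> (nat -> M) -> Prop) :
  Tm a -> Def (fun e => P (e 0) (fun n => e (S n))) ->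
  Tm (fun e => sep (a e) (fun x => P x e)).
Proof.
move=> Ha HP; apply: (Tm_ext _ (fun x e => x ∈ a e /\ P x e)) => [e x|].
  by apply: sepE; apply: (definable_inst P).
by apply: Def_and => //; apply: Def_elem; [def|apply: Tm_shift].
Qed.

Lemma Tm_image a (t : M -> (nat -> M) -> M) :
  Tm a -> Tm (fun e => t (e 0) (fun n => e (S n))) ->
  Tm (fun e => image (a e) (fun x => t x e)).
Proof.
move=> Ha Ht.
apply: (Tm_ext _ (fun y e => exists x, x ∈ a e /\ y = t x e)) => [e x|].
  apply: imageE.
  exact: (Def_subst_env (fun n => match n with 0 => inl 0 | 1 => inl 1 | S (S k) => inr (e k) end)) Ht.
apply: Def_ex; apply: Def_and; first by apply: Def_elem; [def|do 2 apply: Tm_shift].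
apply: Def_eq; first by def.
exact: (Tm_shift _ (lift S)) Ht.
Qed.

Lemma sep_empty_aux : exists z, is_empty z.
Proof.
case: inhab => A; exists (sep A (fun _ => False)) => x.
by rewrite sepE; [case|def].
Qed.

Definition empty := the is_empty.

Lemma emptyE x : ~ x ∈ empty.
Proof. exact: theP sep_empty_aux x. Qed.

Lemma is_emptyP A : is_empty A <-> A = empty.
Proof.
split=> [H|->]; last exact: emptyE.
by apply: ext => x; split=> [/H //|/emptyE].
Qed.

Lemma nonemptyP A : A <> empty <-> nonempty A.
Proof.
split=> [H|[x xA] E]; last by rewrite E in xA; apply: (emptyE x).
by apply: NNPP => N; apply/H/is_emptyP => x xA; apply: N; exists x.
Qed.

Definition sing := sealed (fun x => upair x x).
Definition cup := sealed (fun A B => union (upair A B)).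
Definition diff := sealed (fun A B => sep A (fun x => ~ x ∈ B)).
Definition succ := sealed (fun x => cup x (sing x)).
Definition opair := sealed (fun x y => upair (sing x) (upair x y)).
Definition cart := sealed (fun A B => union (image A (fun x => image B (fun y => opair x y)))).
Definition lam := sealed (fun A (t : M -> M) => image A (fun x => opair x (t x))).
(** The double union contains all coordinates of Kuratowski pairs in F. The union of a singleton of
    values is the value; where F has no value the result is the empty set. *)
Definition app :=
  sealed (fun F x => union (sep (union (union F)) (fun y => opair x y ∈ F))).

Lemma singE x z : z ∈ sing x <-> z = x.
Proof. by rewrite /sing sealedE upairE; tauto. Qed.

Lemma cupE A B x : x ∈ cup A B <-> x ∈ A \/ x ∈ B.
Proof.
rewrite /cup sealedE unionE; split=> [[C []]|[H|H]].
- by rewrite upairE => -[-> | ->]; tauto.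
- by exists A; rewrite upairE; tauto.
- by exists B; rewrite upairE; tauto.
Qed.

Lemma diffE A B x : x ∈ diff A B <-> x ∈ A /\ ~ x ∈ B.
Proof. by rewrite /diff sealedE sepE. Qed.

Lemma succE x z : z ∈ succ x <-> z ∈ x \/ z = x.
Proof. by rewrite /succ sealedE cupE singE. Qed.

Lemma is_upairP p x y : is_upair p x y <-> p = upair x y.
Proof.
split=> [H|-> z]; last exact: upairE.
by apply: ext => z; rewrite upairE; apply: H.
Qed.

Lemma is_succP y x : is_succ y x <-> y = succ x.
Proof.
split=> [H|-> z]; last exact: succE.
by apply: ext => z; rewrite succE; apply: H.
Qed.

Lemma opairE x y : opair x y = upair (sing x) (upair x y).
Proof. by rewrite /opair sealedE. Qed.

Lemma is_opairP p x y : is_opair p x y <-> p = opair x y.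
Proof.
split=> [[a [b []]]|->].
  rewrite !is_upairP opairE => -> [-> ->].
  by rewrite /sing sealedE.
by exists (sing x), (upair x y); rewrite !is_upairP opairE /sing sealedE.
Qed.

Lemma upair_inj x y u v : upair x y = upair u v -> (x = u /\ y = v) \/ (x = v /\ y = u).
Proof.
move=> E.
have H z : (z = x \/ z = y) <-> (z = u \/ z = v) by rewrite -!upairE E.
have [Hx|Hx] := proj1 (H x) (or_introl erefl);
  have [Hy|Hy] := proj1 (H y) (or_intror erefl);
  have [Hu|Hu] := proj2 (H u) (or_introl erefl);
  have [Hv|Hv] := proj2 (H v) (or_intror erefl); subst; by [left|right].
Qed.

Lemma opair_inj x y u v : opair x y = opair u v -> x = u /\ y = v.
Proof.
rewrite !opairE /sing sealedE.
move=> /upair_inj [] [/upair_inj E1 /upair_inj E2];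
  case: E1 => -[? ?]; case: E2 => -[? ?]; by subst.
Qed.

Lemma Tm_empty : Tm (fun _ => empty).
Proof. exact: Tm_const. Qed.

Lemma Tm_sing a : Tm a -> Tm (fun e => sing (a e)).
Proof. by move=> H; rewrite /sing sealedE; apply: Tm_upair. Qed.

Lemma Tm_cup a b : Tm a -> Tm b -> Tm (fun e => cup (a e) (b e)).
Proof. by move=> Ha Hb; rewrite /cup sealedE; apply: Tm_union; apply: Tm_upair. Qed.

Lemma Tm_diff a b : Tm a -> Tm b -> Tm (fun e => diff (a e) (b e)).
Proof. by apply: Tm_fun2; apply: (Tm_ext _ (fun x e => x ∈ e 0 /\ ~ x ∈ e 1)) => [e x|]; [apply: diffE|def]. Qed.

Lemma Tm_succ a : Tm a -> Tm (fun e => succ (a e)).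
Proof. by move=> H; rewrite /succ sealedE; apply: Tm_cup => //; apply: Tm_sing. Qed.

Lemma Tm_opair a b : Tm a -> Tm b -> Tm (fun e => opair (a e) (b e)).
Proof.
by move=> Ha Hb; rewrite /opair sealedE; apply: Tm_upair; [apply: Tm_sing|apply: Tm_upair].
Qed.

End Sets.
#[global] Hint Resolve Tm_upair Tm_union Tm_power Tm_sep Tm_image Tm_empty Tm_sing Tm_cup Tm_diff
  Tm_succ Tm_opair : def.

Section Functions.
Context {M : structure} {HM : models_ZF M}.
Implicit Types (x y z A B C F J : M) (a b c : (nat -> M) -> M).

Lemma Tm_cart a b : Tm a -> Tm b -> Tm (fun e => cart (a e) (b e)).
Proof. by apply: Tm_fun2; rewrite /cart sealedE; def. Qed.

Lemma Tm_app a b : Tm a -> Tm b -> Tm (fun e => app (a e) (b e)).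
Proof. by apply: Tm_fun2; rewrite /app sealedE; apply: Tm_union; def. Qed.

Lemma Tm_lam a (t : M -> (nat -> M) -> M) :
  Tm a -> Tm (fun e => t (e 0) (fun n => e (S n))) ->
  Tm (fun e => lam (a e) (fun x => t x e)).
Proof.
move=> Ha Ht; rewrite /lam sealedE.
by apply: (Tm_image a (fun x e => opair x (t x e))) => //; apply: Tm_opair. Qed.

Lemma cartE A B p : p ∈ cart A B <-> exists x y, x ∈ A /\ y ∈ B /\ p = opair x y.
Proof.
rewrite /cart sealedE unionE; split=> [[C [+ pC]]|[x [y [xA [yB ->]]]]].
  by rewrite imageE // => -[x [xA E]]; move: pC; rewrite E imageE // => -[y [yB ->]]; exists x, y.
by exists (image B (fun y => opair x y)); rewrite !imageE //; split; [exists x|exists y].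
Qed.

Lemma opair_cart A B x y : opair x y ∈ cart A B <-> x ∈ A /\ y ∈ B.
Proof.
rewrite cartE; split=> [[u [v [uA [vB /opair_inj [-> ->]]]]] //|[xA yB]].
by exists x, y.
Qed.

Lemma is_cartesianP P A B : is_cartesian P A B <-> P = cart A B.
Proof.
split=> [H|-> p].
  apply: ext => p; rewrite cartE (H p).
  by split=> -[x [y [xA [yB H']]]]; exists x, y; split=> //; split=> //; apply/is_opairP.
by rewrite cartE; split=> -[x [y [xA [yB H']]]]; exists x, y; split=> //; split=> //; apply/is_opairP.
Qed.

Lemma mapsE F x y : maps F x y <-> opair x y ∈ F.
Proof.
split=> [[p [/is_opairP -> //]]|H].
by exists (opair x y); rewrite is_opairP.
Qed.

Lemma app_unique F x y : maps F x y -> (forall z, maps F x z -> z = y) -> app F x = y.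
Proof.
rewrite mapsE => H U; apply: ext => z; rewrite /app sealedE unionE; split=> [[A []]|zy].
  by rewrite sepE // -mapsE => -[_ /U ->].
exists y; rewrite sepE //; split=> //; split=> //.
rewrite unionE; exists (upair x y); rewrite upairE; split; last by right.
by rewrite unionE; exists (opair x y); rewrite opairE upairE -opairE; split=> //; right.
Qed.

Lemma family_maps F J x y : is_family F J -> maps F x y <-> x ∈ J /\ y = app F x.
Proof.
move=> [H1 H2].
have Happ z : z ∈ J -> maps F z (app F z).
  by move=> /H2 [u [Hu U]]; rewrite (app_unique F z u) // => v /U.
split=> [Hxy|[xJ ->]]; last exact: Happ.
have xJ : x ∈ J.
  move: Hxy; rewrite mapsE => /H1 [u [v [uJ /is_opairP /opair_inj [-> _]]]] //.
split=> //; have [u [Hu U]] := H2 _ xJ.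
by rewrite -(U _ Hxy); apply: U; apply: Happ.
Qed.

Lemma maps_lam A (t : M -> M) x y : definable_map t -> maps (lam A t) x y <-> x ∈ A /\ y = t x.
Proof.
move=> Ht; rewrite mapsE /lam sealedE imageE; last by apply: Tm_opair.
split=> [[z [zA /opair_inj [-> ->]]] //|[xA ->]].
by exists x.
Qed.

Lemma lam_family A (t : M -> M) : definable_map t -> is_family (lam A t) A.
Proof.
move=> Ht; split=> [p|x xA].
  rewrite /lam sealedE imageE; last by apply: Tm_opair.
  by move=> [x [xA ->]]; exists x, (t x); rewrite is_opairP.
by exists (t x); split=> [|y]; rewrite maps_lam // => -[_ ->].
Qed.

Lemma app_lam A (t : M -> M) x : definable_map t -> x ∈ A -> app (lam A t) x = t x.
Proof.
move=> Ht xA; apply: app_unique => [|z]; rewrite maps_lam //.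
by case.
Qed.

Lemma family_ext F G J : is_family F J -> is_family G J ->
  (forall x, x ∈ J -> app F x = app G x) -> F = G.
Proof.
move=> HF HG E; apply: ext => p.
have sub (F1 F2 : M) : is_family F1 J -> is_family F2 J ->
    (forall x, x ∈ J -> app F1 x = app F2 x) -> p ∈ F1 -> p ∈ F2.
  move=> H1 H2 E' pF; have [x [y [xJ /is_opairP Ep]]] := proj1 H1 p pF.
  move: pF; rewrite Ep -!mapsE (family_maps _ _ _ _ H1) (family_maps _ _ _ _ H2).
  by move=> [_ ->]; rewrite E'.
by split; apply: sub => // x xJ; rewrite E.
Qed.

Lemma is_functionP f A B : is_function f A B <-> is_family f A /\ forall x, x ∈ A -> app f x ∈ B.
Proof.
split=> -[Hf H]; split=> // x.
  by move=> xA; apply: (H x); rewrite (family_maps _ _ _ _ Hf).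
by move=> y; rewrite (family_maps _ _ _ _ Hf) => -[xA ->]; apply: H.
Qed.

(** Russell's paradox, relativized to A. *)
Lemma fresh A : exists x, ~ x ∈ A.
Proof.
exists (sep A (fun x => ~ x ∈ x)) => H.
have := sepE A (fun x => ~ x ∈ x) (sep A (fun x => ~ x ∈ x)) ltac:(def).
by tauto.
Qed.

End Functions.
#[global] Hint Resolve Tm_cart Tm_app Tm_lam : def.

(** * Natural numbers of the model *)

Section Omega.
Context {M : structure} {HM : models_ZF M}.
Implicit Types (x y z n k m A B C F J : M) (a b c : (nat -> M) -> M).

Lemma Def_inductive_set a : Tm a -> Def (fun e => inductive_set (a e)).
Proof. by apply: Def_pred1; rewrite /inductive_set; def. Qed.
#[local] Hint Resolve Def_inductive_set : def.

Lemma inductive_setP A :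
  inductive_set A <-> empty ∈ A /\ forall x, x ∈ A -> succ x ∈ A.
Proof.
split=> [[[z [/is_emptyP -> zA]] H]|[zA H]].
  by split=> // x /H [y [/is_succP -> yA]].
split; first by exists empty; rewrite is_emptyP.
by move=> x xA; exists (succ x); rewrite is_succP; split=> //; apply: H.
Qed.

Definition omega := the is_omega.

Lemma omegaP : is_omega omega.
Proof.
apply: theP; case: HM => _ [_ [w Hw] _ _].
have E x : x ∈ sep w (fun x => forall w', inductive_set w' -> x ∈ w') <->
    forall w', inductive_set w' -> x ∈ w'.
  by rewrite sepE //; split=> [[] //|H]; split=> //; apply: H.
exists (sep w (fun x => forall w', inductive_set w' -> x ∈ w')); split.
  apply/inductive_setP; split=> [|x]; rewrite !E.
    by move=> w' /inductive_setP [].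
  by move=> H w' Hw'; have /inductive_setP [_ S] := Hw'; apply/S/H.
by move=> w' Hw' x; rewrite E => /(_ _ Hw').
Qed.

Lemma is_omegaP w : is_omega w <-> w = omega.
Proof.
split=> [[Hw Hmin]|->]; last exact: omegaP.
have [Ho Homin] := omegaP.
by apply: ext => x; split; [apply: Hmin|apply: Homin].
Qed.

Lemma is_natP x : is_nat x <-> x ∈ omega.
Proof.
split=> [[w [/is_omegaP -> //]]|xo].
by exists omega; split=> //; apply: omegaP.
Qed.

Lemma zero_omega : empty ∈ omega.
Proof. by have [/inductive_setP []] := omegaP. Qed.

Lemma succ_omega n : n ∈ omega -> succ n ∈ omega.
Proof. by have [/inductive_setP [_ H] _] := omegaP; apply: H. Qed.
#[local] Hint Resolve zero_omega succ_omega : core.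

Lemma Tm_omega : Tm (fun _ : nat -> M => omega).
Proof. exact: Tm_const. Qed.
#[local] Hint Resolve Tm_omega : def.

Lemma omega_ind (P : M -> Prop) : definable P -> P empty ->
  (forall n, n ∈ omega -> P n -> P (succ n)) -> forall n, n ∈ omega -> P n.
Proof.
move=> HP H0 HS n nw.
have [_ Hmin] := omegaP.
have /Hmin /(_ n nw) : inductive_set (sep omega P); last by rewrite sepE //; case.
apply/inductive_setP; split=> [|x]; rewrite !sepE //.
by move=> [xw xP]; split; [apply: succ_omega|apply: HS].
Qed.

Lemma elem_asym x y : x ∈ y -> y ∈ x -> False.
Proof.
move=> xy yx; case: HM => -[_ Hf _ _] _.
have [|z []] := Hf (upair x y); first by exists x; rewrite upairE; left.
by rewrite upairE => -[-> | ->] /(_ _ (conj _ _)) H;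
  [apply: (H y)|apply: (H x)] => //; rewrite upairE; tauto.
Qed.

Lemma succ_inj x y : succ x = succ y -> x = y.
Proof.
move=> E; have : x ∈ succ y by rewrite -E succE; right.
have : y ∈ succ x by rewrite E succE; right.
rewrite !succE => -[yx|->] // [xy|//]; by case: (elem_asym x y).
Qed.

Lemma succ_neq0 x : succ x <> empty.
Proof. by move=> E; apply: (emptyE x); rewrite -E succE; right. Qed.

Lemma elem_omega n x : n ∈ omega -> x ∈ n -> x ∈ omega.
Proof.
move=> nw; move: n nw x; apply: omega_ind => [|x /emptyE //|n nw IH x]; first by def.
by rewrite succE => -[/IH //|->].
Qed.

(** The least relation that contains the initial pair and is closed under the step. Quantifying over
    sets R of the model keeps it definable in t. *)
Definition rec := sealed (fun (t : M -> M) x =>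
  sep (cart omega omega) (fun p => forall R, opair empty x ∈ R ->
    (forall n y, opair n y ∈ R -> opair (succ n) (t y) ∈ R) -> p ∈ R)).
Definition iter := sealed (fun t x n => app (rec t x) n).

Lemma iterE t x n : iter t x n = app (rec t x) n.
Proof. by rewrite /iter sealedE. Qed.

Lemma Tm_iter (t : M -> (nat -> M) -> M) a b : Tm a -> Tm b ->
  Tm (fun e => t (e 0) (fun i => e (S i))) ->
  Tm (fun e => iter (fun x => t x e) (a e) (b e)).
Proof.
move=> Ha Hb Ht; rewrite /iter /rec !sealedE; apply: Tm_app => //; apply: Tm_sep; first by def.
apply: Def_all; apply: Def_imp.
  by apply: Def_elem => //; apply: Tm_opair => //; do 2 apply: Tm_shift.
apply: Def_imp => //; do 2 apply: Def_all; apply: Def_imp => //.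
apply: Def_elem => //; apply: Tm_opair => //.
exact: (Tm_shift _ (fun i => match i with 0 => 0 | S j => S (S (S (S j))) end)) Ht.
Qed.

Section Recursion.
Context (t : M -> M) (x0 : M).
Hypotheses (Ht : definable_map t) (Hx0 : x0 ∈ omega)
  (Htw : forall x, x ∈ omega -> t x ∈ omega).

Let HDt a : Tm a -> Tm (fun e => t (a e)) := Tm_fun1 t Ht a.

Lemma rec_def : definable (fun p => forall R, opair empty x0 ∈ R ->
    (forall n y, opair n y ∈ R -> opair (succ n) (t y) ∈ R) -> p ∈ R).
Proof. by def. Qed.

Lemma recE p : p ∈ rec t x0 <-> p ∈ cart omega omega /\ forall R, opair empty x0 ∈ R ->
    (forall n y, opair n y ∈ R -> opair (succ n) (t y) ∈ R) -> p ∈ R.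
Proof. by rewrite /rec sealedE sepE //; exact: rec_def. Qed.

Lemma rec0 : opair empty x0 ∈ rec t x0.
Proof. by rewrite recE opair_cart. Qed.

Lemma recS n y : opair n y ∈ rec t x0 -> opair (succ n) (t y) ∈ rec t x0.
Proof.
rewrite !recE !opair_cart => -[[nw yw] H]; split; first by split; [apply: succ_omega|apply: Htw].
by move=> R R0 RS; apply/RS/H.
Qed.

(** Closure of R is only asked at pairs of the recursion itself, since R can be intersected with
    it. *)
Lemma rec_min p R : p ∈ rec t x0 -> opair empty x0 ∈ R ->
  (forall n y, opair n y ∈ rec t x0 -> opair n y ∈ R -> opair (succ n) (t y) ∈ R) -> p ∈ R.
Proof.
move=> pr R0 RS.
have E q : q ∈ sep R (fun p => p ∈ rec t x0) <-> q ∈ R /\ q ∈ rec t x0 by apply: sepE.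
have : p ∈ sep R (fun p => p ∈ rec t x0); last by rewrite E; case.
move: pr; rewrite {1}recE => -[_]; apply; rewrite ?E; first by split=> //; exact: rec0.
by move=> n y; rewrite !E => -[nR nr]; split; [exact: RS|exact: recS].
Qed.

Lemma rec_family : is_function (rec t x0) omega omega.
Proof.
have inc p : p ∈ rec t x0 -> p ∈ cart omega omega.
  by rewrite recE; case.
split; last by move=> x y; rewrite mapsE => /inc; rewrite opair_cart; case.
split=> [p /inc|].
  by rewrite cartE => -[x [y [xw [_ ->]]]]; exists x, y; rewrite is_opairP.
apply: omega_ind; first by def.
  exists x0; split=> [|y]; rewrite mapsE; first exact: rec0.
  move=> H; apply: NNPP => ne.
  (* Minimality excludes a second value: deleting the pair leaves the relation closed, since no step
     leads to index 0. *)
  have : opair empty y ∈ diff (rec t x0) (sing (opair empty y)).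
    apply: rec_min => // [|n z nr _]; rewrite diffE singE; split; try exact: rec0; try exact: recS.
    - by move=> /opair_inj [_ E]; apply: ne.
    - by move=> /opair_inj [E _]; apply: (succ_neq0 n).
  by rewrite diffE singE => -[_]; apply.
move=> n nw [y [Hy U]]; exists (t y); rewrite mapsE in Hy; split=> [|z]; rewrite mapsE; first exact: recS.
move=> H; apply: NNPP => ne.
(* Again the pair can be deleted: a step to [succ n] starts at n, whose only value is y, and so
   leads to [t y], not to z. *)
have : opair (succ n) z ∈ diff (rec t x0) (sing (opair (succ n) z)).
  apply: rec_min => // [|m u mr _]; rewrite diffE singE; split; try exact: rec0; try exact: recS.
  - by move=> /opair_inj [/esym E _]; apply: (succ_neq0 n).
  - move=> /opair_inj [/succ_inj E1 E2]; subst m; apply: ne.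
    by rewrite (U u) // mapsE.
by rewrite diffE singE => -[_]; apply.
Qed.

Lemma iter0 : iter t x0 empty = x0.
Proof.
apply/esym; have [Hf _] := rec_family.
have : maps (rec t x0) empty x0 by rewrite mapsE; exact: rec0.
rewrite iterE.
by rewrite (family_maps _ _ _ _ Hf); case.
Qed.

Lemma iter_omega n : n ∈ omega -> iter t x0 n ∈ omega.
Proof. by rewrite iterE; have /is_functionP [_ H] := rec_family; apply: H. Qed.

Lemma iterS n : n ∈ omega -> iter t x0 (succ n) = t (iter t x0 n).
Proof.
move=> nw; have [Hf _] := rec_family; apply/esym.
have : maps (rec t x0) (succ n) (t (iter t x0 n)); last by rewrite (family_maps _ _ _ _ Hf) -iterE; case.
by rewrite mapsE; apply: recS; rewrite -mapsE (family_maps _ _ _ _ Hf) iterE.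
Qed.

(** A sequence as in [iterate] exists by [rec_family], and by induction any such sequence agrees
    with the recursion. *)
Lemma iterateE (step : M -> M -> Prop) n y :
  (forall x y, x ∈ omega -> step x y <-> y = t x) ->
  iterate step x0 n y <-> n ∈ omega /\ y = iter t x0 n.
Proof.
move=> Hstep; split=> [[w [u [/is_omegaP -> [Hu [H0 [HS Hny]]]]]]|[nw ->]].
  have /is_functionP [Hfam Hw] := Hu.
  move: Hny; rewrite (family_maps _ _ _ _ Hfam) => -[nw ->]; split=> //.
  move: n nw; apply: omega_ind; first by apply: Def_eq; [def|apply: (Tm_iter (fun x _ => t x))].
    have /(H0 empty) : is_empty empty by apply/is_emptyP.
    by rewrite (family_maps _ _ _ _ Hfam) iter0 => -[_].
  move=> n nw IH; rewrite iterS // -IH; apply/Hstep; first exact: Hw.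
  by apply: (HS n (succ n)); rewrite ?is_succP // (family_maps _ _ _ _ Hfam) //; split=> //; apply: succ_omega.
have [Hf _] := rec_family.
exists omega, (rec t x0); split; first exact: omegaP.
split; first exact: rec_family.
split; first by move=> z /is_emptyP ->; rewrite mapsE; exact: rec0.
split; last by rewrite (family_maps _ _ _ _ Hf) iterE.
move=> i i' x z /is_succP ->; rewrite !(family_maps _ _ _ _ Hf) => -[iw ->] [_ ->].
by rewrite -!iterE iterS //; apply/Hstep => //; exact: iter_omega.
Qed.

End Recursion.

Create HintDb omega.
#[local] Hint Resolve zero_omega succ_omega : omega.
Ltac omega_tac := solve [reflexivity | auto 20 with omega nocore].

Definition one := sealed (succ empty).
Definition add := sealed (fun n k => iter succ n k).
Definition mul := sealed (fun n k => iter (fun x => add x n) empty k).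
Definition pow2 := sealed (fun n => iter (fun x => add x x) one n).

Lemma one_omega : one ∈ omega.
Proof. by rewrite /one sealedE; apply/succ_omega/zero_omega. Qed.
#[local] Hint Resolve one_omega : omega core.

Lemma Tm_add a b : Tm a -> Tm b -> Tm (fun e => add (a e) (b e)).
Proof.
rewrite /add sealedE.
by move=> Ha Hb; apply: (Tm_iter (fun x _ => succ x)). Qed.
#[local] Hint Resolve Tm_add : def.

Lemma Tm_mul a b : Tm a -> Tm b -> Tm (fun e => mul (a e) (b e)).
Proof.
rewrite /mul sealedE; apply: (Tm_fun2 (fun n k => iter (fun x => add x n) empty k)).
by apply: (Tm_iter (fun x e => add x (e 0))).
Qed.
#[local] Hint Resolve Tm_mul : def.

Lemma Tm_pow2 a : Tm a -> Tm (fun e => pow2 (a e)).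
Proof.
rewrite /pow2 sealedE.
by move=> Ha; apply: (Tm_iter (fun x e => add x x)) => //; apply: Tm_const. Qed.
#[local] Hint Resolve Tm_pow2 : def.

Lemma add_omega n k : n ∈ omega -> k ∈ omega -> add n k ∈ omega.
Proof.
rewrite /add sealedE.
by move=> nw; apply: iter_omega => //; exact: succ_omega. Qed.
#[local] Hint Resolve add_omega : omega.

Lemma addn0 n : n ∈ omega -> add n empty = n.
Proof.
rewrite /add sealedE.
by move=> nw; apply: iter0 => //; exact: succ_omega. Qed.

Lemma addnS n k : n ∈ omega -> k ∈ omega -> add n (succ k) = succ (add n k).
Proof.
rewrite /add sealedE.
by move=> nw kw; apply: iterS => //; exact: succ_omega. Qed.

Lemma mul_omega n k : n ∈ omega -> k ∈ omega -> mul n k ∈ omega.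
Proof.
rewrite /mul sealedE.
by move=> nw; apply: iter_omega => // x xw; exact: add_omega. Qed.
#[local] Hint Resolve mul_omega : omega.

Lemma muln0 n : n ∈ omega -> mul n empty = empty.
Proof.
rewrite /mul sealedE.
by move=> nw; apply: iter0 => // x xw; exact: add_omega. Qed.

Lemma mulnS n k : n ∈ omega -> k ∈ omega -> mul n (succ k) = add (mul n k) n.
Proof.
rewrite /mul sealedE.
by move=> nw kw; apply: (iterS (fun x => add x n)) => // x xw; exact: add_omega. Qed.

Lemma pow2_omega n : n ∈ omega -> pow2 n ∈ omega.
Proof.
rewrite /pow2 sealedE.
by apply: iter_omega => // x xw; exact: add_omega. Qed.
#[local] Hint Resolve pow2_omega : omega.

Lemma pow20 : pow2 empty = one.
Proof.
rewrite /pow2 sealedE.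
by apply: iter0 => // x xw; exact: add_omega. Qed.

Lemma pow2S n : n ∈ omega -> pow2 (succ n) = add (pow2 n) (pow2 n).
Proof.
rewrite /pow2 sealedE.
by move=> nw; apply: (iterS (fun x => add x x)) => // x xw; exact: add_omega. Qed.

Lemma nat_addE n k m : n ∈ omega -> nat_add n k m <-> k ∈ omega /\ m = add n k.
Proof.
rewrite /add sealedE.
move=> nw; apply: iterateE => //; first exact: succ_omega.
by move=> x y _; apply: is_succP.
Qed.

Lemma nat_mulE n k m : n ∈ omega -> nat_mul n k m <-> k ∈ omega /\ m = mul n k.
Proof.
rewrite /mul sealedE.
move=> nw.
have E : iterate (fun x y => nat_add x n y) empty k m <->
    k ∈ omega /\ m = iter (fun x => add x n) empty k.
  apply: (iterateE (fun x => add x n)) => // x; first by move=> xw; exact: add_omega.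
  by move=> y xw; rewrite nat_addE //; tauto.
rewrite -E; split=> [[z [/is_emptyP -> //]]|H].
by exists empty; rewrite is_emptyP.
Qed.

Lemma nat_pow2E n m : nat_pow2 n m <-> n ∈ omega /\ m = pow2 n.
Proof.
rewrite /pow2 sealedE.
have E : iterate (fun x y => nat_add x x y) one n m <->
    n ∈ omega /\ m = iter (fun x => add x x) one n.
  apply: (iterateE (fun x => add x x)) => // x; first by move=> xw; exact: add_omega.
  by move=> y xw; rewrite nat_addE //; tauto.
rewrite -E; split=> [[z [u [/is_emptyP -> [/is_succP ->]]]]|H].
  by rewrite /one sealedE.
exists empty, one; split; first exact/is_emptyP.
by split=> //; apply/is_succP; rewrite /one sealedE.
Qed.

Lemma add0n n : n ∈ omega -> add empty n = n.
Proof.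
move: n; apply: omega_ind => [||n nw IH]; first by def.
  exact: addn0.
by rewrite addnS // IH.
Qed.

Lemma addSn n k : n ∈ omega -> k ∈ omega -> add (succ n) k = succ (add n k).
Proof.
move=> nw; move: k; apply: omega_ind => [||k kw IH]; first by def.
  by rewrite !addn0 //; apply: succ_omega.
by rewrite !addnS ?IH //; apply: succ_omega.
Qed.

Lemma addC n k : n ∈ omega -> k ∈ omega -> add n k = add k n.
Proof.
move=> nw; move: k; apply: omega_ind => [||k kw IH]; first by def.
  by rewrite addn0 // add0n.
by rewrite addnS // addSn // IH.
Qed.

Lemma addA n k m : n ∈ omega -> k ∈ omega -> m ∈ omega ->
  add n (add k m) = add (add n k) m.
Proof.
move=> nw kw; move: m; apply: omega_ind => [||m mw IH]; first by def.
  by rewrite !addn0 //; apply: add_omega.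
by rewrite !addnS ?IH //; try omega_tac.
Qed.

Lemma mul0n n : n ∈ omega -> mul empty n = empty.
Proof.
move: n; apply: omega_ind => [||n nw IH]; first by def.
  exact: muln0.
by rewrite mulnS // IH addn0.
Qed.

Lemma mulSn n k : n ∈ omega -> k ∈ omega -> mul (succ n) k = add k (mul n k).
Proof.
move=> nw; move: k; apply: omega_ind => [||k kw IH]; first by def.
  by rewrite !muln0 ?addn0 //; apply: succ_omega.
rewrite !mulnS ?IH //; try omega_tac.
rewrite addnS; try omega_tac.
rewrite addSn; try omega_tac.
rewrite addA; try omega_tac.
Qed.

Lemma mulC n k : n ∈ omega -> k ∈ omega -> mul n k = mul k n.
Proof.
move=> nw; move: k; apply: omega_ind => [||k kw IH]; first by def.
  by rewrite muln0 // mul0n.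
by rewrite mulnS // mulSn // IH addC //; try omega_tac.
Qed.

Lemma mul1n n : n ∈ omega -> mul one n = n.
Proof.
by move=> nw; rewrite /one sealedE mulSn // mul0n // addn0.
Qed.

Lemma mulDl n k m : n ∈ omega -> k ∈ omega -> m ∈ omega ->
  mul (add n k) m = add (mul n m) (mul k m).
Proof.
move=> nw kw; move: m; apply: omega_ind => [||m mw IH]; first by def.
  rewrite muln0; try omega_tac.
  rewrite muln0; try omega_tac.
  rewrite muln0; try omega_tac.
  rewrite addn0; try omega_tac.
rewrite mulnS; try omega_tac.
rewrite IH; try omega_tac.
rewrite (mulnS n m); try omega_tac.
rewrite (mulnS k m); try omega_tac.
rewrite -(addA (mul n m)); try omega_tac.
rewrite (addA (mul k m) n k); try omega_tac.
rewrite (addC (mul k m) n); try omega_tac.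
rewrite -(addA n); try omega_tac.
rewrite -(addA (mul n m) n); try omega_tac.
Qed.

Lemma mulA n k m : n ∈ omega -> k ∈ omega -> m ∈ omega ->
  mul n (mul k m) = mul (mul n k) m.
Proof.
move=> nw kw; move: m; apply: omega_ind => [||m mw IH]; first by def.
  by rewrite !muln0 //; try omega_tac.
rewrite !mulnS //; try omega_tac; rewrite -IH.
rewrite (mulC n (add (mul k m) k)); try omega_tac.
rewrite mulDl; try omega_tac.
rewrite (mulC (mul k m) n); try omega_tac.
rewrite (mulC k n); try omega_tac.
Qed.

Lemma addnI n k m : n ∈ omega -> k ∈ omega -> m ∈ omega ->
  add n m = add k m -> n = k.
Proof.
move=> nw kw; move: m; apply: omega_ind => [||m mw IH]; first by def.
  by rewrite !addn0.
by rewrite !addnS // => /succ_inj.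
Qed.

Lemma omega_case n : n ∈ omega -> n = empty \/ exists k, k ∈ omega /\ n = succ k.
Proof.
move: n; apply: omega_ind => [||n nw _]; [by def|by left|].
by right; exists n.
Qed.

Lemma ltP n k : n ∈ omega -> k ∈ omega ->
  n ∈ k <-> exists m, m ∈ omega /\ k = add n (succ m).
Proof.
move=> nw; move: k; apply: omega_ind => [||k kw IH]; first by def.
  split=> [/emptyE //|[m [mw]]]; rewrite addnS // => /esym E.
  by case: (succ_neq0 _ E).
rewrite succE IH; split=> [[[m [mw ->]]|->]|[m [mw]]].
- exists (succ m); split; first exact: succ_omega.
  rewrite (addnS n (succ m)); try omega_tac.
- by exists empty; rewrite addnS ?addn0.
rewrite addnS // => /succ_inj ->.
have [->|[m' [mw' ->]]] := omega_case m mw; first by right; rewrite addn0.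
by left; exists m'.
Qed.

Lemma leq_total n k : n ∈ omega -> k ∈ omega ->
  n ∈ k \/ exists m, m ∈ omega /\ n = add k m.
Proof.
move=> nw; move: k; apply: omega_ind => [||k kw [IH|[m [mw ->]]]]; first by def.
- by right; exists n; rewrite add0n.
- by left; rewrite succE; left.
have [->|[m' [mw' ->]]] := omega_case m mw.
  by left; rewrite addn0 // succE; right.
by right; exists m'; rewrite addnS // addSn.
Qed.

End Omega.
#[global] Hint Resolve Def_inductive_set Tm_omega Tm_add Tm_mul Tm_pow2 Tm_iter : def.
#[global] Hint Resolve zero_omega succ_omega one_omega add_omega mul_omega pow2_omega : omega.
#[global] Hint Resolve zero_omega one_omega : core.

(** * The naturals of the model as a commutative semiring *)

Section Naturals.
Context {M : structure} {HM : models_ZF M}.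

(** A metalevel type for the elements of omega, introduced so that [ring] proves identities of the
    model's arithmetic. *)
Definition N : Type := {n : M | n ∈ omega}.
Definition mkN (x : M) (xw : x ∈ omega) : N := exist (fun n => n ∈ omega) x xw.
Definition nat_val (n : N) : M := proj1_sig n.
Implicit Types a b c d m p q r u v w : N.

Lemma nat_valP a : nat_val a ∈ omega.
Proof. by case: a. Qed.

Lemma nat_val_inj a b : nat_val a = nat_val b -> a = b.
Proof. by case: a b => [x xw] [y yw] /= E; subst y; rewrite (proof_irrelevance _ xw yw). Qed.

Definition N0 : N := mkN empty zero_omega.
Definition N1 : N := mkN one one_omega.
Definition Nadd a b : N := mkN _ (add_omega _ _ (nat_valP a) (nat_valP b)).
Definition Nmul a b : N := mkN _ (mul_omega _ _ (nat_valP a) (nat_valP b)).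

Lemma N_semiring : semi_ring_theory N0 N1 Nadd Nmul (@eq N).
Proof.
have W := nat_valP.
split=> *; apply: nat_val_inj => /=.
- exact: add0n.
- exact: addC.
- exact: addA.
- exact: mul1n.
- exact: mul0n.
- exact: mulC.
- exact: mulA.
- exact: mulDl.
Qed.

Add Ring N_ring : N_semiring.

Declare Scope N_internal_scope.
Local Open Scope N_internal_scope.
Local Notation "a + b" := (Nadd a b) : N_internal_scope.
Local Notation "a * b" := (Nmul a b) : N_internal_scope.
Local Notation "0" := N0 : N_internal_scope.
Local Notation "1" := N1 : N_internal_scope.

Definition Nlt a b : Prop := nat_val a ∈ nat_val b.

Lemma val_add1 a : nat_val (a + 1) = succ (nat_val a).
Proof. rewrite /= /one sealedE addnS ?addn0 //; exact: nat_valP. Qed.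

Lemma Nadd_cancel c a b : a + c = b + c -> a = b.
Proof.
move=> E; apply: nat_val_inj; apply: (addnI _ _ (nat_val c)); try exact: nat_valP.
by move: (f_equal nat_val E).
Qed.

Lemma Nadd1_neq0 a : a + 1 <> 0.
Proof. by move=> /(f_equal nat_val); rewrite val_add1; exact: succ_neq0. Qed.

Lemma Nlt_ex a b : Nlt a b <-> exists c, b = a + c + 1.
Proof.
rewrite /Nlt ltP; try exact: nat_valP.
split=> [[m [mw E]]|[c ->]].
  exists (mkN m mw); apply: nat_val_inj; rewrite val_add1 E /= addnS //.
  exact: nat_valP.
exists (nat_val c); split; first exact: nat_valP.
by rewrite val_add1 /= addnS //; exact: nat_valP.
Qed.

Lemma Nlt_or_ge a b : Nlt a b \/ exists c, a = b + c.
Proof.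
have [H|[m [mw E]]] := leq_total _ _ (nat_valP a) (nat_valP b); first by left.
by right; exists (mkN m mw); apply: nat_val_inj.
Qed.

Lemma Nadd1_cancel a c : a <> a + c + 1.
Proof.
by move=> E; apply: (Nadd1_neq0 c); apply: (Nadd_cancel a); rewrite {2}E; ring.
Qed.

Lemma Npos q : q <> 0 -> exists c, q = c + 1.
Proof.
move=> q0; have [E|[m [mw E]]] := omega_case _ (nat_valP q).
  by case: q0; apply: nat_val_inj.
by exists (mkN m mw); apply: nat_val_inj; rewrite val_add1.
Qed.

Lemma Nmul_cancel c a b : Nlt (c * a) (c * b) -> Nlt a b.
Proof.
case: (Nlt_or_ge a b) => // -[d ->] /Nlt_ex [u E]; exfalso.
by apply: (Nadd1_cancel (c * b) (c * d + u)); rewrite {1}E; ring.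
Qed.

(** Here and up to [Nfrac_sum], an inequality such as [Nlt (p * m) q] is p/q < 1/m without division,
    with m standing for a power of two. *)
Lemma Nlt_mul_weaken p q a b : Nlt a b -> Nlt (p * b) q -> Nlt (p * a) q.
Proof.
move=> /Nlt_ex [c ->] /Nlt_ex [d ->]; apply/Nlt_ex.
by exists (p * c + p + d); ring.
Qed.

(** A nonzero p/q is at least 1/q. With m = 2^q this shows that no positive fraction is below all
    1/2^n. *)
Lemma Nlt_mul_ge p q m : p <> 0 -> Nlt (p * m) q -> ~ Nlt q m.
Proof.
move=> /Npos [a ->] /Nlt_ex [c E] /Nlt_ex [d Em].
apply: (Nadd1_cancel q (d + a * m + c + 1)).
by transitivity (a * m + m + c + 1); [rewrite {1}E; ring|rewrite {2}Em; ring].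
Qed.

(** The number u witnesses p/q <= p'/q' after cross-multiplication. *)
Lemma Nfrac_down p q p' q' u m : q <> 0 -> p * q' + u = p' * q ->
  Nlt (p' * m) q' -> Nlt (p * m) q.
Proof.
move=> /Npos [c ->] E /Nlt_ex [v Eq]; case: (Nlt_or_ge (p * m) (c + 1)) => // -[w Ew].
exfalso; apply: (Nadd1_cancel (p' * (c + 1) * m) (c + v * (c + 1) + q' * w + u * m)).
transitivity ((p * m) * q' + u * m); first by rewrite -E; ring.
by rewrite Ew; transitivity ((c + 1) * q' + w * q' + u * m); [ring|rewrite {1}Eq; ring].
Qed.

(** The mediant (p + 1)/(q + m) of p/q and 1/m lies strictly between them; this is why the cut of
    1/m has no greatest element. *)
Lemma Nmediant p q m : Nlt (p * m) q ->
  Nlt ((p + 1) * m) (q + m) /\ Nlt (p * (q + m)) ((p + 1) * q).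
Proof.
move=> /Nlt_ex [c E]; rewrite !Nlt_ex; split.
  by exists c; rewrite E; ring.
by exists c; rewrite {2}E {1}E; transitivity (p * (q + m) + (c + 1)); rewrite E; ring.
Qed.

(** Two halves of 1/m make up 1/m. The inequality is proved doubled, because the hypotheses speak of
    m + m. *)
Lemma Nfrac_sum p q p' q' m : Nlt (p * (m + m)) q -> Nlt (p' * (m + m)) q' ->
  Nlt ((p * q' + p' * q) * m) (q * q').
Proof.
move=> /Nlt_ex [c E] /Nlt_ex [c' E']; apply: (Nmul_cancel (1 + 1)); apply/Nlt_ex.
exists (c * q' + (c' + 1) * q + (p' * (m + m) + c')).
have E1 : q * q' = (p * (m + m) + c + 1) * q' by rewrite {1}E.
have E2 : q * q' = (p' * (m + m) + c' + 1) * q by rewrite {1}E'; ring.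
have E3 z : z + (p' * (m + m) + c') + 1 = z + q' by rewrite E'; ring.
transitivity (q * q' + q * q'); first by ring.
rewrite {1}E1 E2.
transitivity ((1 + 1) * ((p * q' + p' * q) * m) + (c * q' + (c' + 1) * q) + q'); first by ring.
by rewrite -E3; ring.
Qed.

(* (a + b)^2 <= Npair a b < (a + b + 1)^2, so the code determines a + b. *)
Definition Npair a b : N := (a + b) * (a + b) + b.

Lemma Npair_inj a b a' b' : Npair a b = Npair a' b' -> a = a' /\ b = b'.
Proof.
have lt_case x y x' y' : Nlt (x + y) (x' + y') -> Npair x y = Npair x' y' -> False.
  move=> /Nlt_ex [c E]; rewrite /Npair E => H.
  apply: (Nadd1_cancel y ((x + y) * c + (x + y) * c + x + x + y + c * c + c + c + y')).
  apply: (Nadd_cancel ((x + y) * (x + y))).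
  by transitivity ((x + y) * (x + y) + y); [ring|rewrite H; ring].
move=> E; have Es : a + b = a' + b'.
  have [/lt_case /(_ E) //|[c Ec]] := Nlt_or_ge (a + b) (a' + b').
  have [/lt_case /(_ (esym E)) //|[c' Ec']] := Nlt_or_ge (a' + b') (a + b).
  have [c0|c0] := classic (c = 0); first by rewrite Ec c0; ring.
  have [u Eu] := Npos c c0; exfalso; apply: (Nadd1_cancel (a' + b') (u + c')).
  by rewrite {1}Ec' Ec Eu; ring.
have Eb : b = b'.
  apply: (Nadd_cancel ((a + b) * (a + b))); move: E; rewrite /Npair -Es => E.
  by transitivity ((a + b) * (a + b) + b); [ring|rewrite E; ring].
by split=> //; apply: (Nadd_cancel b); rewrite Es Eb.
Qed.

End Naturals.

(** * Nonnegative reals *)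

Section Order.
Context {M : structure} {HM : models_ZF M}.
Implicit Types (x y z n k m p q A B C F J : M).

Lemma lt_trans n k m : m ∈ omega -> n ∈ k -> k ∈ m -> n ∈ m.
Proof.
move=> mw nk; move: m mw; apply: omega_ind => [|/emptyE //|m mw IH]; first by def.
by rewrite !succE => -[/IH|<-]; left.
Qed.

(** From here on, k <= n is written [k ∈ succ n]. *)
Lemma lt_or_le n k : n ∈ omega -> k ∈ omega -> n ∈ k \/ k ∈ succ n.
Proof.
move=> nw kw; have [|[m [mw ->]]] := leq_total n k nw kw; [by left|right].
have [->|[m' [mw' ->]]] := omega_case m mw; first by rewrite addn0 // succE; right.
by rewrite succE ltP; [left; exists m'| |apply: add_omega => //; apply: succ_omega].
Qed.

Lemma lt_irrefl n : ~ n ∈ n.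
Proof. by move=> H; apply: (elem_asym n n). Qed.

Lemma lt_succ_trans n k m : m ∈ omega -> n ∈ succ k -> k ∈ m -> n ∈ m.
Proof. by move=> mw; rewrite succE => -[nk km|-> //]; apply: (lt_trans _ k). Qed.

Lemma le_trans n k m : m ∈ omega -> n ∈ succ k -> k ∈ succ m -> n ∈ succ m.
Proof.
move=> mw nk; rewrite (succE m k) => -[km|<- //].
by rewrite succE; left; apply: (lt_succ_trans _ k).
Qed.

Lemma omega_max n k : n ∈ omega -> k ∈ omega ->
  exists m, m ∈ omega /\ n ∈ succ m /\ k ∈ succ m.
Proof.
move=> nw kw; have [nk|kn] := lt_or_le n k nw kw.
  by exists k; rewrite !succE; split=> //; split; [left|right].
by exists n; split=> //; split=> //; rewrite succE; right.
Qed.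

Lemma pow2_lt_succ k : k ∈ omega -> pow2 k ∈ pow2 (succ k).
Proof.
have pos n : n ∈ omega -> exists m, m ∈ omega /\ pow2 n = succ m.
  move: n; apply: omega_ind => [||n nw [m [mw E]]]; first by def.
    by exists empty; rewrite pow20 /one sealedE.
  have W := pow2_omega n nw.
  exists (add (pow2 n) m); split; first exact: add_omega.
  by rewrite pow2S // {2}E addnS.
move=> kw; have [m [mw E]] := pos k kw.
have W := pow2_omega k kw.
rewrite pow2S // ltP //; last exact: add_omega.
by exists m; split=> //; rewrite -E.
Qed.

Lemma pow2_lt n k : k ∈ omega -> n ∈ k -> pow2 n ∈ pow2 k.
Proof.
move=> kw; move: k kw n; apply: omega_ind => [|n /emptyE //|k kw IH n]; first by def.
rewrite succE => -[/IH H|->]; last exact: pow2_lt_succ.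
apply: (lt_trans _ (pow2 k)) => //; last exact: pow2_lt_succ.
exact/pow2_omega/succ_omega.
Qed.

Lemma lt_pow2 n : n ∈ omega -> n ∈ pow2 n.
Proof.
move: n; apply: omega_ind => [||n nw IH]; first by def.
  by rewrite pow20 /one sealedE succE; right.
have W := succ_omega n nw.
have [//|H] := lt_or_le _ _ (succ_omega n nw) (pow2_omega _ W).
exfalso; have := pow2_lt_succ n nw; move: H; rewrite succE => -[H|-> H].
  move: H; rewrite succE => -[H H'|-> H'].
    by apply: (elem_asym n (pow2 n)) => //; apply: lt_trans H' H.
  exact: (elem_asym n (pow2 n)).
move: H; rewrite succE => -[H|H]; first exact: (elem_asym n (pow2 n)).
by apply: (lt_irrefl n); rewrite -{2}H.
Qed.

End Order.

(** * The cuts of the powers 1/2^n and their suprema *)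

Section Reals.
Context {M : structure} {HM : models_ZF M}.
Implicit Types (x y z n k m p q A B C F J : M).

Definition fractions := cart omega omega.
(** The cut of 1/2^n as a term; the inequality by itself forces q to be nonzero. *)
Definition half := sealed (fun n => sep fractions (fun z =>
  exists p q, z = opair p q /\ mul p (pow2 n) ∈ q)).

Lemma halfE n p q : opair p q ∈ half n <->
  p ∈ omega /\ q ∈ omega /\ mul p (pow2 n) ∈ q.
Proof.
rewrite /half sealedE sepE // /fractions opair_cart.
split=> [[[pw qw] [p' [q' [/opair_inj [<- <-] H]]]] //|[pw [qw H]]].
by split=> //; exists p, q.
Qed.

Lemma half_frac n z : z ∈ half n -> exists p q, p ∈ omega /\ q ∈ omega /\ z = opair p q.
Proof. by rewrite /half sealedE sepE // => -[H _]; move: H; rewrite /fractions cartE. Qed.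

Lemma Tm_half (a : (nat -> M) -> M) : Tm a -> Tm (fun e => half (a e)).
Proof. by apply: (Tm_fun1 half); rewrite /half sealedE /fractions; def. Qed.
#[local] Hint Resolve Tm_half : def.

Lemma is_fractionP x p q :
  is_fraction x p q <-> p ∈ omega /\ q ∈ omega /\ q <> empty /\ x = opair p q.
Proof. by rewrite /is_fraction !is_natP is_opairP is_emptyP. Qed.

Lemma frac_leE p q p' q' : p ∈ omega -> q ∈ omega -> p' ∈ omega -> q' ∈ omega ->
  q <> empty -> q' <> empty ->
  frac_le (opair p q) (opair p' q') <->
  mul p q' ∈ mul p' q \/ mul p q' = mul p' q.
Proof.
move=> pw qw pw' qw' q0 q0'; split.
  move=> [a [b [a' [b' [u [v [/is_fractionP [aw [bw [b0 E]]]]]]]]]].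
  move=> [/is_fractionP [aw' [bw' [b0' E']]]].
  by move: E E' => /opair_inj [-> ->] /opair_inj [-> ->]; rewrite !nat_mulE // => -[[_ ->] [[_ ->]]].
move=> H; exists p, q, p', q', (mul p q'), (mul p' q).
by rewrite !is_fractionP !nat_mulE.
Qed.

Lemma frac_ltE p q p' q' : p ∈ omega -> q ∈ omega -> p' ∈ omega -> q' ∈ omega ->
  q <> empty -> q' <> empty ->
  frac_lt (opair p q) (opair p' q') <-> mul p q' ∈ mul p' q.
Proof.
move=> pw qw pw' qw' q0 q0'; split.
  move=> [a [b [a' [b' [u [v [/is_fractionP [aw [bw [b0 E]]]]]]]]]].
  move=> [/is_fractionP [aw' [bw' [b0' E']]]].
  by move: E E' => /opair_inj [-> ->] /opair_inj [-> ->]; rewrite !nat_mulE // => -[[_ ->] [[_ ->]]].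
move=> H; exists p, q, p', q', (mul p q'), (mul p' q).
by rewrite !is_fractionP !nat_mulE.
Qed.

Lemma half_denom n p q : opair p q ∈ half n -> q <> empty.
Proof. by rewrite halfE => -[_ [_ H]] E; move: H; rewrite E => /emptyE. Qed.

Lemma half_down n x y : n ∈ omega -> x ∈ half n -> frac_le y x -> y ∈ half n.
Proof.
move=> nw + H; have [p [q [p' [q' [a [b [Fy [Fx _]]]]]]]] := H.
move: Fx Fy H => /is_fractionP [pw' [qw' [q0' ->]]] /is_fractionP [pw [qw [q0 ->]]].
rewrite frac_leE // !halfE => H [_ [_ Hx]]; split=> //; split=> //.
have Hq : mkN q qw <> N0 by move/(f_equal nat_val).
have [u Hu] : exists u, Nadd (Nmul (mkN p pw) (mkN q' qw')) u = Nmul (mkN p' pw') (mkN q qw).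
  case: H => [H|H].
    have /Nlt_ex [c Ec] : Nlt (Nmul (mkN p pw) (mkN q' qw')) (Nmul (mkN p' pw') (mkN q qw)) by [].
    by exists (Nadd c N1); rewrite Ec; apply: nat_val_inj; rewrite /= addA //; first [exact: nat_valP|exact: mul_omega].
  by exists N0; apply: nat_val_inj; rewrite /= H addn0 //; exact: mul_omega.
exact: (Nfrac_down _ _ _ _ u (mkN (pow2 n) (pow2_omega _ nw)) Hq Hu).
Qed.

Lemma half_open n x : n ∈ omega -> x ∈ half n -> exists y, y ∈ half n /\ frac_lt x y.
Proof.
move=> nw H; have [p [q [pw [qw E]]]] := half_frac _ _ H; subst x.
have W := pow2_omega _ nw; have q0 := half_denom _ _ _ H.
move: H; rewrite halfE => -[_ [_ H]].
have [H1 H2] := Nmediant (mkN p pw) (mkN q qw) (mkN _ W) H.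
have H3 : opair (add p one) (add q (pow2 n)) ∈ half n.
  by rewrite halfE; split; [exact: add_omega|split; [exact: add_omega|exact: H1]].
exists (opair (add p one) (add q (pow2 n))); split=> //.
rewrite frac_ltE //; try exact: add_omega.
exact: half_denom H3.
Qed.

Lemma half_mono n k x : k ∈ omega -> n ∈ succ k -> x ∈ half k -> x ∈ half n.
Proof.
move=> kw; rewrite succE => -[nk H|-> //].
have nw := elem_omega _ _ kw nk.
have [p [q [pw [qw E]]]] := half_frac _ _ H; subst x.
move: H; rewrite !halfE => -[_ [_ H]]; split=> //; split=> //.
have Hlt : Nlt (mkN _ (pow2_omega _ nw)) (mkN _ (pow2_omega _ kw)) by apply: pow2_lt.
exact: (Nlt_mul_weaken (mkN p pw) (mkN q qw) _ _ Hlt).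
Qed.

(** The fraction 1/2^k separates the two cuts. *)
Lemma half_strict n k : k ∈ omega -> n ∈ k -> ~ subset (half n) (half k).
Proof.
move=> kw nk sub; have nw := elem_omega _ _ kw nk.
have Wn := pow2_omega _ nw; have Wk := pow2_omega _ kw.
have : opair one (pow2 k) ∈ half n by rewrite halfE mul1n //; split=> //; split=> //; apply: pow2_lt.
by move=> /sub; rewrite halfE mul1n // => -[_ [_ /lt_irrefl]].
Qed.

Lemma half_bounded n : n ∈ omega -> ~ opair one one ∈ half n.
Proof.
move=> nw; rewrite halfE => -[_ [_]]; rewrite mul1n; last exact: pow2_omega.
have W := pow2_omega _ nw.
rewrite /one sealedE succE => -[/emptyE //|E].
by have := lt_pow2 _ nw; rewrite E => /emptyE.
Qed.

Lemma is_half_powP r n : is_half_pow r n <-> n ∈ omega /\ r = half n.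
Proof.
split=> [[m [/nat_pow2E [nw ->] H]]|[nw ->]].
  have W := pow2_omega _ nw.
  split=> //; apply: ext => z; rewrite H; split.
    move=> [p [q [a [/is_fractionP [pw [qw [_ ->]]]]]]].
    by rewrite nat_mulE // halfE => -[[_ ->]].
  move=> Hz; have [p [q [pw [qw E]]]] := half_frac _ _ Hz.
  subst z; exists p, q, (mul p (pow2 n)); rewrite is_fractionP nat_mulE //.
  by have := half_denom _ _ _ Hz; move: Hz; rewrite halfE => -[_ [_ ?]].
have W := pow2_omega _ nw.
exists (pow2 n); rewrite nat_pow2E; split=> // z; split.
  move=> Hz; have [p [q [pw [qw E]]]] := half_frac _ _ Hz.
  subst z; exists p, q, (mul p (pow2 n)); rewrite is_fractionP nat_mulE //.
  by have := half_denom _ _ _ Hz; move: Hz; rewrite halfE => -[_ [_ ?]].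
move=> [p [q [a [/is_fractionP [pw [qw [_ ->]]]]]]].
by rewrite nat_mulE // halfE => -[[_ ->]].
Qed.

(** As the order of cuts is inclusion, this union is the supremum of the 1/2^n with P n; it is 0,
    the empty set, if P holds nowhere. *)
Definition union_half (P : M -> Prop) :=
  sep fractions (fun z => exists n, n ∈ omega /\ P n /\ z ∈ half n).

Lemma union_halfE (P : M -> Prop) z : definable P ->
  z ∈ union_half P <-> exists n, n ∈ omega /\ P n /\ z ∈ half n.
Proof.
move=> HP; rewrite /union_half sepE; last first.
  apply: Def_ex; apply: Def_and; first by def.
  apply: Def_and; last by def.
  exact: (Def_pred1 P HP (fun e => e 0) (Tm_var 0)).
split=> [[] //|[n [nw [nP H]]]]; split; last by exists n.
have [p [q [pw [qw ->]]]] := half_frac _ _ H.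
by rewrite /fractions opair_cart.
Qed.

Lemma one_neq0 : one <> empty.
Proof. by rewrite /one sealedE; exact: succ_neq0. Qed.

Lemma union_half_nnreal (P : M -> Prop) : definable P -> is_nnreal (union_half P).
Proof.
move=> HP; split; [|split; [|split]].
- move=> x; rewrite union_halfE // => -[n [_ [_ H]]].
  have [p [q [pw [qw E]]]] := half_frac _ _ H; subst x.
  by exists p, q; rewrite is_fractionP; have := half_denom _ _ _ H.
- move=> x y; rewrite !union_halfE // => -[n [nw [nP H]]] yx.
  by exists n; split=> //; split=> //; apply: half_down H yx.
- move=> x; rewrite !union_halfE // => -[n [nw [nP H]]].
  have [y [Hy xy]] := half_open _ _ nw H.
  by exists y; rewrite union_halfE //; split=> //; exists n.
exists (opair one one), one, one; rewrite is_fractionP; split.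
  by have := one_neq0.
by rewrite union_halfE // => -[n [nw [_ /(half_bounded _ nw)]]].
Qed.

(** If all exponents exceed n, the supremum is at most 1/2^(n+1). An exponent k <= n in P pushes it
    up to at least 1/2^n. *)
Lemma union_half_lt (P : M -> Prop) n : definable P -> n ∈ omega ->
  real_lt (union_half P) (half n) <-> forall k, k ∈ omega -> P k -> n ∈ k.
Proof.
move=> HP nw; split=> [[sub ne] k kw kP|H].
  have [//|kn] := lt_or_le n k nw kw; case: ne; apply: ext => z; split; first exact: sub.
  by move=> Hz; rewrite union_halfE //; exists k; split=> //; split=> //; apply: half_mono Hz.
have sub : subset (union_half P) (half (succ n)).
  move=> z; rewrite union_halfE // => -[k [kw [kP Hz]]].
  apply: half_mono Hz => //; have := H _ kw kP.
  have [sk|/lt_succ_trans] := lt_or_le (succ n) k (succ_omega _ nw) kw.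
    by move=> _; rewrite succE; left.
  have [|] := lt_or_le (succ n) k (succ_omega _ nw) kw.
    by move=> sk _ _; rewrite succE; left.
  rewrite {1}succE => -[|-> _ _]; last by rewrite succE; right.
  by rewrite succE => -[kn _ /(elem_asym _ _ kn)|-> _ /lt_irrefl].
have nsn : n ∈ succ n by rewrite succE; right.
split=> [z /sub|E].
  by apply: half_mono; [exact: succ_omega|rewrite succE; left].
apply: (half_strict n (succ n)) => //; first exact: succ_omega.
by rewrite -E.
Qed.

Lemma nnreal_frac r z : is_nnreal r -> z ∈ r ->
  exists p q, p ∈ omega /\ q ∈ omega /\ q <> empty /\ z = opair p q.
Proof. by move=> [H _] /H [p [q /is_fractionP ?]]; exists p, q. Qed.

Lemma real_sum_half r s t n : n ∈ omega -> subset r (half (succ n)) ->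
  subset s (half (succ n)) -> is_real_add t r s -> subset t (half n).
Proof.
move=> nw rn sn Ht z.
have down : subset (half (succ n)) (half n).
  by move=> u; apply: half_mono; [exact: succ_omega|rewrite succE; left; rewrite succE; right].
rewrite (Ht z) => -[/rn/down //|[/sn/down //|[x [y [u [/rn xr [/sn ys [Hu zu]]]]]]]].
apply: (half_down n u) zu => //.
have [p [q [pw [qw E]]]] := half_frac _ _ xr; subst x.
have [p' [q' [pw' [qw' E]]]] := half_frac _ _ ys; subst y.
case: Hu => [a [b [a' [b' [v [w [c [d]]]]]]]].
rewrite !is_fractionP => -[[aw [bw [_ /opair_inj [E1 E2]]]]].
move=> [[aw' [bw' [_ /opair_inj [E3 E4]]]]]; subst a b a' b'.
rewrite !nat_mulE // => -[[_ ->] [[_ ->]]].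
rewrite nat_addE ?is_opairP => [[[_ ->] [[_ ->] ->]]|]; last exact: mul_omega.
move: xr ys; rewrite !halfE pow2S // => -[_ [_ xr]] [_ [_ ys]].
split; first by apply: add_omega; exact: mul_omega.
split; first exact: mul_omega.
exact: (Nfrac_sum (mkN p pw) (mkN q qw) (mkN p' pw') (mkN q' qw') (mkN _ (pow2_omega _ nw))).
Qed.

Lemma real_lt_all_half r : is_nnreal r -> (forall n, n ∈ omega -> subset r (half n)) ->
  r = empty.
Proof.
move=> Hr H; apply: NNPP => /nonemptyP [x xr].
have [_ [_ [Hopen _]]] := Hr.
(* Being larger than x, the fraction y = p/q has p nonzero; p/q < 1/2^q then contradicts q < 2^q. *)
have [y [yr lt]] := Hopen x xr.
have [p [q [pw [qw [q0 E]]]]] := nnreal_frac _ _ Hr yr; subst y.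
have := H _ qw _ yr; rewrite halfE => -[_ [_ Hp]].
have [p0|p0] := classic (p = empty).
  case: lt => [a [b [a' [b' [u [v]]]]]].
  rewrite !is_fractionP => -[[aw [bw [b0 _]]] [[aw' [bw' [b0' /opair_inj [<- <-]]]]]].
  by rewrite !nat_mulE // p0 mul0n // => -[_ [[_ ->] /emptyE]].
apply: (Nlt_mul_ge (mkN p pw) (mkN q qw) (mkN _ (pow2_omega _ qw))) => //.
  by move/(f_equal nat_val).
exact: lt_pow2.
Qed.

End Reals.
#[global] Hint Resolve Tm_half : def.

(** * Finite sets *)

Section SizeHints.
Context {M : structure}.
Implicit Types a b c d : (nat -> M) -> M.

Lemma Def_is_family a b : Tm a -> Tm b -> Def (fun e => is_family (a e) (b e)).
Proof. by apply: Def_pred2; rewrite /is_family; def. Qed.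
#[local] Hint Resolve Def_is_family : def.

Lemma Def_is_function a b c : Tm a -> Tm b -> Tm c ->
  Def (fun e => is_function (a e) (b e) (c e)).
Proof. by apply: Def_pred3; rewrite /is_function; def. Qed.
#[local] Hint Resolve Def_is_function : def.

Lemma Def_is_family_union a b : Tm a -> Tm b -> Def (fun e => is_family_union (a e) (b e)).
Proof. by apply: Def_pred2; rewrite /is_family_union; def. Qed.
#[local] Hint Resolve Def_is_family_union : def.

Lemma Def_equipotent a b : Tm a -> Tm b -> Def (fun e => equipotent (a e) (b e)).
Proof. by apply: Def_pred2; rewrite /equipotent; def. Qed.
#[local] Hint Resolve Def_equipotent : def.

Lemma Def_is_omega a : Tm a -> Def (fun e => is_omega (a e)).
Proof. by apply: Def_pred1; rewrite /is_omega /inductive_set; def. Qed.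
#[local] Hint Resolve Def_is_omega : def.

Lemma Def_is_nat a : Tm a -> Def (fun e => is_nat (a e)).
Proof. by apply: Def_pred1; rewrite /is_nat; def. Qed.
#[local] Hint Resolve Def_is_nat : def.

Lemma Def_finite a : Tm a -> Def (fun e => finite (a e)).
Proof. by apply: Def_pred1; rewrite /finite; def. Qed.
#[local] Hint Resolve Def_finite : def.

Lemma Def_countable a : Tm a -> Def (fun e => countable (a e)).
Proof. by apply: Def_pred1; rewrite /countable; def. Qed.
#[local] Hint Resolve Def_countable : def.

Lemma Def_cuf a : Tm a -> Def (fun e => cuf (a e)).
Proof. by apply: Def_pred1; rewrite /cuf; def. Qed.
#[local] Hint Resolve Def_cuf : def.

Lemma Def_is_basic_box a b c d : Tm a -> Tm b -> Tm c -> Tm d ->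
  Def (fun e => is_basic_box (a e) (b e) (c e) (d e)).
Proof. by apply: Def_pred4; rewrite /is_basic_box /space_at; def. Qed.

End SizeHints.
#[global] Hint Resolve Def_is_family Def_is_function Def_is_family_union
  Def_equipotent Def_is_omega Def_is_nat Def_finite Def_countable Def_cuf Def_is_basic_box : def.

Section Finite.
Context {M : structure} {HM : models_ZF M}.
Implicit Types (x y z n k m A B F I J : M).

(** Definition by cases as a term of the model: the proposition enters through the membership
    condition, so the result is definable whenever P is. *)
Definition cond := sealed (fun (P : Prop) A B =>
  sep (cup A B) (fun z => (P /\ z ∈ A) \/ (~ P /\ z ∈ B))).

Lemma cond_true (P : Prop) A B : P -> cond P A B = A.
Proof.
move=> H; rewrite /cond sealedE; apply: ext => z; rewrite sepE ?cupE; first by tauto.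
by apply: (Def_ext (fun e => e 0 ∈ A)) => // e; tauto.
Qed.

Lemma cond_false (P : Prop) A B : ~ P -> cond P A B = B.
Proof.
move=> H; rewrite /cond sealedE; apply: ext => z; rewrite sepE ?cupE; first by tauto.
by apply: (Def_ext (fun e => e 0 ∈ B)) => // e; tauto.
Qed.

Lemma Tm_cond (P : (nat -> M) -> Prop) a b : Def P -> Tm a -> Tm b ->
  Tm (fun e => cond (P e) (a e) (b e)).
Proof.
move=> HP Ha Hb; rewrite /cond sealedE.
have HP' : Def (fun e => P (fun i => e (S i))) := Def_shift S HP.
have Ha' := Tm_shift a S Ha; have Hb' := Tm_shift b S Hb.
by def.
Qed.
#[local] Hint Resolve Tm_cond : def.

Definition big_union := sealed (fun I (t : M -> M) => union (image I t)).

Lemma big_unionE I (t : M -> M) x : definable_map t ->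
  x ∈ big_union I t <-> exists i, i ∈ I /\ x ∈ t i.
Proof.
move=> Ht; rewrite /big_union sealedE unionE; split=> [[A []]|[i [iI xi]]].
  by rewrite imageE // => -[i [iI ->]] xi; exists i.
by exists (t i); rewrite imageE //; split=> //; exists i.
Qed.

Lemma Tm_big_union a (t : M -> (nat -> M) -> M) :
  Tm a -> Tm (fun e => t (e 0) (fun i => e (S i))) ->
  Tm (fun e => big_union (a e) (fun x => t x e)).
Proof. by move=> Ha Ht; rewrite /big_union sealedE; apply: Tm_union; apply: Tm_image. Qed.
#[local] Hint Resolve Tm_big_union : def.

Definition bij_on (t : M -> M) A B :=
  [/\ forall x, x ∈ A -> t x ∈ B,
      forall y, y ∈ B -> exists x, x ∈ A /\ t x = y &
      forall x y, x ∈ A -> y ∈ A -> t x = t y -> x = y].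

Lemma equipotent_intro (t : M -> M) A B : definable_map t -> bij_on t A B -> equipotent A B.
Proof.
move=> Ht [H1 H2 H3]; exists (lam A t); split.
  rewrite is_functionP; split; first exact: lam_family.
  by move=> x xA; rewrite app_lam //; apply: H1.
move=> y /H2 [x [xA E]]; exists x; split; first by rewrite maps_lam.
by move=> x'; rewrite maps_lam // => -[xA' E']; apply: H3 => //; rewrite E E'.
Qed.

Lemma equipotent_elim A B : equipotent A B -> exists f, bij_on (app f) A B.
Proof.
move=> [f [/is_functionP [Hf H1] H2]]; exists f; split=> //.
  move=> y /H2 [x [Hx _]]; exists x.
  by move: Hx; rewrite (family_maps _ _ _ _ Hf) => -[xA ->].
move=> x y xA yA E; have [z [_ Hz]] := H2 _ (H1 _ xA).
by rewrite -(Hz x) ?(family_maps _ _ _ _ Hf) //; apply: Hz; rewrite (family_maps _ _ _ _ Hf).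
Qed.

Lemma finiteP A : finite A <-> exists n, n ∈ omega /\ equipotent A n.
Proof. by split=> -[n [nw H]]; exists n; move: nw; rewrite is_natP. Qed.

Lemma finite_empty : finite empty.
Proof.
apply/finiteP; exists empty; split=> //; apply: (equipotent_intro (fun x => x)) => //.
by split=> [x /emptyE|y /emptyE|x y /emptyE].
Qed.

Lemma finite_add A x : finite A -> finite (cup A (sing x)).
Proof.
move=> fA; have [xA|xA] := classic (x ∈ A).
  have -> // : cup A (sing x) = A.
  by apply: ext => y; rewrite cupE singE; split=> [[|->]|]; tauto.
move: fA => /finiteP [n [nw /equipotent_elim [f [H1 H2 H3]]]].
apply/finiteP; exists (succ n); split; first exact: succ_omega.
pose (t := fun y => cond (y = x) n (app f y)).
have tx : t x = n by rewrite /t cond_true.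
have tA y : y ∈ A -> t y = app f y.
  by move=> yA; rewrite /t cond_false // => E; apply: xA; rewrite -E.
apply: (equipotent_intro t); first by rewrite /t; def.
split=> [y|y|y z].
- rewrite cupE singE succE => -[yA|->]; last by rewrite tx; right.
  by rewrite tA //; left; apply: H1.
- rewrite succE => -[/H2 [z [zA <-]]|->].
    by exists z; rewrite tA // cupE; split=> //; left.
  by exists x; rewrite tx cupE singE; split=> //; right.
rewrite !cupE !singE => -[yA|->] [zA|->] //.
- by rewrite !tA //; apply: H3.
- by rewrite tx tA // => E; have := H1 _ yA; rewrite E => /lt_irrefl.
- by rewrite tx tA // => E; have := H1 _ zA; rewrite -E => /lt_irrefl.
Qed.

(** Induction on the size: the point that a bijection onto [succ n] sends to n is removed. *)
Lemma finite_ind (P : M -> Prop) : definable P -> P empty ->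
  (forall A x, finite A -> ~ x ∈ A -> P A -> P (cup A (sing x))) ->
  forall A, finite A -> P A.
Proof.
move=> HP P0 PS A /finiteP [n [nw]]; move: n nw A.
apply: omega_ind => [|A /equipotent_elim [f [H1 _ _]]|n nw IH A /equipotent_elim [f [H1 H2 H3]]].
- by def.
- have -> // : A = empty.
  by apply/is_emptyP => x /H1 /emptyE.
have [|x [xA xn]] := H2 n; first by rewrite succE; right.
have eqA : equipotent (diff A (sing x)) n.
  apply: (equipotent_intro (app f)) => //; split=> [y|y yn|y z].
  - rewrite diffE singE => -[yA yx]; have := H1 _ yA; rewrite succE => -[//|E].
    by case: yx; apply: H3 => //; rewrite E xn.
  - have [|z [zA zy]] := H2 y; first by rewrite succE; left.
    exists z; rewrite diffE singE; split=> //; split=> // E.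
    by move: yn; rewrite -zy E xn => /lt_irrefl.
  by rewrite !diffE => -[yA _] [zA _]; apply: H3.
have -> : A = cup (diff A (sing x)) (sing x).
  apply: ext => y; rewrite cupE diffE singE.
  by have [->|] := classic (y = x); tauto.
apply: PS; last exact: IH.
  by apply/finiteP; exists n.
by rewrite diffE singE => -[_]; apply.
Qed.

Lemma finite_sub A B : finite A -> subset B A -> finite B.
Proof.
move=> fA; move: A fA B; apply: finite_ind => [|B sub|A x _ xA IH B sub].
- by def.
- have -> : B = empty by apply/is_emptyP => x /sub /emptyE.
  exact: finite_empty.
have fB : finite (diff B (sing x)).
  by apply: IH => y; rewrite diffE singE => -[/sub]; rewrite cupE singE; tauto.
have [xB|xB] := classic (x ∈ B).
  have -> : B = cup (diff B (sing x)) (sing x).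
    apply: ext => y; rewrite cupE diffE singE.
    by have [->|] := classic (y = x); tauto.
  exact: finite_add.
have -> // : B = diff B (sing x).
by apply: ext => y; rewrite diffE singE; split=> [yB|[]//]; split=> // E; apply: xB; rewrite -E.
Qed.

Lemma finite_cup A B : finite A -> finite B -> finite (cup A B).
Proof.
move=> fA; move: B; apply: finite_ind => [||B x _ _ IH]; first by def.
  have -> // : cup A empty = A.
  by apply: ext => y; rewrite cupE; split=> [[//|/emptyE//]|]; left.
have -> : cup A (cup B (sing x)) = cup (cup A B) (sing x) by apply: ext => y; rewrite !cupE; tauto.
exact: finite_add.
Qed.

Lemma finite_sing x : finite (sing x).
Proof.
have := finite_add empty x finite_empty.
by move/finite_sub; apply=> y; rewrite cupE; right.
Qed.

Lemma finite_image A (t : M -> M) : definable_map t -> finite A -> finite (image A t).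
Proof.
move=> Ht; move: A; apply: finite_ind => [||A x _ _ IH]; first by def.
  have -> : image empty t = empty; last exact: finite_empty.
  by apply/is_emptyP => y; rewrite imageE // => -[x [/emptyE]].
have -> : image (cup A (sing x)) t = cup (image A t) (sing (t x)); last exact: finite_add.
apply: ext => y; rewrite cupE !imageE // singE; split=> [[z []]|[[z [zA ->]]|->]].
- by rewrite cupE singE => -[zA ->|-> ->]; [left; exists z|right].
- by exists z; rewrite cupE; split=> //; left.
by exists x; rewrite cupE singE; split=> //; right.
Qed.

Lemma finite_union_closed (Q : M -> Prop) I (t : M -> M) : definable Q -> definable_map t ->
  Q empty -> (forall A B, Q A -> Q B -> Q (cup A B)) ->
  finite I -> (forall i, i ∈ I -> Q (t i)) -> Q (big_union I t).
Proof.
move=> HQ Ht Q0 QU; move: I; apply: finite_ind => [|_|I x _ _ IH H]; first by def.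
  have -> // : big_union empty t = empty.
  by apply/is_emptyP => y; rewrite big_unionE // => -[i [/emptyE]].
have -> : big_union (cup I (sing x)) t = cup (big_union I t) (t x).
  apply: ext => y; rewrite cupE !big_unionE //; split=> [[i []]|[[i [iI yi]]|yx]].
  - by rewrite cupE singE => -[iI yi|-> yi]; [left; exists i|right].
  - by exists i; rewrite cupE; split=> //; left.
  by exists x; rewrite cupE singE; split=> //; right.
by apply: QU; [apply: IH => i iI|]; apply: H; rewrite cupE ?singE; [left|right].
Qed.

Lemma finite_big_union I (t : M -> M) : definable_map t ->
  finite I -> (forall i, i ∈ I -> finite (t i)) -> finite (big_union I t).
Proof.
move=> Ht; apply: (finite_union_closed finite) => //; first exact: finite_empty.
exact: finite_cup.
Qed.

Lemma finite_cart A B : finite A -> finite B -> finite (cart A B).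
Proof.
move=> fA fB; apply: (finite_sub (big_union A (fun x => image B (fun y => opair x y)))).
  by apply: finite_big_union => // x _; apply: finite_image.
move=> p /cartE [x [y [xA [yB ->]]]]; rewrite big_unionE //.
by exists x; rewrite imageE //; split=> //; exists y.
Qed.

Lemma finite_inj A B (t : M -> M) : definable_map t -> finite B ->
  (forall x, x ∈ A -> t x ∈ B) ->
  (forall x y, x ∈ A -> y ∈ A -> t x = t y -> x = y) -> finite A.
Proof.
move=> Ht fB AB inj.
(* The inverse of t as a term: a fibre over a value of t is a singleton, and its union is the point
   itself. Other values of s do no harm, as only a superset of A is wanted. *)
pose (s := fun b => big_union (sep A (fun a => t a = b)) (fun a => a)).
have Hs : definable_map s by rewrite /s; def.
apply: (finite_sub (image B s)); first exact: finite_image.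
move=> x xA; rewrite imageE //; exists (t x); split; first exact: AB.
apply: ext => z; rewrite /s big_unionE //; split=> [zx|[a [+ za]]].
  by exists x; rewrite sepE //; def.
by rewrite sepE; [move=> [aA E]; rewrite -(inj a x)|def].
Qed.

(** Induction on A: monotonicity lets two bounds be replaced by their maximum, so no function
    selecting bounds is involved. *)
Lemma finite_bound A (R : M -> M -> Prop) : definable2 R ->
  (forall a n k, k ∈ omega -> n ∈ succ k -> R a n -> R a k) -> finite A ->
  (forall a, a ∈ A -> exists n, n ∈ omega /\ R a n) ->
  exists n, n ∈ omega /\ forall a, a ∈ A -> R a n.
Proof.
move=> HR mono; move: A; apply: finite_ind => [|_|A x _ _ IH H].
- by def.
- by exists empty; split=> // a /emptyE.
have [|n [nw Hn]] := IH; first by move=> a aA; apply: H; rewrite cupE; left.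
have [|k [kw Hk]] := H x; first by rewrite cupE singE; right.
have [m [mw [nm km]]] := omega_max n k nw kw.
exists m; split=> // a; rewrite cupE singE => -[/Hn|->]; first exact: mono.
exact: mono Hk.
Qed.

Lemma omega_infinite : infinite omega.
Proof.
move=> fw; have [|||n [nw Hn]] := finite_bound omega (fun a n => a ∈ succ n) _ _ fw.
- by def.
- by move=> a n k kw nk an; apply: (le_trans _ n).
- by move=> a aw; exists a; rewrite succE; split=> //; right.
exact: (lt_irrefl (succ n)) (Hn _ (succ_omega _ nw)).
Qed.

End Finite.
#[global] Hint Resolve Tm_cond Tm_big_union : def.

(** * Countable sets and countable unions of finite sets *)

Section Countable.
Context {M : structure} {HM : models_ZF M}.
Implicit Types (x y z n k m A B F I J : M).

Lemma omega_least (P : M -> Prop) n : definable P -> n ∈ omega -> P n ->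
  exists m, m ∈ omega /\ P m /\ forall k, k ∈ m -> ~ P k.
Proof.
move=> HP nw Pn; apply: NNPP => H.
have : forall k, k ∈ omega -> forall m, m ∈ k -> ~ P m.
  apply: omega_ind => [|m /emptyE //|k kw IH m]; first by def.
  rewrite succE => -[/IH //|-> Pk]; by apply: H; exists k.
move/(_ _ (succ_omega _ nw) n); apply=> //.
by rewrite succE; right.
Qed.

Lemma countableP A : countable A <-> exists f, (forall x, x ∈ A -> app f x ∈ omega) /\
  (forall x y, x ∈ A -> y ∈ A -> app f x = app f y -> x = y).
Proof.
split=> [[w [s [/is_omegaP -> [sw /equipotent_elim [f [H1 _ H3]]]]]]|[f [H1 H2]]].
  by exists f; split=> // x xA; apply/sw/H1.
exists omega, (image A (app f)); split; first exact: omegaP.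
have Hf : definable_map (app f) by [].
split=> [y|]; first by rewrite imageE // => -[x [xA ->]]; apply: H1.
apply: (equipotent_intro (app f)) => //; split=> // [x xA|y]; rewrite imageE //.
  by exists x.
by move=> [x [xA ->]]; exists x.
Qed.

(** The least number related to x is a canonical code, so the relation yields an injection without
    choice. *)
Lemma countable_rel A (R : M -> M -> Prop) : definable2 R ->
  (forall x, x ∈ A -> exists n, n ∈ omega /\ R x n) ->
  (forall x y n, x ∈ A -> y ∈ A -> n ∈ omega -> R x n -> R y n -> x = y) -> countable A.
Proof.
move=> HR ex inj.
(* The separated set is the singleton of the least n with [R x n], and its union is that n. *)
pose (t := fun x => union (sep omega (fun n => R x n /\ forall k, k ∈ n -> ~ R x k))).
have Ht : definable_map t by rewrite /t; def.
have tP x : x ∈ A -> t x ∈ omega /\ R x (t x).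
  move=> xA; have [n [nw Rn]] := ex x xA.
  have [|m [mw [Rm Hm]]] := omega_least (R x) n _ nw Rn; first by def.
  have -> // : t x = m.
  apply: ext => z; rewrite /t unionE; split=> [[k [+ zk]]|zm].
    rewrite sepE; last by def.
    move=> [kw [Rk Hk]]; have [km|] := lt_or_le _ _ kw mw; first by case: (Hm _ km).
    by rewrite succE => -[/Hk|->].
  by exists m; rewrite sepE //; def.
apply/countableP; exists (lam A t); split=> [x xA|x y xA yA].
  by rewrite app_lam //; case: (tP _ xA).
rewrite !app_lam // => E; have [tw Rx] := tP _ xA; have [_ Ry] := tP _ yA.
by apply: (inj x y (t x)) => //; rewrite E.
Qed.

Lemma countable_inj A (t : M -> M) : definable_map t -> (forall x, x ∈ A -> t x ∈ omega) ->
  (forall x y, x ∈ A -> y ∈ A -> t x = t y -> x = y) -> countable A.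
Proof.
move=> Ht H1 H2; apply: (countable_rel A (fun x n => n = t x)); first by def.
  by move=> x xA; exists (t x); split=> //; apply: H1.
by move=> x y n xA yA _ -> E; apply: H2.
Qed.

Lemma countable_omega : countable omega.
Proof. exact: (countable_inj omega (fun x => x)). Qed.

Lemma countable_image A (t : M -> M) : definable_map t -> countable A -> countable (image A t).
Proof.
move=> Ht /countableP [f [H1 H2]].
apply: (countable_rel _ (fun y n => exists x, x ∈ A /\ y = t x /\ n = app f x)).
- by def.
- move=> y; rewrite imageE // => -[x [xA ->]]; exists (app f x); split; first exact: H1.
  by exists x.
move=> y y' n _ _ _ [x [xA [-> ->]]] [x' [xA' [-> E]]].
by rewrite (H2 x x').
Qed.

Lemma finite_countable A : finite A -> countable A.
Proof.
move=> /finiteP [n [nw /equipotent_elim [f [H1 _ H3]]]]; apply/countableP; exists f.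
by split=> // x xA; apply: (elem_omega n) => //; apply: H1.
Qed.

(** The code [Npair] on bare elements of M, where it is a definable term. *)
Definition pair_code n k := add (mul (add n k) (add n k)) k.

Lemma pair_code_omega n k : n ∈ omega -> k ∈ omega -> pair_code n k ∈ omega.
Proof.
by move=> nw kw; apply: add_omega => //; apply: mul_omega; apply: add_omega.
Qed.

Lemma pair_code_inj n k n' k' : n ∈ omega -> k ∈ omega -> n' ∈ omega -> k' ∈ omega ->
  pair_code n k = pair_code n' k' -> n = n' /\ k = k'.
Proof.
move=> nw kw nw' kw' E.
have [|E1 E2] := Npair_inj (mkN n nw) (mkN k kw) (mkN n' nw') (mkN k' kw').
  exact: nat_val_inj.
by move: (f_equal nat_val E1) (f_equal nat_val E2).
Qed.

Lemma Tm_pair_code a b : Tm a -> Tm b -> Tm (fun e => pair_code (a e) (b e)).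
Proof. by rewrite /pair_code; def. Qed.
#[local] Hint Resolve Tm_pair_code : def.

Lemma countable_cup A B : countable A -> countable B -> countable (cup A B).
Proof.
move=> /countableP [f [f1 f2]] /countableP [g [g1 g2]].
apply: (countable_rel _ (fun x n => (x ∈ A /\ n = pair_code empty (app f x)) \/
   (x ∈ B /\ n = pair_code one (app g x)))).
- by def.
- move=> x; rewrite cupE => -[H|H].
    exists (pair_code empty (app f x)); split; last by left.
    by apply: pair_code_omega => //; apply: f1.
  exists (pair_code one (app g x)); split; last by right.
  by apply: pair_code_omega => //; apply: g1.
move=> x y n _ _ _ [[xA ->]|[xA ->]] [[yA E]|[yA E]];
  (have [||||E1 E2] := pair_code_inj _ _ _ _ _ _ _ _ E;
    [by []|by auto|by []|by auto|..]).
- exact: f2.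
- by move: (one_neq0 (esym E1)).
- by move: (one_neq0 E1).
- exact: g2.
Qed.

End Countable.

(** * Exhaustions and closure properties of cuf sets *)

Section Cuf.
Context {M : structure} {HM : models_ZF M}.
Implicit Types (x y z n k m A B F I J G : M).

Lemma cuf_rel A (R : M -> M -> Prop) : definable2 R ->
  (forall x, x ∈ A -> exists n, n ∈ omega /\ R n x) ->
  (forall n, n ∈ omega -> finite (sep A (R n))) -> cuf A.
Proof.
move=> HR ex fin.
have Ht : definable_map (fun n => sep A (R n)) by def.
have HRn n : definable (R n) by def.
exists omega, (lam omega (fun n => sep A (R n))); split; first exact: countable_omega.
split; first exact: lam_family.
split=> [n B|x]; first by rewrite maps_lam // => -[nw ->]; apply: fin.
split=> [xA|[n [B [+ xB]]]].
  have [n [nw Rn]] := ex x xA; exists n, (sep A (R n)).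
  by rewrite maps_lam // sepE.
by rewrite maps_lam // => -[nw E]; move: xB; rewrite E sepE //; case.
Qed.

(** The sequence of stages is coded by one set G of pairs (n, x), x being in stage n; a single
    element of M can serve as a parameter of formulas. *)
Definition is_exhaustion G A :=
  [/\ forall n x, opair n x ∈ G -> n ∈ omega /\ x ∈ A,
      forall x, x ∈ A -> exists n, n ∈ omega /\ opair n x ∈ G,
      forall n k x, k ∈ omega -> n ∈ succ k -> opair n x ∈ G -> opair k x ∈ G &
      forall n, n ∈ omega -> finite (sep A (fun x => opair n x ∈ G))].

(** Stage n is the union of the finite sets whose index has code at most n; there are finitely many
    such indices because the coding is injective. *)
Lemma cuf_exhaustion A : cuf A -> exists G, is_exhaustion G A.
Proof.
move=> [J [F [/countableP [f [f1 f2]] [HF [fin HU]]]]].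
pose (P := fun p => exists n x j, p = opair n x /\ j ∈ J /\ app f j ∈ succ n /\ x ∈ app F j).
have HP : definable P by rewrite /P; def.
have FP j : j ∈ J -> maps F j (app F j) by rewrite (family_maps _ _ _ _ HF).
have GE n x : opair n x ∈ sep (cart omega A) P <->
    n ∈ omega /\ exists j, j ∈ J /\ app f j ∈ succ n /\ x ∈ app F j.
  rewrite sepE // opair_cart; split=> [[[nw xA] [n' [x' [j]]]]|[nw [j [jJ [jn xj]]]]].
    by move=> [/opair_inj [<- <-] H]; split=> //; exists j.
  split; last by exists n, x, j.
  by split=> //; apply/HU; exists j, (app F j); split=> //; apply: FP.
exists (sep (cart omega A) P); split.
- by move=> n x; rewrite sepE // opair_cart; case.
- move=> x /HU [j [B []]]; rewrite (family_maps _ _ _ _ HF) => -[jJ ->] xj.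
  exists (app f j); split; first exact: f1.
  by rewrite GE; split; [exact: f1|exists j; split=> //; rewrite succE; split=> //; right].
- move=> n k x kw nk; rewrite !GE => -[nw [j [jJ [jn xj]]]]; split=> //; exists j; split=> //.
  split=> //; move: nk; rewrite succE => -[nk|<- //].
  by rewrite succE; left; apply: (lt_succ_trans _ n).
move=> n nw; set I := sep J (fun j => app f j ∈ succ n).
have fI : finite I.
  apply: (finite_inj I (succ n) (app f)) => //.
  - apply/finiteP; exists (succ n); split; first exact: succ_omega.
    by apply: (equipotent_intro (fun x => x)) => //; split=> // y yn; exists y.
  - by move=> j; rewrite /I sepE //; case.
  by move=> i j; rewrite /I !sepE // => -[iJ _] [jJ _]; apply: f2.
apply: (finite_sub (big_union I (app F))).
  apply: finite_big_union => // j; rewrite /I sepE // => -[jJ _].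
  exact: fin (FP _ jJ).
move=> x; rewrite sepE // GE => -[_ [_ [j [jJ [jn xj]]]]].
by rewrite big_unionE //; exists j; rewrite /I sepE.
Qed.

(** The points related to stage n of B form a finite union of finite sections. As R is a relation,
    no b has to be chosen for a given x. *)
Lemma cuf_finite_sections A B (R : M -> M -> Prop) : definable2 R -> cuf B ->
  (forall x, x ∈ A -> exists b, b ∈ B /\ R b x) ->
  (forall b, b ∈ B -> finite (sep A (R b))) -> cuf A.
Proof.
move=> HR /cuf_exhaustion [G [G1 G2 G3 G4]] ex fin.
apply: (cuf_rel A (fun n x => exists b, opair n b ∈ G /\ R b x)); first by def.
  move=> x /ex [b [bB Rb]]; have [n [nw Gn]] := G2 _ bB.
  by exists n; split=> //; exists b.
move=> n nw; have HRb b : definable (R b) by def.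
apply: (finite_sub (big_union (sep B (fun b => opair n b ∈ G)) (fun b => sep A (R b)))).
  apply: finite_big_union; [by def|exact: G4|].
  by move=> b; rewrite sepE // => -[bB _]; apply: fin.
move=> x; rewrite sepE; last by def.
move=> [xA [b [nb Rb]]]; rewrite big_unionE; last by def.
exists b; rewrite !sepE //; split=> //.
by have [_ bB] := G1 _ _ nb.
Qed.

Lemma cuf_sub A B : cuf A -> subset B A -> cuf B.
Proof.
move=> cA sub; apply: (cuf_finite_sections B A (fun a b => a = b)) => //.
  by move=> x /sub xA; exists x.
move=> b _; apply: (finite_sub (sing b)); first exact: finite_sing.
by move=> x; rewrite sepE // singE => -[_ ->].
Qed.

Lemma countable_cuf A : countable A -> cuf A.
Proof.
move=> /countableP [f [f1 f2]]; apply: (cuf_rel A (fun n x => n = app f x)); first by def.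
  by move=> x xA; exists (app f x); split=> //; apply: f1.
move=> n nw; have [[x xS]|N] := classic (nonempty (sep A (fun x => n = app f x))).
  apply: (finite_sub (sing x)); first exact: finite_sing.
  move=> y; move: xS; rewrite !sepE // singE => -[xA ->] [yA E].
  by apply: f2.
apply: (finite_sub empty); first exact: finite_empty.
by move=> x xS; case: N; exists x.
Qed.

Lemma finite_cuf A : finite A -> cuf A.
Proof. by move/finite_countable/countable_cuf. Qed.

Lemma cuf_empty : cuf empty.
Proof. exact/finite_cuf/finite_empty. Qed.

Lemma countable_empty : countable empty.
Proof. exact/finite_countable/finite_empty. Qed.

Lemma cuf_cup A B : cuf A -> cuf B -> cuf (cup A B).
Proof.
move=> /cuf_exhaustion [G [G1 G2 G3 G4]] /cuf_exhaustion [H [H1 H2 H3 H4]].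
apply: (cuf_rel _ (fun n x => opair n x ∈ G \/ opair n x ∈ H)); first by def.
  by move=> x; rewrite cupE => -[/G2|/H2] [n [nw Hn]]; exists n; split=> //; [left|right].
move=> n nw; apply: (finite_sub (cup (sep A (fun x => opair n x ∈ G)) (sep B (fun x => opair n x ∈ H)))).
  by apply: finite_cup; [exact: G4|exact: H4].
move=> x; rewrite cupE !sepE // => -[_ [Hx|Hx]]; [left|right]; split=> //.
  by have [] := G1 _ _ Hx.
by have [] := H1 _ _ Hx.
Qed.

Lemma cuf_cart A B : cuf A -> cuf B -> cuf (cart A B).
Proof.
move=> /cuf_exhaustion [G [G1 G2 G3 G4]] /cuf_exhaustion [H [H1 H2 H3 H4]].
apply: (cuf_rel _ (fun n p => exists x y, p = opair x y /\ opair n x ∈ G /\ opair n y ∈ H)).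
- by def.
- move=> p /cartE [x [y [/G2 [n [nw Gn]] [/H2 [k [kw Hk]] ->]]]].
  have [m [mw [nm km]]] := omega_max n k nw kw.
  by exists m; split=> //; exists x, y; split=> //; split; [apply: G3 Gn|apply: H3 Hk].
move=> n nw; apply: (finite_sub (cart (sep A (fun x => opair n x ∈ G)) (sep B (fun x => opair n x ∈ H)))).
  by apply: finite_cart; [exact: G4|exact: H4].
move=> p; rewrite sepE; last by def.
move=> [_ [x [y [-> [Gx Hy]]]]]; rewrite opair_cart !sepE //.
have [_ xA] := G1 _ _ Gx; have [_ yB] := H1 _ _ Hy.
by split.
Qed.

Lemma every_union_mono (I I' Q R : M -> Prop) : (forall J, I' J -> I J) ->
  every_union I Q R -> every_union I' Q R.
Proof. by move=> H HU J F U /H; apply: HU. Qed.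

(** Indices are grouped by the stages of an exhaustion of J; each group is finite, so its union
    [t n] still satisfies Q. *)
Lemma every_union_cuf (Q : M -> Prop) : definable Q -> Q empty ->
  (forall A B, Q A -> Q B -> Q (cup A B)) ->
  every_union countable Q cuf -> every_union cuf Q cuf.
Proof.
move=> HQ Q0 QU HU J F U /cuf_exhaustion [G [G1 G2 G3 G4]] HF FQ FU.
pose (t := fun n => big_union (sep J (fun j => opair n j ∈ G)) (app F)).
have Ht : definable_map t by rewrite /t; def.
apply: (HU omega (lam omega t)); first exact: countable_omega.
- exact: lam_family.
- move=> n A; rewrite maps_lam // => -[nw ->].
  apply: finite_union_closed => //; first exact: G4.
  move=> j; rewrite sepE // => -[jJ _]; apply: (FQ j).
  by rewrite (family_maps _ _ _ _ HF).
move=> x; rewrite (FU x); split=> [[j [A []]]|[n [A []]]].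
  rewrite (family_maps _ _ _ _ HF) => -[jJ ->] xj; have [n [nw Gn]] := G2 _ jJ.
  exists n, (t n); rewrite maps_lam //; split=> //.
  by rewrite /t big_unionE //; exists j; rewrite sepE.
rewrite maps_lam // => -[nw ->]; rewrite /t big_unionE // => -[j []].
rewrite sepE // => -[jJ _] xj; exists j, (app F j).
by rewrite (family_maps _ _ _ _ HF).
Qed.

End Cuf.
#[global] Hint Resolve Tm_pair_code : def.

(** * Quasi-metrics *)

Section RealHints.
Context {M : structure}.
Implicit Types a b c : (nat -> M) -> M.

Lemma Def_nat_mul a b c : Tm a -> Tm b -> Tm c -> Def (fun e => nat_mul (a e) (b e) (c e)).
Proof. by apply: Def_pred3; rewrite /nat_mul /nat_add /iterate; def. Qed.

Lemma Def_nat_add a b c : Tm a -> Tm b -> Tm c -> Def (fun e => nat_add (a e) (b e) (c e)).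
Proof. by apply: Def_pred3; rewrite /nat_add /iterate; def. Qed.

Lemma Def_is_fraction a b c : Tm a -> Tm b -> Tm c ->
  Def (fun e => is_fraction (a e) (b e) (c e)).
Proof. by apply: Def_pred3; rewrite /is_fraction; def. Qed.
#[local] Hint Resolve Def_nat_mul Def_nat_add Def_is_fraction : def.

Lemma Def_frac_le a b : Tm a -> Tm b -> Def (fun e => frac_le (a e) (b e)).
Proof. by apply: Def_pred2; rewrite /frac_le; def. Qed.

Lemma Def_frac_lt a b : Tm a -> Tm b -> Def (fun e => frac_lt (a e) (b e)).
Proof. by apply: Def_pred2; rewrite /frac_lt; def. Qed.

Lemma Def_is_frac_add a b c : Tm a -> Tm b -> Tm c ->
  Def (fun e => is_frac_add (a e) (b e) (c e)).
Proof. by apply: Def_pred3; rewrite /is_frac_add; def. Qed.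
#[local] Hint Resolve Def_frac_le Def_frac_lt Def_is_frac_add : def.

Lemma Def_is_nnreal a : Tm a -> Def (fun e => is_nnreal (a e)).
Proof. by apply: Def_pred1; rewrite /is_nnreal; def. Qed.

Lemma Def_real_lt a b : Tm a -> Tm b -> Def (fun e => real_lt (a e) (b e)).
Proof. by apply: Def_pred2; rewrite /real_lt; def. Qed.

End RealHints.
#[global] Hint Resolve Def_frac_le Def_frac_lt Def_is_frac_add Def_is_nnreal Def_real_lt : def.

Section QuasiMetric.
Context {M : structure} {HM : models_ZF M}.
Implicit Types (x y z n k m r s t A B X T V d : M).

Definition nnreals := sep (power fractions) is_nnreal.

Lemma nnrealsP : is_nnreals nnreals.
Proof.
move=> r; rewrite /nnreals sepE; last by def.
split=> [[] //|Hr]; split=> //; rewrite powerE => z zr.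
have [p [q [pw [qw [_ ->]]]]] := nnreal_frac _ _ Hr zr.
by rewrite /fractions opair_cart.
Qed.

Lemma is_nnrealsP R : is_nnreals R <-> R = nnreals.
Proof.
split=> [H|->]; last exact: nnrealsP.
by apply: ext => r; rewrite (H r) (nnrealsP r).
Qed.

Lemma distE d x y r : dist d x y r <-> maps d (opair x y) r.
Proof.
by split=> [[p [/is_opairP -> //]]|H]; exists (opair x y); rewrite is_opairP.
Qed.

Lemma half_zero n : n ∈ omega -> opair empty one ∈ half n.
Proof.
move=> nw; rewrite halfE mul0n; last exact: pow2_omega.
by split=> //; split=> //; rewrite /one sealedE succE; right.
Qed.

(** The triangle inequality quantifies over sums that exist as sets, so a sum has to be produced
    before it can be applied. *)
Lemma real_sum_ex r s : is_nnreal r -> is_nnreal s -> exists t, is_real_add t r s.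
Proof.
move=> Hr Hs; exists (sep fractions (fun z => z ∈ r \/ z ∈ s \/
    exists x y u, x ∈ r /\ y ∈ s /\ is_frac_add u x y /\ frac_le z u)) => z.
rewrite sepE; last by rewrite -/(fractions); def.
split=> [[] //|H]; split=> //.
case: H => [zr|[zs|[x [y [u [_ [_ [_]]]]]]]].
- have [p [q [pw [qw [_ ->]]]]] := nnreal_frac _ _ Hr zr.
  by rewrite /fractions opair_cart.
- have [p [q [pw [qw [_ ->]]]]] := nnreal_frac _ _ Hs zs.
  by rewrite /fractions opair_cart.
move=> [p [q [_ [_ [_ [_ [/is_fractionP [pw [qw [_ ->]]] _]]]]]]].
by rewrite /fractions opair_cart.
Qed.

(** A decreasing sequence of preorders on X whose intersection is the diagonal, i.e. a countable
    base of a separated transitive quasi-uniformity. *)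
Definition entourages (C : M -> M -> M -> Prop) X : Prop :=
  [/\ definable3 C,
      forall n x, n ∈ omega -> x ∈ X -> C n x x,
      forall n x y z, n ∈ omega -> x ∈ X -> y ∈ X -> z ∈ X -> C n x y -> C n y z -> C n x z,
      forall n k x y, k ∈ omega -> n ∈ succ k -> x ∈ X -> y ∈ X -> C k x y -> C n x y &
      forall x y, x ∈ X -> y ∈ X -> (forall n, n ∈ omega -> C n x y) -> x = y].

Definition induces (C : M -> M -> M -> Prop) X T : Prop :=
  forall V, V ∈ T <-> subset V X /\ forall x, x ∈ V ->
    exists n, n ∈ omega /\ forall y, y ∈ X -> C n x y -> y ∈ V.

(* With [d x y := sup {1 / 2 ^ n | ~ C n x y}] the triangle inequality holds
   even with a maximum instead of a sum. *)
Lemma entourages_quasi_metric (C : M -> M -> M -> Prop) X T :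
  entourages C X -> induces C X T ->
  exists d, is_quasi_metric d X /\ is_induced_topology T d X /\
    ((forall n x y, x ∈ X -> y ∈ X -> C n x y -> C n y x) -> is_metric d X).
Proof.
move=> [HC refl trans mono sep0] HT.
pose (P := fun p n => exists x y, p = opair x y /\ ~ C n x y).
have PE x y n : P (opair x y) n <-> ~ C n x y.
  split=> [[x' [y' [/opair_inj [-> ->]]]] //|H]; by exists x, y.
have HP p : definable (P p) by rewrite /P; def.
pose (d := lam (cart X X) (fun p => union_half (P p))).
have Hd : definable_map (fun p => union_half (P p)) by rewrite /union_half /fractions /P; def.
have dE x y r : dist d x y r <-> x ∈ X /\ y ∈ X /\ r = union_half (P (opair x y)).
  by rewrite distE /d maps_lam // opair_cart; tauto.
have ltE n x y : n ∈ omega -> x ∈ X -> y ∈ X ->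
    real_lt (union_half (P (opair x y))) (half n) <-> C n x y.
  move=> nw xX yX; rewrite union_half_lt //; split=> [H|H k kw].
    by apply: NNPP => /PE /(H _ nw) /lt_irrefl.
  rewrite PE => nC; have [//|kn] := lt_or_le n k nw kw.
  by case: nC; apply: mono H.
have dsub x y x' y' : (forall n, ~ C n x y -> ~ C n x' y') ->
    subset (union_half (P (opair x y))) (union_half (P (opair x' y'))).
  move=> H z; rewrite !union_halfE // => -[n [nw [/PE nC zn]]].
  by exists n; rewrite PE; split=> //; split=> //; apply: H.
have qm : is_quasi_metric d X.
  split.
    exists (cart X X), nnreals; split; first exact/is_cartesianP.
    split; first exact: nnrealsP.
    apply/is_functionP; split; first exact: lam_family.
    by move=> p pX; rewrite app_lam //; apply/nnrealsP; apply: union_half_nnreal.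
  split=> [x r|].
    rewrite dE => -[xX [_ ->]] z; rewrite union_halfE // => -[n [nw [/PE nC _]]].
    by apply: nC; apply: refl.
  split=> [x y z r s t u|x y r].
    rewrite !dE => -[xX [yX ->]] [_ [zX ->]] [_ [_ ->]] Hu w.
    rewrite union_halfE // => -[n [nw [/PE nC wn]]]; apply/Hu.
    (* By transitivity [C n x z] and [C n z y] cannot both hold, so the cut of 1/2^n is contained in
       one of the two summands. *)
    have [xz|xz] := classic (C n x z); last first.
      by left; rewrite union_halfE //; exists n; rewrite PE.
    right; left; rewrite union_halfE //; exists n; rewrite PE.
    by split=> //; split=> // zy; apply: nC; apply: (trans n x z y).
  rewrite dE => -[xX [yX ->]] emp; apply: sep0 => // n nw; apply: NNPP => nC.
  (* The fraction 0/1 lies in every cut [half n], so an empty distance excludes every n with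
     [~ C n x y]. *)
  by apply: (emp (opair empty one)); rewrite union_halfE //; exists n; rewrite PE; split=> //; split=> //; exact: half_zero.
exists d; split=> //; split.
  move=> V; rewrite (HT V); split=> -[sub H]; split=> // x xV.
    have [n [nw Hn]] := H _ xV; exists n, (half n); split; first exact/is_half_powP.
    by move=> y r; rewrite dE => -[xX [yX ->]]; rewrite ltE //; apply: Hn.
  have [n [e [/is_half_powP [nw ->] Hn]]] := H _ xV; exists n; split=> // y yX Cxy.
  by apply: (Hn _ (union_half (P (opair x y)))); rewrite ?dE ?ltE //; have := sub _ xV.
move=> sym; split=> // x y r; rewrite !dE => -[xX [yX ->]]; split=> //; split=> //.
by apply: ext => z; split; apply: dsub => n nC /sym H; apply: nC; apply: H.
Qed.

(** * Countable local bases and pseudobases from a quasi-metric *)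

Section Consequences.
Context (d X T : M).
Hypotheses (Hd : is_quasi_metric d X) (HT : is_induced_topology T d X).

Definition near n x y := real_lt (app d (opair x y)) (half n).

Lemma qm_dist x y r : dist d x y r <-> x ∈ X /\ y ∈ X /\ r = app d (opair x y).
Proof.
have [[XX [R [/is_cartesianP -> [_ /is_functionP [Hf _]]]]] _] := Hd.
by rewrite distE (family_maps _ _ _ _ Hf) opair_cart; tauto.
Qed.

Lemma qm_nnreal x y : x ∈ X -> y ∈ X -> is_nnreal (app d (opair x y)).
Proof.
have [[XX [R [/is_cartesianP -> [/is_nnrealsP -> /is_functionP [_ Hf]]]]] _] := Hd.
by move=> xX yX; apply/nnrealsP; apply: Hf; rewrite opair_cart.
Qed.

Lemma real_lt_sub_half r n : n ∈ omega -> subset r (half (succ n)) -> real_lt r (half n).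
Proof.
move=> nw sub; have sw := succ_omega _ nw; split=> [z /sub|E].
  by apply: half_mono => //; rewrite succE; left; rewrite succE; right.
by apply: (half_strict n (succ n)) => //; [rewrite succE; right|rewrite -E].
Qed.

Lemma near_refl n x : n ∈ omega -> x ∈ X -> near n x x.
Proof.
move=> nw xX; have [_ [H _]] := Hd; apply: real_lt_sub_half => // z.
have /(_ x (app d (opair x x))) := H; rewrite qm_dist => /(_ (conj xX (conj xX erefl))) E.
by move/E.
Qed.

(** One index pays for the sum, as 2 / 2^(n+2) = 1/2^(n+1), and one for the strict inequality in
    [near]. *)
Lemma near_trans n x y z : n ∈ omega -> x ∈ X -> y ∈ X -> z ∈ X ->
  near (succ (succ n)) x y -> near (succ (succ n)) y z -> near n x z.
Proof.
move=> nw xX yX zX [xy _] [yz _]; have [_ [_ [H _]]] := Hd.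
have [t Ht] := real_sum_ex _ _ (qm_nnreal _ _ xX yX) (qm_nnreal _ _ yX zX).
apply: real_lt_sub_half => // w wr.
apply: (real_sum_half _ _ _ _ (succ_omega _ nw) xy yz Ht).
by apply: (H x z y _ _ _ t _ _ _ Ht) wr; rewrite qm_dist.
Qed.

Lemma near_separated x y : x ∈ X -> y ∈ X -> (forall n, n ∈ omega -> near n x y) -> x = y.
Proof.
move=> xX yX H; have [_ [_ [_ Hs]]] := Hd; apply: (Hs x y (app d (opair x y))).
  by rewrite qm_dist.
apply/is_emptyP; apply: real_lt_all_half; first exact: qm_nnreal.
by move=> n /H [].
Qed.

Lemma qm_open V : V ∈ T <-> subset V X /\ forall x, x ∈ V ->
    exists n, n ∈ omega /\ forall y, y ∈ X -> near n x y -> y ∈ V.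
Proof.
rewrite (HT V); split=> -[sub H]; split=> // x xV.
  have [n [e [/is_half_powP [nw ->] Hn]]] := H _ xV; exists n; split=> // y yX lt.
  by apply: (Hn y (app d (opair x y))) => //; rewrite qm_dist; have := sub _ xV.
have [n [nw Hn]] := H _ xV; exists n, (half n); split; first exact/is_half_powP.
by move=> y r; rewrite qm_dist => -[_ [yX ->]]; apply: Hn.
Qed.

(** Interiors of balls are shown to be open by [near_trans] alone; openness of the balls themselves
    would call for differences of reals. *)
Definition ball_interior x n := sep X (fun y =>
  exists m, m ∈ omega /\ forall z, z ∈ X -> near m y z -> near n x z).

Lemma ball_interiorE x n y : y ∈ ball_interior x n <-> y ∈ X /\
  exists m, m ∈ omega /\ forall z, z ∈ X -> near m y z -> near n x z.
Proof. by rewrite /ball_interior sepE //; rewrite /near; def. Qed.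

Lemma Tm_ball_interior x : definable_map (ball_interior x).
Proof. by rewrite /ball_interior /near; def. Qed.

Lemma ball_interior_open x n : n ∈ omega -> ball_interior x n ∈ T.
Proof.
move=> nw; rewrite qm_open; split=> [y|y]; rewrite ball_interiorE; first by case.
move=> [yX [m [mw Hm]]]; have sw := succ_omega _ (succ_omega _ mw).
exists (succ (succ m)); split=> // z zX yz; rewrite ball_interiorE; split=> //.
exists (succ (succ m)); split=> // w wX zw; apply: Hm => //.
exact: near_trans yz zw.
Qed.

Lemma ball_interior_center x n : n ∈ omega -> x ∈ X -> x ∈ ball_interior x n.
Proof. by move=> nw xX; rewrite ball_interiorE; split=> //; exists n. Qed.

Lemma ball_interior_near x n y : y ∈ ball_interior x n -> near n x y.
Proof. by rewrite ball_interiorE => -[yX [m [mw]]]; apply=> //; exact: near_refl. Qed.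

Lemma ball_interior_countable x : countable (image omega (ball_interior x)).
Proof. by apply: countable_image; [exact: Tm_ball_interior|exact: countable_omega]. Qed.

Lemma ball_interior_family x U : U ∈ image omega (ball_interior x) <->
  exists n, n ∈ omega /\ U = ball_interior x n.
Proof. by apply: imageE; exact: Tm_ball_interior. Qed.

Lemma qm_first_countable : first_countable X T.
Proof.
move=> x xX; exists (image omega (ball_interior x)); split; first exact: ball_interior_countable.
split=> [U /ball_interior_family [n [nw ->]]|V].
  by split; [exact: ball_interior_open|exact: ball_interior_center].
rewrite qm_open => -[sub H] xV; have [n [nw Hn]] := H _ xV.
exists (ball_interior x n); rewrite ball_interior_family; split; first by exists n.
move=> y yU; apply: Hn; last exact: ball_interior_near.
by move: yU; rewrite ball_interiorE; case.
Qed.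

Lemma qm_countable_pseudocharacter : countable_pseudocharacter X T.
Proof.
move=> x A xX HA; exists (image omega (ball_interior x)); split; first exact: ball_interior_countable.
split=> [U /ball_interior_family [n [nw ->]]|y]; first exact: ball_interior_open.
rewrite (HA y); split=> [H|[yX H]].
  have -> : y = x by case: H.
  split=> // U /ball_interior_family [n [nw ->]]; exact: ball_interior_center.
left; apply/esym/near_separated => // n nw; apply: ball_interior_near; apply: H.
by rewrite ball_interior_family; exists n.
Qed.

End Consequences.

Lemma quasi_metrizable_first_countable X T : quasi_metrizable X T -> first_countable X T.
Proof. by move=> [d [Hd HT]]; apply: (qm_first_countable d). Qed.

Lemma quasi_metrizable_countable_pseudocharacter X T :
  quasi_metrizable X T -> countable_pseudocharacter X T.
Proof. by move=> [d [Hd HT]]; apply: (qm_countable_pseudocharacter d). Qed.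

Lemma metrizable_quasi_metrizable X T : metrizable X T -> quasi_metrizable X T.
Proof. by move=> [d [[Hd _] HT]]; exists d. Qed.

Lemma countable_pseudocharacter_cuf X T :
  countable_pseudocharacter X T -> cuf_pseudocharacter X T.
Proof.
move=> H x xX; have [|B [cB [BT HB]]] := H x (sing x) xX; first by apply/is_upairP; rewrite /sing sealedE.
by exists B; split; [exact: countable_cuf|split=> // y; rewrite -(HB y) singE].
Qed.

(** Interiors of balls around one point x are nonempty open sets, so they have finite complements,
    and these cover X without x. Only one point has to be picked. *)
Lemma qm_cofinite_cuf X T : cofinite_space X T -> quasi_metrizable X T -> cuf X.
Proof.
move=> HX [d [Hd HT]]; have [[x xX]|N] := classic (nonempty X); last first.
  by have -> : X = empty; [apply: NNPP => /nonemptyP|exact: cuf_empty].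
pose (B := fun n => ball_interior d X x n).
have HB : definable_map B by exact: Tm_ball_interior.
apply: (cuf_sub (cup (sing x) (sep X (fun y => y <> x)))); last first.
  by move=> y yX; rewrite cupE singE sepE //; have [->|] := classic (y = x); [left|right].
apply: cuf_cup; first exact/finite_cuf/finite_sing.
apply: (cuf_rel _ (fun n y => ~ y ∈ B n)); first by def.
  move=> y; rewrite sepE // => -[yX ne]; apply: NNPP => H; apply/ne/esym.
  apply: (near_separated d X Hd) => // n nw; apply: (ball_interior_near d X Hd).
  by apply: NNPP => yB; apply: H; exists n.
move=> n nw; have := ball_interior_open d X T Hd HT x n nw.
rewrite (HX _) => -[_ [E|[D [HD fD]]]].
  by case: (E x); exact: (ball_interior_center d X).
apply: (finite_sub D) => // y; rewrite sepE; last by def.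
by rewrite sepE // => -[[yX _] yB]; apply/HD.
Qed.

End QuasiMetric.

(** * Products *)

Section Products.
Context {M : structure} {HM : models_ZF M}.
Implicit Types (x y z n k m f g p A B D F G I J K P S T U V W X : M).

(** A coordinate is recovered as the set of its elements, all of which lie in the double union of
    the pair. *)
Definition pfst := sealed (fun p =>
  sep (union (union p)) (fun x => exists A B, p = opair A B /\ x ∈ A)).
Definition psnd := sealed (fun p =>
  sep (union (union p)) (fun x => exists A B, p = opair A B /\ x ∈ B)).

Lemma opair_union2 A B x : x ∈ A \/ x ∈ B -> x ∈ union (union (opair A B)).
Proof.
move=> H; have HU C : C = A \/ C = B -> C ∈ union (opair A B).
  move=> HC; rewrite unionE; exists (upair A B); rewrite opairE !upairE.
  by split=> //; right.
rewrite unionE; case: H => H; [exists A|exists B]; split=> //; apply: HU; [by left|by right].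
Qed.

Lemma pfstE A B : pfst (opair A B) = A.
Proof.
rewrite /pfst sealedE; apply: ext => x; rewrite sepE; last by def.
split=> [[_ [A' [B' [/opair_inj [<- _]]]]] //|xA].
by split; [apply: opair_union2; left|exists A, B].
Qed.

Lemma psndE A B : psnd (opair A B) = B.
Proof.
rewrite /psnd sealedE; apply: ext => x; rewrite sepE; last by def.
split=> [[_ [A' [B' [/opair_inj [_ <-]]]]] //|xA].
by split; [apply: opair_union2; right|exists A, B].
Qed.

Lemma Tm_pfst a : Tm a -> Tm (fun e => pfst (a e)).
Proof. by apply: (Tm_fun1 pfst); rewrite /pfst sealedE; def. Qed.

Lemma Tm_psnd a : Tm a -> Tm (fun e => psnd (a e)).
Proof. by apply: (Tm_fun1 psnd); rewrite /psnd sealedE; def. Qed.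
#[local] Hint Resolve Tm_pfst Tm_psnd : def.

Definition points S j := pfst (app S j).
Definition opens S j := psnd (app S j).

Lemma Tm_points a b : Tm a -> Tm b -> Tm (fun e => points (a e) (b e)).
Proof. by rewrite /points; def. Qed.

Lemma Tm_opens a b : Tm a -> Tm b -> Tm (fun e => opens (a e) (b e)).
Proof. by rewrite /opens; def. Qed.
#[local] Hint Resolve Tm_points Tm_opens : def.

Lemma space_atE S J Q j X T : is_space_family S J Q ->
  space_at S j X T <-> j ∈ J /\ X = points S j /\ T = opens S j.
Proof.
move=> [HS H]; split=> [[s [+ /is_opairP Es]]|[jJ [-> ->]]].
  rewrite (family_maps _ _ _ _ HS) => -[jJ E]; rewrite /points /opens -E Es pfstE psndE.
  by [].
have [X' [T' [[s [Hs /is_opairP Es]] _]]] := H _ jJ.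
exists s; split=> //; apply/is_opairP.
by move: Hs; rewrite (family_maps _ _ _ _ HS) /points /opens => -[_ <-]; rewrite Es pfstE psndE.
Qed.

Lemma space_familyE S J Q j : is_space_family S J Q -> j ∈ J -> Q (points S j) (opens S j).
Proof.
move=> HS jJ; have [_ H] := HS; have [X [T [+ HQ]]] := H _ jJ.
by rewrite (space_atE S J Q) // => -[_ [<- <-]].
Qed.

Lemma product_setE P S J Q f : is_space_family S J Q -> is_product_set P S J ->
  f ∈ P <-> is_family f J /\ forall j, j ∈ J -> app f j ∈ points S j.
Proof.
move=> HS HP; rewrite (HP f); split=> -[Hf H]; split=> //.
  move=> j jJ; apply: (H j _ (opens S j)); first by rewrite (space_atE S J Q).
  by rewrite (family_maps _ _ _ _ Hf).
move=> j X T y; rewrite (space_atE S J Q) // (family_maps _ _ _ _ Hf).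
by move=> [jJ [-> _]] [_ ->]; apply: H.
Qed.

Lemma product_ext P S J Q f g : is_space_family S J Q -> is_product_set P S J ->
  f ∈ P -> g ∈ P -> (forall j, j ∈ J -> app f j = app g j) -> f = g.
Proof.
move=> HS HP; rewrite !(product_setE P S J Q) // => -[Hf _] [Hg _].
exact: family_ext.
Qed.

Lemma boxE B P S J Q : is_space_family S J Q -> is_product_set P S J ->
  is_basic_box B P S J <-> exists U K, is_family U J /\ finite K /\
    (forall j, j ∈ J -> app U j ∈ opens S j /\ (j ∈ K \/ app U j = points S j)) /\
    (forall f, f ∈ B <-> f ∈ P /\ forall j, j ∈ J -> app f j ∈ app U j).
Proof.
move=> HS HP; split=> -[U [K [HU [fK [H HB]]]]]; exists U, K; split=> //; split=> //.
  split=> [j jJ|f].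
    by apply: H; rewrite ?(space_atE S J Q) // (family_maps _ _ _ _ HU).
  rewrite (HB f); split=> -[fP Hf]; split=> //; have [Ff _] := proj1 (product_setE P S J Q f HS HP) fP.
    by move=> j jJ; apply: (Hf j); rewrite ?(family_maps _ _ _ _ HU) ?(family_maps _ _ _ _ Ff).
  move=> j y A; rewrite (family_maps _ _ _ _ HU) (family_maps _ _ _ _ Ff).
  by move=> [jJ ->] [_ ->]; apply: Hf.
split=> [j X T A|f].
  rewrite (space_atE S J Q) // (family_maps _ _ _ _ HU).
  by move=> [jJ [-> ->]] [_ ->]; apply: H.
rewrite (HB f); split=> -[fP Hf]; split=> //; have [Ff _] := proj1 (product_setE P S J Q f HS HP) fP.
  move=> j y A; rewrite (family_maps _ _ _ _ HU) (family_maps _ _ _ _ Ff).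
  by move=> [jJ ->] [_ ->]; apply: Hf.
by move=> j jJ; apply: (Hf j); rewrite ?(family_maps _ _ _ _ HU) ?(family_maps _ _ _ _ Ff).
Qed.

(** * Products of entourages induce the product topology *)

Section ProductEntourages.
Context (S J P W : M) (Q : M -> M -> Prop) (C : M -> M -> M -> M -> Prop).
Hypotheses (HS : is_space_family S J Q) (HPW : is_product_space P W S J)
  (HC : definable4 C)
  (HE : forall j, j ∈ J -> entourages (fun n => C n j) (points S j))
  (HI : forall j, j ∈ J -> induces (fun n => C n j) (points S j) (opens S j))
  (Hfin : forall n, n ∈ omega ->
     finite (sep J (fun j => exists x y, x ∈ points S j /\ y ∈ points S j /\ ~ C n j x y))).

Definition product_entourage n f g := forall j, j ∈ J -> C n j (app f j) (app g j).

Lemma product_entourages : entourages product_entourage P.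
Proof.
have [HP _] := HPW.
have pt f j : f ∈ P -> j ∈ J -> app f j ∈ points S j.
  by rewrite (product_setE P S J Q) // => -[_]; apply.
split.
- by rewrite /product_entourage; def.
- by move=> n f nw fP j jJ; have [_ refl _ _ _] := HE _ jJ; apply: refl => //; apply: pt.
- move=> n f g h nw fP gP hP fg gh j jJ; have [_ _ trans _ _] := HE _ jJ.
  by apply: (trans n _ (app g j)); [|apply: pt|apply: pt|apply: pt|apply: fg|apply: gh].
- move=> n k f g kw nk fP gP fg j jJ; have [_ _ _ mono _] := HE _ jJ.
  by apply: (mono n k) => //; [apply: pt|apply: pt|apply: fg].
move=> f g fP gP H; apply: (product_ext P S J Q) => // j jJ.
have [_ _ _ _ sep0] := HE _ jJ; apply: sep0; [exact: pt|exact: pt|].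
by move=> n nw; apply: H.
Qed.

(** A box restricts finitely many coordinates, so one n works for all of them. Conversely the points
    g with C_n f g form a box: its sides are open by transitivity, and by [Hfin] all but finitely
    many are whole spaces. *)
Lemma product_induces : induces product_entourage P W.
Proof.
have [HP HW] := HPW.
have pt f j : f ∈ P -> j ∈ J -> app f j ∈ points S j.
  by rewrite (product_setE P S J Q) // => -[_]; apply.
move=> V; rewrite (HW V); split=> -[sub H]; split=> // f fV; have fP := sub _ fV.
  have [B [+ [fB BV]]] := H _ fV; rewrite (boxE _ _ _ _ Q) // => -[U [K [HU [fK [HUK HB]]]]].
  have [_ fU] := proj1 (HB f) fB.
  have [|||n [nw Hn]] := finite_bound K (fun j n => j ∈ J -> forall y, y ∈ points S j ->
      C n j (app f j) y -> y ∈ app U j) _ _ fK.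
  - by def.
  - move=> j n k kw nk Hj jJ y yX Cy; apply: Hj => //; have [_ _ _ mono _] := HE _ jJ.
    by apply: (mono n k) => //; apply: pt.
  (* K may contain elements outside J; the condition is void there and n = 0 serves. *)
  - move=> j jK; have [jJ|nJ] := classic (j ∈ J); last by exists empty.
    have [Uj _] := HUK _ jJ; move: Uj; rewrite (HI _ jJ) => -[_ Hx].
    by have [n [nw Hn]] := Hx _ (fU _ jJ); exists n.
  exists n; split=> // g gP Cfg; apply: BV; rewrite (HB g); split=> // j jJ.
  have [_ [jK|->]] := HUK _ jJ; last exact: pt.
  by apply: Hn => //; [apply: pt|apply: Cfg].
have [n [nw Hn]] := H _ fV.
pose (N := fun j => sep (points S j) (C n j (app f j))).
have HNC j : definable (C n j (app f j)) by def.
have HN : definable_map N.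
  by rewrite /N; apply: (Tm_sep (fun e => points S (e 0)) (fun x e => C n (e 0) (app f (e 0)) x)); def.
exists (sep P (product_entourage n f)); split; last first.
  have HD : definable (product_entourage n f) by rewrite /product_entourage; def.
  split; last by move=> g; rewrite sepE // => -[gP fg]; apply: Hn.
  by rewrite sepE //; split=> //; have [_ refl _ _ _] := product_entourages; apply: refl.
rewrite (boxE _ _ _ _ Q) //.
exists (lam J N), (sep J (fun j => exists x y, x ∈ points S j /\ y ∈ points S j /\ ~ C n j x y)).
split; first exact: lam_family.
split; first exact: Hfin.
split=> [j jJ|g].
  rewrite app_lam //; split.
    rewrite (HI _ jJ); split=> [x|x]; rewrite {1}/N sepE //; first by case.
    move=> [xX fx]; exists n; split=> // y yX xy; rewrite /N sepE //; split=> //.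
    by have [_ _ trans _ _] := HE _ jJ; apply: (trans n _ x) => //; apply: pt.
  have [jK|jK] := classic (j ∈ sep J (fun j => exists x y, x ∈ points S j /\ y ∈ points S j /\ ~ C n j x y)).
    by left.
  right; apply: ext => y; rewrite /N sepE //; split=> [[] //|yX]; split=> //.
  apply: NNPP => nC; apply: jK; rewrite sepE; last by def.
  by split=> //; exists (app f j), y; split=> //; apply: pt.
rewrite sepE; last by rewrite /product_entourage; def.
split=> -[gP Hg]; split=> // j jJ; move: (Hg _ jJ); rewrite app_lam //; rewrite /N sepE //.
  by split=> //; apply: pt.
by case.
Qed.

End ProductEntourages.

(** [L n x] reads as x being in stage n. Besides x itself, every point outside the finite stage n is
    related to x, so a nonempty set open for these relations is cofinite; conversely a finite
    complement lies within one stage. *)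
Lemma cofinite_entourages (L : M -> M -> Prop) X T : definable2 L ->
  (forall x, x ∈ X -> exists n, n ∈ omega /\ L n x) ->
  (forall n k x, k ∈ omega -> n ∈ succ k -> L n x -> L k x) ->
  (forall n, n ∈ omega -> finite (sep X (L n))) -> cofinite_space X T ->
  entourages (fun n x y => x = y \/ ~ L n y) X /\ induces (fun n x y => x = y \/ ~ L n y) X T.
Proof.
move=> HL ex mono fin HX; split.
  split=> [|n x _ _|n x y z _ _ _ _ [->|nx] [<-|nz]|n k x y kw nk _ _ [->|nL]|x y xX yX H].
  - by def.
  - by left.
  - by left.
  - by right.
  - by right.
  - by right.
  - by left.
  - by right=> Ln; apply/nL/(mono n).
  have [n [nw Ln]] := ex _ yX; by case: (H _ nw).
have HLn n : definable (L n) by def.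
move=> V; rewrite (HX V); split=> -[sub H]; split=> //.
  move=> x xV; case: H => [/(_ x) //|[D [HD fD]]].
  have [|||n [nw Hn]] := finite_bound D (fun y n => L n y) _ _ fD.
  - by def.
  - by move=> y n k kw nk; apply: mono.
  - by move=> y /HD [/ex].
  exists n; split=> // y yX [<- //|nL]; apply: NNPP => yV; apply/nL/Hn/HD.
  by [].
have [[x xV]|N] := classic (nonempty V); last by left=> x xV; apply: N; exists x.
right; exists (diff X V); split=> [y|]; first exact: diffE.
have [n [nw Hn]] := H _ xV; apply: (finite_sub _ _ (fin n nw)) => y.
rewrite diffE sepE // => -[yX yV]; split=> //; apply: NNPP => nL.
by apply: yV; apply: Hn => //; right.
Qed.

(** Stages lie within D. A point of D is isolated by any stage containing it, whereas oo is in no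
    stage and gets cofinite neighbourhoods. *)
Lemma compactified_entourages (L : M -> M -> Prop) X T D oo : definable2 L ->
  (forall x, x ∈ D -> exists n, n ∈ omega /\ L n x) ->
  (forall n k x, k ∈ omega -> n ∈ succ k -> L n x -> L k x) ->
  (forall n, n ∈ omega -> finite (sep D (L n))) ->
  (forall n x, L n x -> x ∈ D) -> ~ oo ∈ D ->
  (forall x, x ∈ X <-> x ∈ D \/ x = oo) ->
  (forall U, U ∈ T <-> subset U X /\
     (oo ∈ U -> exists C, is_difference C X U /\ finite C)) ->
  entourages (fun n x y => x = y \/ (~ L n x /\ ~ L n y)) X /\
  induces (fun n x y => x = y \/ (~ L n x /\ ~ L n y)) X T.
Proof.
move=> HL ex mono fin LD ooD HX HT; split.
  split=> [|n x _ _|n x y z _ _ _ _ [->|[nx ny]] [<-|[ny' nz]]|n k x y kw nk _ _ [->|[nx ny]]|x y xX yX H].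
  - by def.
  - by left.
  - by left.
  - by right.
  - by right.
  - by right.
  - by left.
  - by right; split=> Ln; [apply/nx/(mono n)|apply/ny/(mono n)].
  move: xX yX; rewrite !HX => -[xD|Ex]; first by have [n [nw Ln]] := ex _ xD; case: (H _ nw) => // -[].
  by move=> [yD|->] //; have [n [nw Ln]] := ex _ yD; case: (H _ nw) => // -[].
have HLn n : definable (L n) by def.
move=> V; rewrite (HT V); split=> -[sub H]; split=> //.
  move=> x xV; have := sub _ xV; rewrite HX => -[xD|Ex].
    have [n [nw Ln]] := ex _ xD; exists n; split=> // y yX [<- //|[]] //.
  move: xV; rewrite Ex => ooV; have [E [HE fE]] := H ooV.
  have [|||n [nw Hn]] := finite_bound E (fun y n => L n y) _ _ fE.
  - by def.
  - by move=> y n k kw nk; apply: mono.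
  - by move=> y /HE []; rewrite HX => -[/ex //|->].
  exists n; split=> // y yX [<- //|[_ nL]]; apply: NNPP => yV; apply/nL/Hn/HE.
  by [].
move=> ooV; exists (diff X V); split=> [y|]; first exact: diffE.
have [n [nw Hn]] := H _ ooV; apply: (finite_sub _ _ (fin n nw)) => y.
rewrite diffE sepE // => -[yX yV].
have Ly : L n y.
  apply: NNPP => nL; apply: yV; apply: Hn => //; right; split=> //.
  by move/LD.
by split=> //; apply: LD Ly.
Qed.

End Products.
#[global] Hint Resolve Tm_pfst Tm_psnd Tm_points Tm_opens : def.

(** * From unions to products and back *)

Section UnionsToProducts.
Context {M : structure} {HM : models_ZF M}.
Implicit Types (x y z n k m f g p j A B D F G J K P S T U V W X : M).

(** The properties that [countable] and [cuf] share and that the argument uses: omega can be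
    adjoined, and tagging with an index j is allowed. *)
Definition size_class (Q : M -> Prop) : Prop :=
  [/\ definable Q, forall A, countable A -> Q A,
      forall A B, Q A -> Q B -> Q (cup A B) &
      forall A j, Q A -> Q (image A (opair j))].

Lemma size_class_countable : size_class countable.
Proof.
split=> //; first exact: countable_cup.
by move=> A j; apply: countable_image; def.
Qed.

Lemma size_class_cuf : size_class cuf.
Proof.
split=> //; [exact: countable_cuf|exact: cuf_cup|].
move=> A j cA; apply: (cuf_finite_sections _ A (fun x p => p = opair j x)) => //.
- by move=> p; rewrite imageE //.
move=> x _; apply: (finite_sub (sing (opair j x))); first exact: finite_sing.
by move=> p; rewrite sepE ?singE; [case|def].
Qed.

Definition dsum J (D : M -> M) := big_union J (fun j => image (D j) (opair j)).

Lemma dsumE J (D : M -> M) j x : definable_map D ->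
  opair j x ∈ dsum J D <-> j ∈ J /\ x ∈ D j.
Proof.
move=> HD; have HD' i : definable_map (opair i) by def.
rewrite /dsum big_unionE; last by def.
split=> [[i [iJ]]|[jJ xj]].
  by rewrite imageE // => -[y [yi /opair_inj [-> ->]]].
by exists j; rewrite imageE //; split=> //; exists x.
Qed.

Lemma cuf_dsum (I Q : M -> Prop) J (D : M -> M) : size_class Q -> definable_map D ->
  every_union I Q cuf -> I J -> (forall j, j ∈ J -> Q (D j)) -> cuf (dsum J D).
Proof.
move=> [_ _ _ Qim] HD HU IJ HQ.
have Ht : definable_map (fun j => image (D j) (opair j)) by def.
apply: (HU J (lam J (fun j => image (D j) (opair j)))) => //.
- exact: lam_family.
- by move=> j A; rewrite maps_lam // => -[jJ ->]; apply/Qim/HQ.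
move=> x; rewrite /dsum big_unionE //; split=> [[j [jJ xj]]|[j [A []]]].
  by exists j, (image (D j) (opair j)); rewrite maps_lam.
by rewrite maps_lam // => -[jJ ->] xj; exists j.
Qed.

(** The last clause holds because the indices that meet stage n are first coordinates of a finite
    set; it provides the finiteness needed for product entourages. *)
Lemma dsum_exhaustion (D : M -> M) J G : definable_map D -> is_exhaustion G (dsum J D) ->
  [/\ forall j x, j ∈ J -> x ∈ D j -> exists n, n ∈ omega /\ opair n (opair j x) ∈ G,
      forall n k p, k ∈ omega -> n ∈ succ k -> opair n p ∈ G -> opair k p ∈ G,
      forall j n, j ∈ J -> n ∈ omega -> finite (sep (D j) (fun x => opair n (opair j x) ∈ G)),
      forall n j x, opair n (opair j x) ∈ G -> j ∈ J /\ x ∈ D j &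
      forall n, n ∈ omega -> finite (sep J (fun j => exists x, opair n (opair j x) ∈ G))].
Proof.
move=> HD [G1 G2 G3 G4]; split=> //.
- by move=> j x jJ xj; apply: G2; rewrite dsumE.
- move=> j n jJ nw; apply: (finite_inj _ _ (opair j) _ (G4 n nw)); first by def.
    by move=> x; rewrite !sepE // dsumE // => -[xj xG].
  by move=> x y _ _ /opair_inj [].
- by move=> n j x /G1 [_]; rewrite dsumE.
move=> n nw; apply: (finite_sub (image (sep (dsum J D) (fun p => opair n p ∈ G)) pfst)).
  by apply: finite_image; [def|exact: G4].
move=> j; rewrite sepE; last by def.
move=> [jJ [x xG]]; rewrite imageE; last by def.
exists (opair j x); rewrite pfstE sepE //; split=> //; split=> //.
by have [] := G1 _ _ xG.
Qed.

Lemma product_cofinite_quasi_metrizable (I Q : M -> Prop) : size_class Q ->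
  every_union I Q cuf ->
  every_product I (fun X T => cofinite_space X T /\ Q X) quasi_metrizable.
Proof.
move=> SQ HU J S P W IJ _ HS HPW.
have HD : definable_map (points S) by def.
pose proof (fun j => space_familyE S J _ j HS) as HX.
have cD : cuf (dsum J (points S)).
  by apply: (cuf_dsum I Q) => // j /HX [].
have [G HG] := cuf_exhaustion _ cD.
have [ex mono fin inD finJ] := dsum_exhaustion _ _ _ HD HG.
have HC j : j ∈ J -> entourages (fun n x y => x = y \/ ~ opair n (opair j y) ∈ G) (points S j) /\
   induces (fun n x y => x = y \/ ~ opair n (opair j y) ∈ G) (points S j) (opens S j).
  move=> jJ; apply: (cofinite_entourages (fun n x => opair n (opair j x) ∈ G)).
  - by def.
  - by move=> x; apply: ex.
  - by move=> n k x; apply: mono.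
  - by move=> n; apply: fin.
  by have [] := HX _ jJ.
pose (C := fun n j x y => x = y \/ ~ opair n (opair j y) ∈ G).
have HCdef : definable4 C by rewrite /C; def.
have HE j jJ := proj1 (HC j jJ); have HI j jJ := proj2 (HC j jJ).
have Hfin n : n ∈ omega ->
    finite (sep J (fun j => exists x y, x ∈ points S j /\ y ∈ points S j /\ ~ C n j x y)).
  move=> nw; apply: (finite_sub _ _ (finJ n nw)) => j; rewrite !sepE; try by def.
  move=> [jJ [x [y [_ [_ nC]]]]]; split=> //; exists y.
  by apply: NNPP => ny; apply: nC; right.
have [d [Hd [HT _]]] := entourages_quasi_metric _ _ _
  (product_entourages S J P W _ C HS HPW HCdef HE)
  (product_induces S J P W _ C HS HPW HCdef HE HI Hfin).
by exists d.
Qed.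

(** The space does not name its D and oo, but D is definable as the set of isolated points: if oo
    were isolated, D would be finite. *)
Lemma sing_open_compactified (Q : M -> Prop) X T D oo x : infinite D -> ~ oo ∈ D ->
  (forall x, x ∈ X <-> x ∈ D \/ x = oo) ->
  (forall U, U ∈ T <-> subset U X /\
     (oo ∈ U -> exists C, is_difference C X U /\ finite C)) ->
  x ∈ X -> sing x ∈ T <-> x ∈ D.
Proof.
move=> infD ooD HX HT xX; rewrite (HT (sing x)); split=> [[_ H]|xD].
  move: (xX); rewrite HX => -[//|E]; exfalso; subst x.
  have [|C [HC fC]] := H; first by rewrite singE.
  apply: infD; apply: (finite_sub _ _ fC) => y yD; apply/HC; rewrite singE HX.
  by split=> [|E]; [left|apply: ooD; rewrite -E].
split=> [y|]; rewrite singE; first by move=> ->.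
by move=> E; case: ooD; rewrite E.
Qed.

Lemma product_compactified_metrizable (I Q Q' : M -> Prop) : size_class Q ->
  (forall A, Q' A -> Q A) -> every_union I Q cuf ->
  every_product I (compactified_discrete Q') metrizable.
Proof.
move=> SQ QQ HU J S P W IJ _ HS HPW.
pose (D := fun j => sep (points S j) (fun x => sing x ∈ opens S j)).
have HD : definable_map D by rewrite /D; def.
pose proof (fun j => space_familyE S J _ j HS) as HX.
have DE j D' oo : j ∈ J -> infinite D' -> ~ oo ∈ D' ->
    (forall x, x ∈ points S j <-> x ∈ D' \/ x = oo) ->
    (forall U, U ∈ opens S j <-> subset U (points S j) /\
      (oo ∈ U -> exists C, is_difference C (points S j) U /\ finite C)) -> D j = D'.
  move=> jJ infD ooD H1 H2; apply: ext => x; rewrite /D sepE //.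
  split=> [[xX]|xD]; first by rewrite (sing_open_compactified Q _ _ D' oo).
  by have xX : x ∈ points S j by [rewrite H1; left]; rewrite (sing_open_compactified Q _ _ D' oo).
have cD : cuf (dsum J D).
  apply: (cuf_dsum I Q) => // j jJ; have [D' [oo [infD [QD [ooD [H1 H2]]]]]] := HX _ jJ.
  by rewrite (DE j D' oo) //; apply: QQ.
have [G HG] := cuf_exhaustion _ cD.
have [ex mono fin inD finJ] := dsum_exhaustion _ _ _ HD HG.
pose (C := fun n j x y => x = y \/ (~ opair n (opair j x) ∈ G /\ ~ opair n (opair j y) ∈ G)).
have HC j : j ∈ J -> entourages (fun n => C n j) (points S j) /\
   induces (fun n => C n j) (points S j) (opens S j).
  move=> jJ; have [D' [oo [infD [QD [ooD [H1 H2]]]]]] := HX _ jJ.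
  have E := DE j D' oo jJ infD ooD H1 H2; rewrite -E in ooD H1.
  apply: (compactified_entourages (fun n x => opair n (opair j x) ∈ G) _ _ (D j) oo) => //.
  - by move=> x; apply: ex.
  - by move=> n k x; apply: mono.
  - by move=> n; apply: fin.
  by move=> n x /inD [].
have HCdef : definable4 C by rewrite /C; def.
have HE j jJ := proj1 (HC j jJ); have HI j jJ := proj2 (HC j jJ).
have Hfin n : n ∈ omega ->
    finite (sep J (fun j => exists x y, x ∈ points S j /\ y ∈ points S j /\ ~ C n j x y)).
  move=> nw; apply: (finite_sub _ _ (finJ n nw)) => j; rewrite !sepE; try by def.
  move=> [jJ [x [y [_ [_ nC]]]]]; split=> //.
  have [xG|xG] := classic (opair n (opair j x) ∈ G); first by exists x.
  by exists y; apply: NNPP => ny; apply: nC; right.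
have [d [_ [HT Hsym]]] := entourages_quasi_metric _ _ _
  (product_entourages S J P W _ C HS HPW HCdef HE)
  (product_induces S J P W _ C HS HPW HCdef HE HI Hfin).
exists d; split=> //; apply: Hsym => n f g _ _ fg j jJ.
by have [->|[]] := fg j jJ; [left|right].
Qed.

Lemma cuf_cofinite_quasi_metrizable X T :
  cofinite_space X T -> cuf X -> quasi_metrizable X T.
Proof.
move=> HX /cuf_exhaustion [G [G1 G2 G3 G4]].
have [|||||HE HI] := cofinite_entourages (fun n x => opair n x ∈ G) X T.
- by def.
- by [].
- by [].
- by [].
- by [].
by have [d [Hd [HT _]]] := entourages_quasi_metric _ _ _ HE HI; exists d.
Qed.

End UnionsToProducts.

(** * Recovering a union from the neighbourhoods of one point of a product *)

Section ProductsToUnions.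
Context {M : structure} {HM : models_ZF M}.
Context (J oo : M) (X T D : M -> M).
Implicit Types (x y z n k m f g p i j A B U V : M).
(** The conditions on open sets are those that the cofinite topology and the one-point
    compactification have in common. *)
Hypotheses (HX : definable_map X) (HT : definable_map T) (HD : definable_map D)
  (XE : forall j x, j ∈ J -> x ∈ X j <-> x ∈ D j \/ x = oo)
  (ooD : forall j, j ∈ J -> ~ oo ∈ D j)
  (TX : forall j, j ∈ J -> X j ∈ T j)
  (TD : forall j x, j ∈ J -> x ∈ D j -> diff (X j) (sing x) ∈ T j)
  (Too : forall j A, j ∈ J -> A ∈ T j -> oo ∈ A -> finite (diff (X j) A)).

Definition pointed_family := lam J (fun j => opair (X j) (T j)).
Definition pointed_product := sep (power (cart J (big_union J X)))
  (fun f => is_family f J /\ forall j, j ∈ J -> app f j ∈ X j).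
Definition pointed_topology := sep (power pointed_product) (fun V =>
  forall f, f ∈ V -> exists B, is_basic_box B pointed_product pointed_family J /\
    f ∈ B /\ subset B V).

Let S := pointed_family.
Let P := pointed_product.
Let W := pointed_topology.

Lemma pointed_familyP (Q : M -> M -> Prop) : (forall j, j ∈ J -> Q (X j) (T j)) ->
  is_space_family S J Q.
Proof.
move=> HQ; have Ht : definable_map (fun j => opair (X j) (T j)) by def.
split; first exact: lam_family.
move=> j jJ; exists (X j), (T j); split; last exact: HQ.
by exists (opair (X j) (T j)); rewrite maps_lam // is_opairP.
Qed.

Let HS : is_space_family S J (fun _ _ => True) := pointed_familyP _ (fun _ _ => I).

Lemma points_pointed j : j ∈ J -> points S j = X j /\ opens S j = T j.
Proof.
by move=> jJ; rewrite /points /opens /S /pointed_family app_lam; [rewrite pfstE psndE|def|].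
Qed.

Lemma pointed_productE f : f ∈ P <-> is_family f J /\ forall j, j ∈ J -> app f j ∈ X j.
Proof.
rewrite /P /pointed_product sepE; last by def.
split=> [[] //|[Hf H]]; split=> //; rewrite powerE => p pf.
have [x [y [xJ /is_opairP E]]] := proj1 Hf p pf.
rewrite E opair_cart; split=> //; rewrite big_unionE //; exists x; split=> //.
by move: pf; rewrite E -mapsE (family_maps _ _ _ _ Hf) => -[_ ->]; apply: H.
Qed.

Lemma pointed_product_set : is_product_set P S J.
Proof.
move=> f; rewrite pointed_productE; split=> -[Hf H]; split=> //.
  move=> j Y R y; rewrite (space_atE _ _ _ _ _ _ HS) (family_maps _ _ _ _ Hf).
  by move=> [jJ [-> _]] [_ ->]; rewrite (proj1 (points_pointed _ jJ)); apply: H.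
move=> j jJ; apply: (H j _ (opens S j)).
  by rewrite (space_atE _ _ _ _ _ _ HS) (proj1 (points_pointed _ jJ)).
by rewrite (family_maps _ _ _ _ Hf).
Qed.

Lemma pointed_productP : is_product_space P W S J.
Proof.
split; first exact: pointed_product_set.
by move=> V; rewrite /W /pointed_topology sepE ?powerE //; def.
Qed.

Definition base_point := lam J (fun _ => oo).
Definition spike j y := lam J (fun i => cond (i = j) y oo).

Lemma app_base_point j : j ∈ J -> app base_point j = oo.
Proof. by move=> jJ; rewrite /base_point app_lam. Qed.

Lemma spike_def j y : definable_map (fun i => cond (i = j) y oo).
Proof. by def. Qed.

Lemma app_spike j y i : i ∈ J -> app (spike j y) i = cond (i = j) y oo.
Proof. by move=> iJ; rewrite /spike app_lam //; exact: spike_def. Qed.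

Lemma base_pointP : base_point ∈ P.
Proof.
rewrite pointed_productE; split; first exact: lam_family.
by move=> j jJ; rewrite app_base_point // XE //; right.
Qed.

Lemma spikeP j y : j ∈ J -> y ∈ D j -> spike j y ∈ P.
Proof.
move=> jJ yD; rewrite pointed_productE; split; first exact/lam_family/spike_def.
move=> i iJ; rewrite app_spike // XE //; have [E|E] := classic (i = j).
  by rewrite cond_true // E; left.
by rewrite cond_false //; right.
Qed.

(** All coordinates of a spike but the j-th equal oo, so it lies in a box around the base point as
    soon as y is in the j-th side. That side contains oo, so its complement is finite. *)
Lemma spikes_outside_finite U V j : j ∈ J -> V ∈ W -> base_point ∈ V -> subset V U ->
  finite (sep (D j) (fun y => ~ spike j y ∈ U)).
Proof.
have [HP HW] := pointed_productP.
move=> jJ /HW [sub H] fV VU; have [B [+ [fB BV]]] := H _ fV.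
rewrite (boxE _ _ _ _ _ HS HP) => -[R [K [HR [fK [HRK HB]]]]].
have [_ fR] := proj1 (HB _) fB; have [+ _] := HRK _ jJ.
rewrite (proj2 (points_pointed _ jJ)) => RT; have fin := Too _ _ jJ RT.
have Rj i : i ∈ J -> oo ∈ app R i by move=> iJ; rewrite -(app_base_point i) //; apply: fR.
apply: (finite_sub _ _ (fin (Rj _ jJ))) => y; rewrite sepE; last by rewrite /spike; def.
move=> [yD yU]; rewrite diffE XE //; split; first by left.
move=> yR; apply/yU/VU/BV; rewrite (HB _); split; first exact: spikeP.
move=> i iJ; rewrite app_spike //; have [E|E] := classic (i = j).
  by rewrite cond_true // E.
by rewrite cond_false //; apply: Rj.
Qed.

(** There is one finite section for each pair (U, j). Asking only for neighbourhoods of the base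
    point covers pseudobases and local bases alike. *)
Lemma cuf_of_separating_family B : cuf J -> cuf B ->
  (forall U, U ∈ B -> exists V, V ∈ W /\ base_point ∈ V /\ subset V U) ->
  (forall j y, j ∈ J -> y ∈ D j -> exists U, U ∈ B /\ ~ spike j y ∈ U) ->
  cuf (big_union J D).
Proof.
move=> cJ cB Hnb Hsep.
apply: (cuf_finite_sections _ (cart B J)
  (fun p y => exists U j, p = opair U j /\ y ∈ D j /\ ~ spike j y ∈ U)).
- by rewrite /spike; def.
- exact: cuf_cart.
- move=> y; rewrite big_unionE // => -[j [jJ yj]]; have [U [UB yU]] := Hsep _ _ jJ yj.
  by exists (opair U j); rewrite opair_cart; split=> //; exists U, j.
move=> p /cartE [U [j [UB [jJ ->]]]]; have [V [VW [fV VU]]] := Hnb _ UB.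
apply: (finite_sub _ _ (spikes_outside_finite U V j jJ VW fV VU)) => y.
rewrite !sepE; try by rewrite /spike; def.
by move=> [_ [U' [j' [/opair_inj [<- <-] H]]]].
Qed.

Lemma cuf_of_cuf_pseudocharacter : cuf J -> cuf_pseudocharacter P W -> cuf (big_union J D).
Proof.
move=> cJ H; have [B [cB [BW HB]]] := H _ base_pointP.
apply: (cuf_of_separating_family B) => // [U UB|j y jJ yj].
  exists U; split; first exact: BW.
  by have [_ H'] := proj2 (HB base_point) erefl; split=> //; apply: H'.
apply: NNPP => N; have /HB E : spike j y ∈ P /\ forall U, U ∈ B -> spike j y ∈ U.
  by split=> [|U UB]; [exact: spikeP|apply: NNPP => yU; apply: N; exists U].
apply: (ooD j jJ); have := app_spike j y j jJ; rewrite E app_base_point // cond_true // => ->.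
by [].
Qed.

Lemma cuf_of_first_countable : cuf J -> first_countable P W -> cuf (big_union J D).
Proof.
have [HP HW] := pointed_productP.
move=> cJ H; have [B [cB [BW HB]]] := H _ base_pointP.
apply: (cuf_of_separating_family B) => //; first exact: countable_cuf.
  by move=> U /BW [UW fU]; exists U; split=> //; split=> // x.
move=> j y jJ yj.
(* V is an open neighbourhood of the base point that misses the spike, hence so does any member of
   the local base contained in V. *)
pose (V := sep P (fun g => app g j <> y)).
have VE g : g ∈ V <-> g ∈ P /\ app g j <> y by rewrite /V sepE //; def.
pose (R := fun i => cond (i = j) (diff (X j) (sing y)) (X i)).
have HR : definable_map R by rewrite /R; def.
have VW : V ∈ W.
  rewrite (HW V); split=> [g /VE [] //|g gV]; exists V; split; last by split=> // h.
  rewrite (boxE _ _ _ _ _ HS HP); exists (lam J R), (sing j).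
  split; first exact: lam_family.
  split; first exact: finite_sing.
  split=> [i iJ|h].
    rewrite app_lam // singE; have [-> ->] := points_pointed _ iJ; rewrite /R.
    have [E|E] := classic (i = j); first by rewrite cond_true // E; split; [exact: TD|left].
    by rewrite cond_false //; split; [exact: TX|right].
  rewrite VE; split=> -[hP Hh]; split=> //.
    move=> i iJ; have [_ hX] := proj1 (pointed_productE h) hP.
    rewrite app_lam // /R; have [E|E] := classic (i = j); last by rewrite cond_false //; apply: hX.
    by rewrite cond_true // E diffE singE; split=> //; apply: hX.
  by have := Hh _ jJ; rewrite app_lam // /R cond_true // diffE singE => -[].
have [|U [UB UV]] := HB _ VW.
  rewrite VE app_base_point //; split; first exact: base_pointP.
  by move=> E; apply: (ooD j jJ); rewrite E.
exists U; split=> // /UV; rewrite VE => -[_]; apply.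
by rewrite app_spike // cond_true.
Qed.

End ProductsToUnions.

(** * The equivalences *)

Section Equivalences.
Context {M : structure} {HM : models_ZF M}.
Implicit Types (x y z j A B D F J P S T U V W X : M).

Lemma every_product_mono (I I' : M -> Prop) (Q1 Q2 R1 R2 : M -> M -> Prop) :
  (forall J, I' J -> I J) -> (forall X T, Q2 X T -> Q1 X T) -> (forall X T, R1 X T -> R2 X T) ->
  every_product I Q1 R1 -> every_product I' Q2 R2.
Proof.
move=> HI HQ HR H J S P W IJ nJ [HS HS'] HP; apply: HR; apply: (H J S P W) => //.
  exact: HI.
split=> // j jJ; have [X [T [ST QX]]] := HS' j jJ; exists X, T; split=> //.
exact: HQ.
Qed.

(** [Tau] abstracts from the choice between the two topologies; it takes oo as an argument because a
    compactification singles this point out. *)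
Lemma every_union_of_products (I Q : M -> Prop) (R : M -> M -> Prop) (Tau : M -> M -> M) :
  size_class Q -> (forall J, I J -> cuf J) ->
  Tm (fun e => Tau (e 0) (e 1)) ->
  (forall D oo X, infinite D -> Q D -> ~ oo ∈ D -> X = cup D (sing oo) ->
     [/\ R X (Tau X oo), X ∈ Tau X oo,
         forall x, x ∈ D -> diff X (sing x) ∈ Tau X oo &
         forall A, A ∈ Tau X oo -> oo ∈ A -> finite (diff X A)]) ->
  every_product I R cuf_pseudocharacter \/ every_product I R first_countable ->
  every_union I Q cuf.
Proof.
move=> [_ Qc Qcup _] Icuf HTau HR Hprod J F U IJ HF FQ FU.
(* Products are only considered over nonempty index sets, so the empty union is treated apart. *)
have [[j0 j0J]|nJ] := classic (nonempty J); last first.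
  have -> : U = empty; last exact: cuf_empty.
  apply/is_emptyP => x /FU [j [A []]]; rewrite (family_maps _ _ _ _ HF) => -[jJ _].
  by case: nJ; exists j.
have [oo Hoo] := fresh (cup U omega).
(* Adjoining omega makes [D j] infinite and preserves Q. *)
pose (D := fun j => cup (app F j) omega).
pose (X := fun j => cup (D j) (sing oo)).
pose (T := fun j => Tau (X j) oo).
have HD : definable_map D by rewrite /D; def.
have HX : definable_map X by rewrite /X /D; def.
have HT : definable_map T.
  by apply: (Tm_fun2 Tau HTau (fun e => X (e 0)) (fun _ => oo)); last exact: Tm_const.
have ooD j : j ∈ J -> ~ oo ∈ D j.
  move=> jJ; rewrite cupE => -[ooF|oow]; apply: Hoo; rewrite cupE; last by right.
  by left; apply/FU; exists j, (app F j); rewrite (family_maps _ _ _ _ HF).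
have RT j (jJ : j ∈ J) : [/\ R (X j) (T j), X j ∈ T j,
     forall x, x ∈ D j -> diff (X j) (sing x) ∈ T j &
     forall A, A ∈ T j -> oo ∈ A -> finite (diff (X j) A)].
  apply: HR => //; last exact: ooD.
    move=> fD; apply: omega_infinite; apply: (finite_sub _ _ fD) => x xw.
    by rewrite cupE; right.
  apply: Qcup; last exact/Qc/countable_omega.
  by apply: (FQ j); rewrite (family_maps _ _ _ _ HF).
have XE j x : j ∈ J -> x ∈ X j <-> x ∈ D j \/ x = oo by move=> _; rewrite cupE singE.
have TX j : j ∈ J -> X j ∈ T j by case/RT.
have TD j x : j ∈ J -> x ∈ D j -> diff (X j) (sing x) ∈ T j.
  by move=> /RT [_ _ H _]; apply: H.
have Too j A : j ∈ J -> A ∈ T j -> oo ∈ A -> finite (diff (X j) A).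
  by move=> /RT [_ _ _ H]; apply: H.
have HS : is_space_family (pointed_family J X T) J R.
  by apply: (pointed_familyP J X T D) => // j /RT [].
pose proof (pointed_productP J X T D HX HT HD) as HP.
have cU : cuf (big_union J D); last first.
  apply: (cuf_sub _ _ cU) => x /FU [j [A []]]; rewrite (family_maps _ _ _ _ HF) => -[jJ ->] xA.
  by rewrite big_unionE //; exists j; rewrite cupE; split=> //; left.
have nJ : nonempty J by exists j0.
case: Hprod => H; have HPW := H J _ _ _ IJ nJ HS HP.
  exact: (cuf_of_cuf_pseudocharacter J oo X T D HX HT HD XE ooD Too (Icuf _ IJ)).
exact: (cuf_of_first_countable J oo X T D HX HT HD XE ooD TX TD Too (Icuf _ IJ)).
Qed.

Definition cofinite_topology X := sep (power X) (fun U => is_empty U \/ finite (diff X U)).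
Definition compactified_topology X oo := sep (power X) (fun U => oo ∈ U -> finite (diff X U)).

Lemma cofinite_topologyP X : cofinite_space X (cofinite_topology X).
Proof.
move=> U; rewrite /cofinite_topology sepE ?powerE; last by def.
split=> -[sub [H|H]]; split=> //; try by left.
  by right; exists (diff X U); split=> // x; apply: diffE.
right; have [E [HE fE]] := H; apply: (finite_sub _ _ fE) => x.
by rewrite diffE => /HE.
Qed.

Lemma diff_self X : diff X X = empty.
Proof. by apply/is_emptyP => x; rewrite diffE => -[]. Qed.

Lemma diff_diff_sing X x : finite (diff X (diff X (sing x))).
Proof.
apply: (finite_sub _ _ (finite_sing x)) => y; rewrite !diffE => -[yX H].
by apply: NNPP => yx; apply: H.
Qed.

Lemma union_of_cofinite_products (I Q : M -> Prop) : size_class Q -> (forall J, I J -> cuf J) ->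
  let cofinite_Q X T := cofinite_space X T /\ Q X in
  every_product I cofinite_Q cuf_pseudocharacter \/ every_product I cofinite_Q first_countable ->
  every_union I Q cuf.
Proof.
move=> SQ Icuf cofinite_Q.
apply: (every_union_of_products _ _ _ (fun X _ => cofinite_topology X)) => //.
  by rewrite /cofinite_topology; def.
move=> D oo X infD QD ooD EX.
have E U : U ∈ cofinite_topology X <-> subset U X /\ (is_empty U \/ finite (diff X U)).
  by rewrite /cofinite_topology sepE ?powerE //; def.
split.
- split; first exact: cofinite_topologyP.
  have [_ Qc Qcup _] := SQ; rewrite EX; apply: Qcup => //.
  exact/Qc/finite_countable/finite_sing.
- by rewrite E diff_self; split=> //; right; exact: finite_empty.
- move=> x xD; rewrite E; split; first by move=> y; rewrite diffE; case.
  by right; exact: diff_diff_sing.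
by move=> A; rewrite E => -[_ [/(_ oo) //|]].
Qed.

Lemma union_of_compactified_products (I Q Q' : M -> Prop) : size_class Q ->
  (forall J, I J -> cuf J) -> (forall D, infinite D -> Q D -> Q' D) ->
  every_product I (compactified_discrete Q') metrizable -> every_union I Q cuf.
Proof.
move=> SQ Icuf QQ' H.
apply: (every_union_of_products _ _ (compactified_discrete Q') compactified_topology) => //.
- by rewrite /compactified_topology; def.
- move=> D oo X infD QD ooD EX.
  have E U : U ∈ compactified_topology X oo <-> subset U X /\ (oo ∈ U -> finite (diff X U)).
    by rewrite /compactified_topology sepE ?powerE //; def.
  split.
  + exists D, oo; split=> //; split; first exact: QQ'.
    split=> //; split=> [x|U]; first by rewrite EX cupE singE.
    rewrite E; split=> -[sub fin]; split=> // ooU.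
      by exists (diff X U); split; [move=> x; apply: diffE|apply: fin].
    have [C [HC fC]] := fin ooU; apply: (finite_sub _ _ fC) => x.
    by rewrite diffE => /HC.
  + by rewrite E diff_self; split=> // _; exact: finite_empty.
  + move=> x xD; rewrite E; split; first by move=> y; rewrite diffE; case.
    by move=> _; exact: diff_diff_sing.
  + by move=> A; rewrite E => -[_ fin] /fin.
right; apply: every_product_mono H => // X T /metrizable_quasi_metrizable.
exact: quasi_metrizable_first_countable.
Qed.

Section Block.
Context (I Q Q' : M -> Prop).
Hypotheses (SQ : size_class Q) (HI : forall J, countable J -> I J)
  (Icuf : forall J, I J -> cuf J) (QQ' : forall D, infinite D -> Q D -> Q' D)
  (QQ : forall D, Q' D -> Q D).

Let E := every_union countable Q cuf.
Let cofinite_Q X T := cofinite_space X T /\ Q X.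

Lemma union_extends : E -> every_union I Q cuf.
Proof.
have [HQ Qc Qcup _] := SQ => H; apply: (every_union_mono cuf) => //.
by apply: every_union_cuf => //; apply: Qc; exact: countable_empty.
Qed.

Lemma union_restricts : every_union I Q cuf -> E.
Proof. exact: every_union_mono. Qed.

(** E does not mention I, so it links the versions for cuf and for countable products. The instances
    take I and Q to be [cuf] or [countable], and Q' to be [cuf] or [denumerable] according to Q. *)
Lemma block_equivalences :
  [/\ E <-> every_product I cofinite_Q quasi_metrizable,
      E <-> every_product I cofinite_Q first_countable,
      E <-> every_product I cofinite_Q countable_pseudocharacter,
      E <-> every_product I cofinite_Q cuf_pseudocharacter &
      E <-> every_product I (compactified_discrete Q') metrizable].
Proof.
have qm : E -> every_product I cofinite_Q quasi_metrizable.
  by move=> /union_extends; exact: product_cofinite_quasi_metrizable.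
have qf : every_product I cofinite_Q quasi_metrizable -> every_product I cofinite_Q first_countable.
  by apply: every_product_mono => //; exact: quasi_metrizable_first_countable.
have qp : every_product I cofinite_Q quasi_metrizable ->
    every_product I cofinite_Q countable_pseudocharacter.
  by apply: every_product_mono => //; exact: quasi_metrizable_countable_pseudocharacter.
have pc : every_product I cofinite_Q countable_pseudocharacter ->
    every_product I cofinite_Q cuf_pseudocharacter.
  by apply: every_product_mono => //; exact: countable_pseudocharacter_cuf.
have fE : every_product I cofinite_Q first_countable -> E.
  by move=> H; apply: union_restricts; apply: union_of_cofinite_products => //; right.
have cE : every_product I cofinite_Q cuf_pseudocharacter -> E.
  by move=> H; apply: union_restricts; apply: union_of_cofinite_products => //; left.
split; try tauto.
split=> [/union_extends H|H].
  exact: (product_compactified_metrizable _ Q).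
by apply: union_restricts; apply: (union_of_compactified_products _ _ Q').
Qed.

End Block.

(** Both families of spaces coincide, because a cofinite space on a cuf set is quasi-metrizable. *)
Lemma qm_cofinite_products (Q : M -> Prop) (R : M -> M -> Prop) :
  (forall X, Q X -> cuf X) ->
  (forall X T, R X T <-> cofinite_space X T /\ Q X /\ quasi_metrizable X T) ->
  every_product countable R quasi_metrizable <->
  every_product countable (fun X T => cofinite_space X T /\ Q X) quasi_metrizable.
Proof.
move=> Qcuf HR; split; apply: every_product_mono => // X T.
  move=> [HX HQ]; apply/HR; split=> //; split=> //.
  by apply: cuf_cofinite_quasi_metrizable => //; apply: Qcuf.
by move=> /HR [HX [HQ _]].
Qed.

End Equivalences.

Theorem corollary3p25 (M : structure) (HM : models_ZF M) :
  (* (i) *)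
  [<-> @every_union M cuf cuf cuf;
       @every_union M countable cuf cuf;
       @every_product M countable qm_cofinite quasi_metrizable;
       @every_product M cuf cuf_cofinite quasi_metrizable;
       @every_product M cuf cuf_cofinite first_countable;
       @every_product M cuf cuf_cofinite countable_pseudocharacter;
       @every_product M cuf cuf_cofinite cuf_pseudocharacter;
       @every_product M cuf (compactified_discrete cuf) metrizable]
  /\
  (* (ii) *)
  [<-> @every_union M countable countable cuf;
       @every_product M countable qm_countable_cofinite quasi_metrizable;
       @every_product M cuf countable_cofinite quasi_metrizable;
       @every_product M cuf countable_cofinite first_countable;
       @every_product M cuf countable_cofinite countable_pseudocharacter;
       @every_product M cuf countable_cofinite cuf_pseudocharacter;
       @every_product M cuf (compactified_discrete denumerable) metrizable]
  /\
  (* (iii) for (i) *)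
  [<-> @every_union M cuf cuf cuf;
       @every_union M countable cuf cuf;
       @every_product M countable qm_cofinite quasi_metrizable;
       @every_product M countable cuf_cofinite quasi_metrizable;
       @every_product M countable cuf_cofinite first_countable;
       @every_product M countable cuf_cofinite countable_pseudocharacter;
       @every_product M countable cuf_cofinite cuf_pseudocharacter;
       @every_product M countable (compactified_discrete cuf) metrizable]
  /\
  (* (iii) for (ii) *)
  [<-> @every_union M countable countable cuf;
       @every_product M countable qm_countable_cofinite quasi_metrizable;
       @every_product M countable countable_cofinite quasi_metrizable;
       @every_product M countable countable_cofinite first_countable;
       @every_product M countable countable_cofinite countable_pseudocharacter;
       @every_product M countable countable_cofinite cuf_pseudocharacter;
       @every_product M countable (compactified_discrete denumerable)
         metrizable].
Proof.
have [a1 a2 a3 a4 a5] := block_equivalences cuf cuf cuf size_class_cuf countable_cuf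
  (fun J H => H) (fun D _ H => H) (fun D H => H).
have [b1 b2 b3 b4 b5] := block_equivalences countable cuf cuf size_class_cuf (fun J H => H)
  countable_cuf (fun D _ H => H) (fun D H => H).
have [c1 c2 c3 c4 c5] := block_equivalences cuf countable denumerable size_class_countable
  countable_cuf (fun J H => H) (fun D => @conj _ _) (fun D => @proj2 _ _).
have [d1 d2 d3 d4 d5] := block_equivalences countable countable denumerable
  size_class_countable (fun J H => H) countable_cuf (fun D => @conj _ _) (fun D => @proj2 _ _).
(* These two pass between countable and cuf index sets in unions of cuf sets, i.e. between (2) and
   (1) of (i). *)
pose proof (union_extends cuf cuf size_class_cuf (fun J H => H)) as u1.
pose proof (union_restricts cuf cuf countable_cuf) as u2.
have q1 : @every_product M countable qm_cofinite quasi_metrizable <->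
    @every_product M countable cuf_cofinite quasi_metrizable.
  refine (qm_cofinite_products cuf qm_cofinite (fun X H => H) _) => X T.
  split=> [[HX HT]|[HX [_ HT]]] //.
  by split=> //; split=> //; apply: (qm_cofinite_cuf X T).
have q2 : @every_product M countable qm_countable_cofinite quasi_metrizable <->
    @every_product M countable countable_cofinite quasi_metrizable.
  by refine (qm_cofinite_products countable qm_countable_cofinite _ _) => //; exact: countable_cuf.
by rewrite /cuf_cofinite /countable_cofinite in q1 q2 *; split; [|split; [|split]]; tfae; tauto.
Qed.
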